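(* Let $(B,g_B)$ and $(F,g_F)$ be Riemannian manifolds of positive dimension with $\dim B+\dim F\ge 4$, let $f:B\to\mathbb{R}^+$ be a smooth positive function on $B$, and let $B\times_f F$ be the warped product, i.e. the manifold $B\times F$ endowed with the Riemannian metric $g=g_B\oplus f^2 g_F$. Then $B\times_f F$ is conformally Osserman if and only if it is locally conformally flat.
   Context: Let $(M,g)$ be a Riemannian manifold of dimension $n\ge 3$ with Levi-Civita connection $\nabla$. The curvature tensor is taken with the sign convention $R(X,Y)=\nabla_{[X,Y]}-[\nabla_X,\nabla_Y]$, and $R(X,Y,Z,V)=g(R(X,Y)Z,V)$. For an orthonormal basis $\{E_i\}$ the Ricci tensor and scalar curvature are $\rho(X,Y)=\sum_i R(X,E_i,Y,E_i)$ and $\tau=\sum_i\rho(E_i,E_i)$. The Weyl tensor $W$ is defined by $R=C\bullet g+W$, where $C=\frac{1}{n-2}\left(\rho-\frac{\tau}{2(n-1)}g\right)$ is the Schouten tensor and $(C\bullet g)(X,Y,Z,V)=C(X,Z)g(Y,V)+C(Y,V)g(X,Z)-C(X,V)g(Y,Z)-C(Y,Z)g(X,V)$. The conformal Jacobi operator is $\mathcal{J}_W(X)Y=W(X,Y)X$. $(M,g)$ is conformally Osserman if for every $p\in M$ the eigenvalues (with multiplicities) of $\mathcal{J}_W(x)$ on $T_pM$ do not depend on the unit vector $x\in S_p=\{x\in T_pM: g_p(x,x)=1\}$ (they may depend on $p$). $(M,g)$ is locally conformally flat if every point has a neighbourhood on which $g$ is conformal to a flat metric. *)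

(* Defs.v *)
From HB Require Import structures.
From mathcomp Require Import all_boot all_order all_algebra.
From mathcomp Require Import all_classical all_reals all_analysis.
Set Implicit Arguments.
Unset Strict Implicit.
Unset Printing Implicit Defensive.
Import Order.TTheory GRing.Theory Num.Theory.
Import numFieldNormedType.Exports.
Local Open Scope classical_set_scope.
Local Open Scope ring_scope.

(* Vectors of R^n are row vectors; 'e_i is the i-th coordinate vector. *)
Notation "''e_' i" := (delta_mx 0 i) (at level 8, i at level 2, format "''e_' i").

Section Calculus.
Variables (R : realType) (n : nat).

(* C^k on U, meant for open U. *)
Fixpoint Ck (k : nat) (W : normedModType R) (U : set 'rV[R]_n)
    (f : 'rV[R]_n -> W) : Prop :=
  (forall x, U x -> {for x, continuous f}) /\
  if k is k'.+1 then
    forall i : 'I_n, (forall x, U x -> derivable f x 'e_i) /\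
                     Ck k' U (fun x => 'D_('e_i) f x)
  else True.

Definition smooth_on (W : normedModType R) (U : set 'rV[R]_n)
  (f : 'rV[R]_n -> W) : Prop := forall k, Ck k U f.

End Calculus.

(* Riemannian geometry of a metric given by its Gram matrix
   g x = (g_x(e_i, e_j))_ij on an open subset of R^n. *)
Section LocalGeometry.
Variables (R : realType) (n : nat).
Implicit Types (g : 'rV[R]_n -> 'M[R]_n) (x u v w z : 'rV[R]_n).
Implicit Types (X Y Z : 'rV[R]_n -> 'rV[R]_n).

Definition inner (G : 'M[R]_n) u v : R := (u *m G *m v^T) 0 0.

(* Koszul formula for constant (hence commuting) vector fields u, v, w:
   the value of g(nabla_u v, w) at x. *)
Definition koszul g x u v w : R :=
  2^-1 * ('D_u (fun y => inner (g y) v w) x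
          + 'D_v (fun y => inner (g y) u w) x
          - 'D_w (fun y => inner (g y) u v) x).

(* The vector representing a linear form through the scalar product G. *)
Definition sharp (G : 'M[R]_n) (a : 'rV[R]_n -> R) : 'rV[R]_n :=
  (\row_k a 'e_k) *m invmx G.

Definition christoffel g x u v : 'rV[R]_n := sharp (g x) (koszul g x u v).

Definition nabla g X Y : 'rV[R]_n -> 'rV[R]_n :=
  fun x => 'D_(X x) Y x + christoffel g x (X x) (Y x).

Definition lie_bracket X Y : 'rV[R]_n -> 'rV[R]_n :=
  fun x => 'D_(X x) Y x - 'D_(Y x) X x.

(* R(X,Y) = nabla_[X,Y] - [nabla_X, nabla_Y]; this sign makes
   R(X,Y,X,Y) positive on round spheres. *)
Definition curvature_op g X Y Z : 'rV[R]_n -> 'rV[R]_n :=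
  fun x => nabla g (lie_bracket X Y) Z x
           - (nabla g X (nabla g Y Z) x - nabla g Y (nabla g X Z) x).

(* The curvature operator is tensorial, so tangent vectors at x may be extended
   by constant vector fields. *)
Definition curvature g x u v w : 'rV[R]_n :=
  curvature_op g (cst u) (cst v) (cst w) x.

Definition riemann g x u v w z : R := inner (g x) (curvature g x u v w) z.

(* sum_i S(E_i, E_i) for any orthonormal basis E, see mtraceE. *)
Definition mtrace (G : 'M[R]_n) (S : 'rV[R]_n -> 'rV[R]_n -> R) : R :=
  \sum_i \sum_j invmx G i j * S 'e_i 'e_j.

Definition ricci g x u v : R :=
  mtrace (g x) (fun e e' => riemann g x u e v e').

Definition scalar_curvature g x : R := mtrace (g x) (ricci g x).

Definition schouten g x u v : R :=
  (n%:R - 2)^-1 *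
  (ricci g x u v - scalar_curvature g x / (2 * (n%:R - 1)) * inner (g x) u v).

Definition bullet (C h : 'rV[R]_n -> 'rV[R]_n -> R) u v w z : R :=
  C u w * h v z + C v z * h u w - C u z * h v w - C v w * h u z.

Definition weyl g x u v w z : R :=
  riemann g x u v w z - bullet (schouten g x) (inner (g x)) u v w z.

(* J_W(u) v = W(u,v)u, where g(W(u,v)u, z) = W(u,v,u,z). *)
Definition conformal_jacobi g x u v : 'rV[R]_n := sharp (g x) (weyl g x u v u).

Lemma mtraceE (G A E : 'M[R]_n) : E *m G *m E^T = 1%:M ->
  mtrace G (inner A) = \sum_i inner A (row i E) (row i E).
Proof.
move=> EGE.
have GE : (E^T *m E) *m G = 1%:M.
  by rewrite -mulmxA; apply: mulmx1C; rewrite EGE.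
have iG : invmx G = E^T *m E.
  have uG : G \in unitmx by case/mulmx1_unit : GE.
  by apply: (can_inj (mulmxK uG)); rewrite mulVmx.
transitivity (\tr (A *m (E^T *m E))); last first.
  rewrite mulmxA mxtrace_mulC mulmxA; apply: eq_bigr => i _.
  rewrite /inner -row_mul [RHS]mxE [LHS]mxE.
  by apply: eq_bigr => j _; rewrite !mxE.
rewrite /mtrace iG; apply: eq_bigr => i _; rewrite mxE.
apply: eq_bigr => j _; rewrite mulrC; congr (_ * _).
  by rewrite /inner -rowE trmx_delta -colE !mxE.
by rewrite !mxE; apply: eq_bigr => k _; rewrite !mxE mulrC.
Qed.

End LocalGeometry.

(* from_chart only matters on chart_img. *)
Record chart (R : realType) (M : topologicalType) (n : nat) := Chart {
  chart_dom : set M;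
  chart_img : set 'rV[R]_n;
  to_chart : M -> 'rV[R]_n;
  from_chart : 'rV[R]_n -> M }.

Record is_chart (R : realType) (M : topologicalType) (n : nat)
    (c : chart R M n) : Prop := IsChart {
  chart_dom_open : open (chart_dom c);
  chart_img_open : open (chart_img c);
  to_chart_img : forall p, chart_dom c p -> chart_img c (to_chart c p);
  from_chart_dom : forall x, chart_img c x -> chart_dom c (from_chart c x);
  to_chartK : forall p, chart_dom c p -> from_chart c (to_chart c p) = p;
  from_chartK : forall x, chart_img c x -> to_chart c (from_chart c x) = x;
  to_chart_continuous :
    forall p, chart_dom c p -> {for p, continuous (to_chart c)};
  from_chart_continuous :
    forall x, chart_img c x -> {for x, continuous (from_chart c)} }.

(* A topological space with an indexed family of charts and, in each chart, the
   Gram matrix of the metric in that chart; the axioms are in is_riemannian. *)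
Record riemannian_data (R : realType) (n : nat) := RiemannianData {
  carrier :> topologicalType;
  chart_index : Type;
  chart_at : chart_index -> chart R carrier n;
  metric : chart_index -> 'rV[R]_n -> 'M[R]_n }.

Section Manifolds.
Variables (R : realType) (n : nat).
Implicit Types (M : riemannian_data R n).

Definition transition M (i j : chart_index M) : 'rV[R]_n -> 'rV[R]_n :=
  to_chart (chart_at j) \o from_chart (chart_at i).

(* Image in the chart i of the part of U that this chart covers. *)
Definition chart_img_of M (U : set M) (i : chart_index M) : set 'rV[R]_n :=
  chart_img (chart_at i) `&` from_chart (chart_at i) @^-1` U.

Record is_riemannian M : Prop := IsRiemannian {
  riem_hausdorff : hausdorff_space M;
  riem_second_countable : @second_countable M;
  riem_chart : forall i : chart_index M, is_chart (chart_at i);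
  riem_cover : forall p : M, exists i : chart_index M, chart_dom (chart_at i) p;
  riem_transition : forall i j : chart_index M,
    smooth_on (chart_img_of (chart_dom (chart_at j)) i) (transition i j);
  riem_smooth : forall i : chart_index M,
    smooth_on (chart_img (chart_at i)) (metric i);
  riem_sym : forall (i : chart_index M) x, chart_img (chart_at i) x ->
    (metric i x)^T = metric i x;
  riem_pos : forall (i : chart_index M) x u, chart_img (chart_at i) x ->
    u != 0 -> 0 < inner (metric i x) u u;
  riem_compat : forall (i j : chart_index M) x,
    chart_img_of (chart_dom (chart_at j)) i x ->
    forall a b : 'I_n,
    metric i x a b = inner (metric j (transition i j x))
      ('D_('e_a) (transition i j) x) ('D_('e_b) (transition i j) x) }.

Definition smooth_fun M (U : set M) (f : M -> R) : Prop :=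
  forall i : chart_index M,
    smooth_on (chart_img_of U i) (f \o from_chart (chart_at i)).

(* T_pM is R^n through a chart i around p. *)
Definition conformally_osserman M : Prop :=
  forall (p : M) (i : chart_index M), chart_dom (chart_at i) p ->
  let g := metric i in
  let x := to_chart (chart_at i) p in
  forall u v, inner (g x) u u = 1 -> inner (g x) v v = 1 ->
  forall a : R,
    \rank (eigenspace (lin1_mx (conformal_jacobi g x u)) a) =
    \rank (eigenspace (lin1_mx (conformal_jacobi g x v)) a).

Definition locally_conformally_flat M : Prop :=
  forall p : M, exists U : set M, exists h : M -> R,
  [/\ open U, U p, smooth_fun U h, (forall q, U q -> 0 < h q) &
   forall (i : chart_index M) x, chart_img_of U i x ->
   forall u v w,
     curvature (fun y => h (from_chart (chart_at i) y) *: metric i y) x u v w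
     = 0].

End Manifolds.

Section WarpedProduct.
Variables (R : realType) (m n : nat).

Definition prod_chart (M N : topologicalType) (c : chart R M m)
    (d : chart R N n) : chart R (M * N)%type (m + n) :=
  Chart (chart_dom c `*` chart_dom d)
    [set x | chart_img c (lsubmx x) /\ chart_img d (rsubmx x)]
    (fun p => row_mx (to_chart c p.1) (to_chart d p.2))
    (fun x => (from_chart c (lsubmx x), from_chart d (rsubmx x))).

Definition warped_product (B : riemannian_data R m) (F : riemannian_data R n)
    (f : B -> R) : riemannian_data R (m + n) :=
  @RiemannianData R (m + n) (B * F)%type (chart_index B * chart_index F)%type
    (fun ij => prod_chart (chart_at ij.1) (chart_at ij.2))
    (fun ij x => block_mx
       (metric ij.1 (lsubmx x)) 0
       0 (f (from_chart (chart_at ij.1) (lsubmx x)) ^+ 2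
          *: metric ij.2 (rsubmx x))).

End WarpedProduct.
Arguments warped_product {R m n} B F f.

Section CkTheory.
Variables (R : realType) (n : nat).
Implicit Types (U V : set 'rV[R]_n) (k : nat).

Lemma Ck_ext k (W : normedModType R) U (f g : 'rV[R]_n -> W) :
  open U -> (forall x, U x -> f x = g x) -> Ck k U f -> Ck k U g.
Proof.
move=> oU; elim: k f g => [|k IH] f g fg.
all: have nfg x : U x -> \near x, f x = g x by
  move=> Ux; apply: filterS (open_nbhs_nbhs (conj oU Ux)) => y /fg.
all: have cg : (forall x, U x -> {for x, continuous f}) ->
    forall x, U x -> {for x, continuous g} by
  move=> cf x Ux; rewrite /prop_for /continuous_at -fg//;
  exact: cvg_trans (near_eq_cvg (nfg x Ux)) (cf x Ux).
- by move=> [cf _]; split=> //; exact: cg.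
- move=> [cf df]; split=> [|i]; first exact: cg.
  have [dfi Ckf] := df i; split.
    by move=> x Ux; apply: near_eq_derivable (dfi _ Ux); exact: nfg.
  apply: IH Ckf => x Ux; apply: near_eq_derive; exact: nfg.
Qed.

Lemma Ck_sub k (W : normedModType R) U V (f : 'rV[R]_n -> W) :
  V `<=` U -> Ck k U f -> Ck k V f.
Proof.
move=> VU; elim: k f => [|k IH] f [cf df]; split => //.
- by move=> x /VU; exact: cf.
- by move=> x /VU; exact: cf.
- move=> i; have [di Ci] := df i; split; first by move=> x /VU; exact: di.
  exact: IH.
Qed.

Lemma CkS k (W : normedModType R) U (f : 'rV[R]_n -> W) :
  Ck k.+1 U f -> Ck k U f.
Proof.
elim: k f => [|k IH] f [cf df]; split => // i.
by have [di Ci] := df i; split => //; exact: IH.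
Qed.

Lemma Ck_cst k (W : normedModType R) U (w : W) : Ck k U (fun _ => w).
Proof.
elim: k w => [|k IH] w; split => //.
- by move=> x _; exact: cst_continuous.
- by move=> x _; exact: cst_continuous.
- move=> i; split; first by move=> x _; exact: derivable_cst.
  by under eq_fun do rewrite derive_cst; exact: IH.
Qed.

Lemma CkD k (W : normedModType R) U (f g : 'rV[R]_n -> W) : open U ->
  Ck k U f -> Ck k U g -> Ck k U (f + g).
Proof.
move=> oU; elim: k f g => [|k IH] f g [cf df] [cg dg]; split=> //.
- by move=> x Ux; apply: continuousD; [exact: cf|exact: cg].
- by move=> x Ux; apply: continuousD; [exact: cf|exact: cg].
- move=> i; have [dfi Cfi] := df i; have [dgi Cgi] := dg i; split.
    by move=> x Ux; apply: derivableD; [exact: dfi|exact: dgi].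
  apply: Ck_ext (IH _ _ Cfi Cgi) => // x Ux.
  by rewrite deriveD//; [exact: dfi|exact: dgi].
Qed.

Lemma CkM k U (f g : 'rV[R]_n -> R) : open U ->
  Ck k U f -> Ck k U g -> Ck k U (f * g).
Proof.
move=> oU; elim: k f g => [|k IH] f g; move=> Cf Cg.
all: have [cf df] := Cf; have [cg dg] := Cg; split=> //.
- by move=> x Ux; apply: continuousM; [exact: cf|exact: cg].
- by move=> x Ux; apply: continuousM; [exact: cf|exact: cg].
- move=> i; have [dfi Cfi] := df i; have [dgi Cgi] := dg i; split.
    by move=> x Ux; apply: derivableM; [exact: dfi|exact: dgi].
  have := CkD oU (IH _ _ (CkS Cf) Cgi) (IH _ _ (CkS Cg) Cfi).
  apply: Ck_ext => // x Ux.
  by rewrite deriveM//; [exact: dfi|exact: dgi].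
Qed.

Lemma continuous_mxP (T : topologicalType) p q (f : T -> 'M[R]_(p, q)) x :
  {for x, continuous f} <-> forall i j, {for x, continuous (fun y => f y i j)}.
Proof.
split=> [cf i j|cf].
  apply: (@continuous_comp _ _ _ f (fun M : 'M[R]_(p,q) => M i j)) => //.
  exact: coord_continuous.
apply/cvg_ballP => e e0.
have : \forall y \near x, forall i j, ball (f x i j) e (f y i j).
  apply: filter_forall => i; apply: filter_forall => j.
  exact: (cvg_ball (cf i j)).
by apply: filterS => y H; split.
Qed.

Lemma Ck_mxP k p q U (f : 'rV[R]_n -> 'M[R]_(p, q)) : open U ->
  Ck k U f <-> forall i j, Ck k U (fun x => f x i j).
Proof.
move=> oU; elim: k f => [|k IH] f.
  split=> [[cf _] i j|C].
    by split=> // x Ux; exact: (continuous_mxP f x).1 (cf x Ux) i j.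
  by split=> // x Ux; apply/continuous_mxP => i j; have [Cij _] := C i j; exact: Cij.
split=> [[cf df] i j|C].
  split=> [x Ux|a].
    exact: (continuous_mxP f x).1 (cf x Ux) i j.
  have [dfa Cfa] := df a; split.
    by move=> x Ux; exact: (derivable_mxP f x _).1 (dfa x Ux) i j.
  apply: Ck_ext ((IH _).1 Cfa i j) => // x Ux.
  by rewrite derive_mx ?mxE//; exact: dfa.
have df a x : U x -> derivable f x 'e_a.
  by move=> Ux; apply/derivable_mxP => i j; have [_ /(_ a)[Cij _]] := C i j; exact: Cij.
split=> [x Ux|a].
  by apply/continuous_mxP => i j; have [Cij _] := C i j; exact: Cij.
split; first exact: df.
apply/IH => i j; have [_ /(_ a)[_]] := C i j.
by apply: Ck_ext => // x Ux; rewrite derive_mx ?mxE//; exact: df.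
Qed.

End CkTheory.

Lemma derive_lin (R : realType) p q (W : normedModType R)
  (L : {linear 'rV[R]_p -> 'rV[R]_q}) (f : 'rV[R]_q -> W) x v :
  'D_v (f \o L) x = 'D_(L v) f (L x).
Proof. by rewrite /derive/=; under eq_fun do rewrite linearP. Qed.

Lemma derivable_lin (R : realType) p q (W : normedModType R)
  (L : {linear 'rV[R]_p -> 'rV[R]_q}) (f : 'rV[R]_q -> W) x v :
  derivable f (L x) (L v) -> derivable (f \o L) x v.
Proof. by rewrite /derivable/=; under [in X in _ -> X]eq_fun do rewrite linearP. Qed.

Lemma derivable0 (R : realType) (V W : normedModType R) (f : V -> W) x :
  derivable f x 0.
Proof.
rewrite /derivable; under eq_fun do rewrite /= scaler0 add0r subrr scaler0.
exact: is_cvg_cst.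
Qed.

Lemma derive0 (R : realType) (V W : normedModType R) (f : V -> W) x :
  'D_0 f x = 0.
Proof.
rewrite /derive; under eq_fun do rewrite /= scaler0 add0r subrr scaler0.
exact: lim_cst.
Qed.

Lemma Ck_lin (R : realType) p q (W : normedModType R) k
  (L : {linear 'rV[R]_p -> 'rV[R]_q}) (U : set 'rV[R]_q) (f : 'rV[R]_q -> W) :
  continuous L -> (forall i, L 'e_i = 0 \/ exists j, L 'e_i = 'e_j) ->
  Ck k U f -> Ck k (L @^-1` U) (f \o L).
Proof.
move=> cL Le; elim: k f => [|k IH] f [cf df]; split=> //.
- by move=> x Ux; apply: continuous_comp; [exact: cL|exact: cf].
- by move=> x Ux; apply: continuous_comp; [exact: cL|exact: cf].
- move=> i; split=> [x Ux|].
    apply: derivable_lin; case: (Le i) => [->|[j ->]]; first exact: derivable0.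
    by apply: (df j).1.
  rewrite (_ : (fun x => _) = (fun y => 'D_(L 'e_i) f y) \o L); last first.
    by apply/funext => x; exact: derive_lin.
  apply: IH; case: (Le i) => [->|[j ->]]; last by case: (df j).
  rewrite (_ : (fun x => _) = fun _ => 0); first exact: Ck_cst.
  by apply/funext => y; exact: derive0.
Qed.

Lemma open_setX (S T : topologicalType) (A : set S) (B : set T) :
  open A -> open B -> open (A `*` B).
Proof.
move=> oA oB; rewrite openE => -[a b] [/= Aa Bb].
by exists (A, B) => //; split; exact: open_nbhs_nbhs.
Qed.

Lemma hausdorff_prod (S T : topologicalType) :
  hausdorff_space S -> hausdorff_space T -> hausdorff_space (S * T)%type.
Proof.
move=> hS hT [p1 p2] [q1 q2] pq.
have nX (A : set S) (B : set T) (s : S) (t : T) :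
    nbhs s A -> nbhs t B -> nbhs (s, t) (A `*` B).
  by move=> sA tB; exists (A, B).
congr pair.
- apply: hS => A B pA qB.
  have [[a b] [/= [Aa _] [Ba _]]] := pq (A `*` setT) (B `*` setT)
    (nX _ _ _ _ pA filterT) (nX _ _ _ _ qB filterT).
  by exists a.
- apply: hT => A B pA qB.
  have [[a b] [/= [_ Ab] [_ Bb]]] := pq (setT `*` A) (setT `*` B)
    (nX _ _ _ _ filterT pA) (nX _ _ _ _ filterT qB).
  by exists b.
Qed.

Lemma second_countable_prod (S T : topologicalType) :
  @second_countable S -> @second_countable T -> @second_countable (S * T)%type.
Proof.
move=> [B cB [oB bB]] [C cC [oC bC]].
exists [set DE.1 `*` DE.2 | DE in B `*` C].
  by apply: (sub_countable (card_image_le _ _)); exact: countableX.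
split=> [_ [[D E] [/= BD CE] <-]|[s t]].
  by apply: open_setX; [exact: oB|exact: oC].
move=> A /= [[P Q] [/= sP tQ] PQA].
have [D [BD Ds] DP] := bB s P sP.
have [E [CE Et] EQ] := bC t Q tQ.
exists (D `*` E) => /=.
  by split=> //; exists (D, E).
by move=> [a b] [/= Da Eb]; apply: PQA; split; [exact: DP|exact: EQ].
Qed.

Section Warped.
Variables (R : realType) (m n : nat).
Implicit Types (x : 'rV[R]_(m + n)).

Lemma lsubmx_e (i : 'I_(m + n)) :
  lsubmx ('e_i : 'rV[R]_(m + n)) = 0 \/
  exists j, lsubmx ('e_i : 'rV[R]_(m + n)) = 'e_j.
Proof.
case: (split_ordP i) => j ->; [right; exists j|left]; apply/rowP => k.
  by rewrite !mxE !eqxx/= eq_lshift.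
by rewrite !mxE !eqxx/= eq_lrshift.
Qed.

Lemma rsubmx_e (i : 'I_(m + n)) :
  rsubmx ('e_i : 'rV[R]_(m + n)) = 0 \/
  exists j, rsubmx ('e_i : 'rV[R]_(m + n)) = 'e_j.
Proof.
case: (split_ordP i) => j ->; [left|right; exists j]; apply/rowP => k.
  by rewrite !mxE !eqxx/= eq_rlshift.
by rewrite !mxE !eqxx/= eq_rshift.
Qed.

Lemma Ck_lsubmx k (W : normedModType R) U (f : 'rV[R]_m -> W) :
  Ck k U f -> Ck k [set x : 'rV[R]_(m + n) | U (lsubmx x)]
    (fun x => f (lsubmx x)).
Proof.
apply: (@Ck_lin _ (m + n) m W k (lsubmx : {linear _ -> _})).
  exact: continuous_lsubmx.
exact: lsubmx_e.
Qed.

Lemma Ck_rsubmx k (W : normedModType R) U (f : 'rV[R]_n -> W) :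
  Ck k U f -> Ck k [set x : 'rV[R]_(m + n) | U (rsubmx x)]
    (fun x => f (rsubmx x)).
Proof.
apply: (@Ck_lin _ (m + n) n W k (rsubmx : {linear _ -> _})).
  exact: continuous_rsubmx.
exact: rsubmx_e.
Qed.

Lemma inner_block (A : 'M[R]_m) (D : 'M[R]_n) (u v : 'rV[R]_(m + n)) :
  inner (block_mx A 0 0 D) u v
  = inner A (lsubmx u) (lsubmx v) + inner D (rsubmx u) (rsubmx v).
Proof.
rewrite /inner -{1}(hsubmxK u) -{1}(hsubmxK v) tr_row_mx mul_row_block.
by rewrite !mulmx0 addr0 add0r mul_row_col mxE.
Qed.

Lemma open_chart_img_of (M : riemannian_data R n) (i : chart_index M) U :
  is_chart (chart_at i) -> open U -> open (chart_img_of U i).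
Proof.
move=> ci oU; rewrite openE => x [xi xU].
apply: filterI; first by apply: open_nbhs_nbhs; split=> //; case: ci.
apply: (from_chart_continuous ci xi); exact: open_nbhs_nbhs.
Qed.

End Warped.

Lemma warped_product_riemannian (R : realType) (m n : nat)
    (B : riemannian_data R m) (F : riemannian_data R n) (f : B -> R) :
  is_riemannian B -> is_riemannian F ->
  smooth_fun setT f -> (forall p : B, 0 < f p) ->
  is_riemannian (warped_product B F f).
Proof.
move=> hB hF sf f0.
have oB (i : chart_index B) := chart_img_open (riem_chart hB i).
have oF (i : chart_index F) := chart_img_open (riem_chart hF i).
have oL (U : set 'rV[R]_m) : open U -> open [set x : 'rV[R]_(m + n) | U (lsubmx x)].
  by move=> oU; apply: open_comp => // x _; exact: continuous_lsubmx.
have oR (U : set 'rV[R]_n) : open U -> open [set x : 'rV[R]_(m + n) | U (rsubmx x)].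
  by move=> oU; apply: open_comp => // x _; exact: continuous_rsubmx.
have imgE (i j : chart_index (warped_product B F f)) :
    chart_img_of (chart_dom (chart_at j)) i =
    [set x : 'rV[R]_(m + n) |
        chart_img_of (chart_dom (chart_at j.1)) i.1 (lsubmx x)] `&`
    [set x : 'rV[R]_(m + n) |
        chart_img_of (chart_dom (chart_at j.2)) i.2 (rsubmx x)].
  by apply/seteqP; split=> x /= [] [] /= ? ? [] /= ? ?.
have oT (i j : chart_index (warped_product B F f)) :
    open (chart_img_of (chart_dom (chart_at j)) i).
  rewrite imgE; apply: openI; [apply: oL|apply: oR]; apply: open_chart_img_of.
  - exact: riem_chart.
  - exact: (chart_dom_open (riem_chart hB j.1)).
  - exact: riem_chart.
  - exact: (chart_dom_open (riem_chart hF j.2)).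
have sT (i j : chart_index (warped_product B F f)) :
    smooth_on (chart_img_of (chart_dom (chart_at j)) i) (transition i j).
  move=> k; apply/(Ck_mxP _ _ (oT i j)) => a b; rewrite ord1 {a}.
  rewrite imgE; case: (split_ordP b) => {}b ->.
    apply: (Ck_sub (@subIsetl _ _ _)).
    rewrite (_ : (fun x => transition i j x 0 (lshift n b)) =
      (fun x => transition i.1 j.1 (lsubmx x) 0 b)); last first.
      by apply/funext => x; rewrite /transition/= row_mxEl.
    apply: (@Ck_lsubmx _ _ _ k _ _ (fun y => transition i.1 j.1 y 0 b)).
    apply: (Ck_mxP k _ _).1; last exact: (riem_transition hB).
    apply: open_chart_img_of; first exact: riem_chart.
    exact: (chart_dom_open (riem_chart hB j.1)).
  apply: (Ck_sub (@subIsetr _ _ _)).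
  rewrite (_ : (fun x => transition i j x 0 (rshift m b)) =
    (fun x => transition i.2 j.2 (rsubmx x) 0 b)); last first.
    by apply/funext => x; rewrite /transition/= row_mxEr.
  apply: (@Ck_rsubmx _ _ _ k _ _ (fun y => transition i.2 j.2 y 0 b)).
  apply: (Ck_mxP k _ _).1; last exact: (riem_transition hF).
  apply: open_chart_img_of; first exact: riem_chart.
  exact: (chart_dom_open (riem_chart hF j.2)).
split.
- by apply: hausdorff_prod; exact: riem_hausdorff.
- by apply: second_countable_prod; exact: riem_second_countable.
- move=> [i j] /=; have ci := riem_chart hB i; have cj := riem_chart hF j.
  split=> /=.
  + by apply: open_setX; apply: chart_dom_open.
  + by apply: openI; [exact: oL|exact: oR].
  + move=> [p q] /= [pi qj]; rewrite row_mxKl row_mxKr.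
    by split; apply: to_chart_img.
  + by move=> x /= [xi xj]; split; apply: from_chart_dom.
  + by move=> [p q] /= [pi qj]; rewrite row_mxKl row_mxKr !to_chartK.
  + by move=> x /= [xi xj]; rewrite !from_chartK// hsubmxK.
  + move=> [p q] /= [pi qj]; apply/continuous_mxP => a b.
    rewrite ord1; case: (split_ordP b) => {}b ->.
      rewrite (_ : (fun y : B * F => row_mx (to_chart (chart_at i) y.1)
        (to_chart (chart_at j) y.2) 0 (lshift n b)) =
        (fun y => to_chart (chart_at i) y.1 0 b)); last first.
        by apply/funext => y; rewrite row_mxEl.
      apply: (@continuous_comp _ _ _ fst (fun y => to_chart (chart_at i) y 0 b)).
        exact: cvg_fst.
      by apply: (continuous_mxP _ _).1; exact: to_chart_continuous.
    rewrite (_ : (fun y : B * F => row_mx (to_chart (chart_at i) y.1)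
        (to_chart (chart_at j) y.2) 0 (rshift m b)) =
        (fun y => to_chart (chart_at j) y.2 0 b)); last first.
      by apply/funext => y; rewrite row_mxEr.
    apply: (@continuous_comp _ _ _ snd (fun y => to_chart (chart_at j) y 0 b)).
      exact: cvg_snd.
    by apply: (continuous_mxP _ _).1; exact: to_chart_continuous.
  + move=> x /= [xi xj].
    have c1 : {for x, continuous (from_chart (chart_at i) \o lsubmx)}.
      apply: continuous_comp; first exact: continuous_lsubmx.
      exact: from_chart_continuous.
    have c2 : {for x, continuous (from_chart (chart_at j) \o rsubmx)}.
      apply: continuous_comp; first exact: continuous_rsubmx.
      exact: from_chart_continuous.
    exact: (cvg_pair c1 c2).
- move=> [p q]; have [i pi] := riem_cover hB p; have [j qj] := riem_cover hF q.
  by exists (i, j).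
- exact: sT.
- move=> [i j] k /=.
  have oij : open [set x : 'rV[R]_(m + n) | chart_img (chart_at i) (lsubmx x) /\
                                  chart_img (chart_at j) (rsubmx x)].
    by apply: openI; [exact: oL|exact: oR].
  apply/(Ck_mxP _ _ oij) => a b.
  case: (split_ordP a) => {}a ->; case: (split_ordP b) => {}b ->.
  + rewrite [X in Ck k _ X](_ : _ =
      (fun x : 'rV[R]_(m + n) => metric i (lsubmx x) a b)); last first.
      by apply/funext => x; rewrite block_mxEul.
    apply: (@Ck_sub _ _ _ _ [set x | chart_img (chart_at i) (lsubmx x)]).
      by move=> x [].
    apply: (@Ck_lsubmx _ _ _ k _ _ (fun y => metric i y a b)).
    by apply: (Ck_mxP k _ _).1; [|exact: riem_smooth].
  + rewrite [X in Ck k _ X](_ : _ = (fun x : 'rV[R]_(m + n) => 0)); last first.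
      by apply/funext => x; rewrite block_mxEur mxE.
    exact: Ck_cst.
  + rewrite [X in Ck k _ X](_ : _ = (fun x : 'rV[R]_(m + n) => 0)); last first.
      by apply/funext => x; rewrite block_mxEdl mxE.
    exact: Ck_cst.
  + rewrite [X in Ck k _ X](_ : _ =
      (fun x : 'rV[R]_(m + n) => f (from_chart (chart_at i) (lsubmx x)) *
         f (from_chart (chart_at i) (lsubmx x)) *
         metric j (rsubmx x) a b)); last first.
      by apply/funext => x; rewrite block_mxEdr mxE expr2.
    have Cf : Ck k [set x : 'rV[R]_(m + n) | chart_img (chart_at i) (lsubmx x) /\
                                  chart_img (chart_at j) (rsubmx x)]
        (fun x => f (from_chart (chart_at i) (lsubmx x))).
      apply: (@Ck_sub _ _ _ _ [set x | chart_img (chart_at i) (lsubmx x)]).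
        by move=> x [].
      apply: (@Ck_lsubmx _ _ _ k _ _ (f \o from_chart (chart_at i))).
      by have := sf i k; rewrite /chart_img_of preimage_setT setIT.
    apply: (CkM oij); first exact: CkM.
    apply: (@Ck_sub _ _ _ _ [set x | chart_img (chart_at j) (rsubmx x)]).
      by move=> x [].
    apply: (@Ck_rsubmx _ _ _ k _ _ (fun y => metric j y a b)).
    by apply: (Ck_mxP k _ _).1; [|exact: riem_smooth].
- move=> [i j] x /= [xi xj]; rewrite tr_block_mx !trmx0 linearZ/=.
  by rewrite (riem_sym hB)// (riem_sym hF).
- move=> [i j] x u /= [xi xj] u0; rewrite inner_block.
  have sc c (D : 'M[R]_n) v w : inner (c *: D) v w = c * inner D v w.
    by rewrite /inner -scalemxAr -scalemxAl mxE.
  have fx := exprn_gt0 2 (f0 (from_chart (chart_at i) (lsubmx x))).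
  have i0 p (G : 'M[R]_p) : inner G 0 0 = 0 by rewrite /inner !mul0mx mxE.
  rewrite sc; have [ul|ul] := eqVneq (lsubmx u) 0.
    rewrite ul i0 add0r mulr_gt0//; apply: (riem_pos hF) => //.
    apply: contra_neq u0 => ur.
    by rewrite -(hsubmxK u) ul ur row_mx0.
  rewrite ltr_pwDl//; first exact: (riem_pos hB).
  rewrite mulr_ge0 ?(ltW fx)//.
  have [->|ur] := eqVneq (rsubmx u) 0; first by rewrite i0.
  by apply/ltW; apply: (riem_pos hF).
- move=> i j x xij a b.
  have := xij; rewrite imgE => -[/= xB xF].
  have dT c : derivable (transition i j) x 'e_c.
    by have [_ /(_ c)[dc _]] := sT i j 1%N; exact: dc.
  have dB c : lsubmx ('D_('e_c) (transition i j) x) =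
      'D_(lsubmx 'e_c) (transition i.1 j.1) (lsubmx x).
    have d1 : derivable (transition i.1 j.1) (lsubmx x)
        (lsubmx ('e_c : 'rV[R]_(m + n))).
      case: (lsubmx_e R c) => [->|[d ->]]; first exact: derivable0.
      by have [_ /(_ d)[dd _]] := riem_transition hB i.1 j.1 1%N; exact: dd.
    apply/rowP => k; rewrite derive_mx// mxE derive_mx// !mxE.
    rewrite (_ : (fun y => transition i j y 0 (lshift n k)) =
      (fun y => transition i.1 j.1 (lsubmx y) 0 k)); last first.
      by apply/funext => y; rewrite /transition/= row_mxEl.
    exact: (derive_lin lsubmx (fun y => transition i.1 j.1 y 0 k)).
  have dF c : rsubmx ('D_('e_c) (transition i j) x) =
      'D_(rsubmx 'e_c) (transition i.2 j.2) (rsubmx x).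
    have d1 : derivable (transition i.2 j.2) (rsubmx x)
        (rsubmx ('e_c : 'rV[R]_(m + n))).
      case: (rsubmx_e R c) => [->|[d ->]]; first exact: derivable0.
      by have [_ /(_ d)[dd _]] := riem_transition hF i.2 j.2 1%N; exact: dd.
    apply/rowP => k; rewrite derive_mx// mxE derive_mx// !mxE.
    rewrite (_ : (fun y => transition i j y 0 (rshift m k)) =
      (fun y => transition i.2 j.2 (rsubmx y) 0 k)); last first.
      by apply/funext => y; rewrite /transition/= row_mxEr.
    exact: (derive_lin rsubmx (fun y => transition i.2 j.2 y 0 k)).
  rewrite inner_block !dB !dF /= row_mxKl row_mxKr.
  have le (c : 'I_m) : lsubmx ('e_(lshift n c) : 'rV[R]_(m + n)) = 'e_c.
    by apply/rowP => k; rewrite !mxE !eqxx/= eq_lshift.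
  have re (c : 'I_n) : rsubmx ('e_(rshift m c) : 'rV[R]_(m + n)) = 'e_c.
    by apply/rowP => k; rewrite !mxE !eqxx/= eq_rshift.
  have le0 (c : 'I_n) : lsubmx ('e_(rshift m c) : 'rV[R]_(m + n)) = 0.
    by apply/rowP => k; rewrite !mxE !eqxx/= eq_lrshift.
  have re0 (c : 'I_m) : rsubmx ('e_(lshift n c) : 'rV[R]_(m + n)) = 0.
    by apply/rowP => k; rewrite !mxE !eqxx/= eq_rlshift.
  have i0l p (G : 'M[R]_p) v : inner G 0 v = 0 by rewrite /inner !mul0mx mxE.
  have i0r p (G : 'M[R]_p) v : inner G v 0 = 0.
    by rewrite /inner trmx0 mulmx0 mxE.
  have sc c (D : 'M[R]_n) v w : inner (c *: D) v w = c * inner D v w.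
    by rewrite /inner -scalemxAr -scalemxAl mxE.
  have fE : from_chart (chart_at j.1) (transition i.1 j.1 (lsubmx x)) =
            from_chart (chart_at i.1) (lsubmx x).
    by rewrite /transition/= (to_chartK (riem_chart hB j.1))//; case: xB.
  rewrite sc; case: (split_ordP a) => {}a ->; case: (split_ordP b) => {}b ->.
  + by rewrite block_mxEul !le !re0 derive0 i0l mulr0 addr0 -(riem_compat hB).
  + by rewrite block_mxEur mxE re0 le0 !derive0 i0l i0r mulr0 addr0.
  + by rewrite block_mxEdl mxE re0 le0 !derive0 i0l i0r mulr0 addr0.
  + rewrite block_mxEdr mxE !le0 !re derive0 i0l add0r -(riem_compat hF)//.
    by rewrite -/(transition i.1 j.1 (lsubmx x)) fE.
Qed.

(* Main.v *)
(* Both directions rest on the conformal change formula R_hg = h (R_g - P . g), P a symmetric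
   2-tensor and . the product called bullet: it shows that a conformally flat metric has
   vanishing Weyl tensor, hence vanishing conformal Jacobi operators.

   Conversely the warped metric is f^2 times the product of f^-2 g_B and g_F, so in an
   orthonormal basis adapted to the splitting W = A - S . g, where A vanishes unless all four
   indices lie on the same side. The Osserman condition makes the trace of J_W(x)^2 equal to
   K |x|^4; polarising it at e_i + s e_j with i and j on different sides gives
   |J_W(e_i) - J_W(e_j)|^2 = |W(e_i, ., e_j, .) + W(e_j, ., e_i, .)|^2. The right-hand side and
   the mixed entries of the left-hand side only involve S and cancel, so the other entries of
   J_W(e_i) and J_W(e_j) agree. Together with the trace condition this kills S off the
   diagonal and every S_ii + S_jj, hence J_W(e_i) = 0, K = 0 and finally W = 0.

   When W = 0 in dimension at least 4, the contracted second Bianchi identity makes the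
   Schouten tensor P a Codazzi tensor. The linear system
     ds = g(m, .),  nabla m = - s P + r g,  dr = - P(m, .)
   is then flat, and by the Frobenius theorem has a local solution starting at (1, 0, 0). It
   satisfies g(m, m) = 2 s r, and s^-2 g is flat. Flatness is transported to the other charts
   by naturality of the curvature. *)
From HB Require Import structures.
Require Import Defs.
From mathcomp Require Import all_boot all_order all_algebra.
From mathcomp Require Import all_classical all_reals all_analysis.
From mathcomp Require Import ring lra.
From mathcomp.real_closed Require complex.
Set Implicit Arguments.
Unset Strict Implicit.
Unset Printing Implicit Defensive.
Import Order.TTheory GRing.Theory Num.Theory.
Import numFieldNormedType.Exports.
Local Open Scope classical_set_scope.
Local Open Scope ring_scope.

(** * Differential calculus on R^n *)

(** The trace of J_W(x)^2 is preferred to the eigenvalues because it is a quartic polynomial in x: a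
    value K on the unit sphere extends by homogeneity and can be polarised. The dimension enters
    with two strengths. The algebraic part needs three indices, so that one factor offers at least
    two directions while the other may be a curve. The Codazzi property needs four: the contracted
    Bianchi identity carries the factor n - 3, and in dimension 3 a vanishing Weyl tensor says
    nothing about conformal flatness. Flatness of h g is a Riccati-type equation for the gradient of
    ln h. With h = s^-2 and the extra unknowns m, r it becomes linear, so solutions exist along
    whole rays without blow-up, and the quadratic relation g(m, m) = 2 s r only has to hold at the
    starting point, the system preserving it. [smooth_on] speaks of iterated partial derivatives
    only; hence total differentiability, derivatives along arbitrary vectors and the commutation of
    second derivatives come first. *)

Section MatrixNorm.
Variables (R : realType) (p q : nat).

Lemma entry_le_norm (A : 'M[R]_(p, q)) i j : `|A i j| <= `|A|.
Proof.
rewrite [leRHS]/Num.Def.normr/= mx_normrE.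
exact: (le_bigmax _ (fun ij : 'I_p * 'I_q => `|A ij.1 ij.2|) (i, j)).
Qed.

Lemma norm_le_entry (A : 'M[R]_(p, q)) e : 0 <= e ->
  (forall i j, `|A i j| <= e) -> `|A| <= e.
Proof.
move=> e0 Ae; rewrite [leLHS]/Num.Def.normr/= mx_normrE.
by apply: bigmax_le => // -[i j] _; exact: Ae.
Qed.

End MatrixNorm.

Section Lines.
Variables (R : realType) (V : normedModType R).

Lemma is_derive_line (W : normedModType R) (f : V -> W) x v (s : R) :
  derivable f (x + s *: v) v ->
  is_derive s 1 (fun t : R => f (x + t *: v)) ('D_v f (x + s *: v)).
Proof.
have E : (fun h : R => h^-1 *: (f (x + (h *: (1 : R) + s) *: v) - f (x + s *: v)))
    = (fun h => h^-1 *: (f (h *: v + (x + s *: v)) - f (x + s *: v))).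
  apply/funext => h; congr (_ *: (f _ - _)).
  by rewrite [h *: 1]mulr1 scalerDl addrCA.
by move=> dfs; apply: DeriveDef; rewrite /derivable /derive /= E.
Qed.

(** Parametrising the segment by [0, 1] lets [t] have either sign, as needed when it is a coordinate
    of a vector. *)
Lemma mvt_line (f : V -> R) x v (t : R) :
  (forall s : R, 0 <= s <= 1 -> derivable f (x + (s * t) *: v) v) ->
  exists2 s : R, 0 <= s <= 1 &
    f (x + t *: v) - f x = t * 'D_v f (x + (s * t) *: v).
Proof.
move=> df; pose phi (s : R) := f (x + (s * t) *: v).
have dphi (s : R) : s \in `[0, 1]%R ->
    is_derive s 1 phi (t * 'D_v f (x + (s * t) *: v)).
  rewrite in_itv => s01; rewrite mulrC.
  apply: (@is_derive1_comp _ (fun t : R => f (x + t *: v)) (fun s => s * t)).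
    exact/is_derive_line/df.
  have -> : (fun s : R => s * t) = t *: (@id R) by apply/funext => u /=; rewrite mulrC.
  by apply: is_derive_eq; rewrite [_ *: _]mulr1.
have dphi' (s : R) : s \in `]0, 1[%R -> is_derive s 1 phi (t * 'D_v f (x + (s * t) *: v)).
  by move=> s01; apply/dphi/subset_itv_oo_cc.
have cphi : {within `[0, 1], continuous phi}.
  apply: derivable_within_continuous => s s01.
  by have [] := dphi s s01.
have [c] := MVT_segment (ler01 : (0 : R) <= 1) dphi' cphi.
rewrite in_itv/= /phi mul1r mul0r scale0r addr0 subr0 mulr1 => c01 E.
by exists c.
Qed.

Lemma mvt_segment_line (f : V -> R) x v :
  (forall s : R, 0 <= s <= 1 -> derivable f (x + s *: v) v) ->
  exists2 s : R, 0 <= s <= 1 & f (x + v) - f x = 'D_v f (x + s *: v).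
Proof.
move=> df; have [|s s01] := @mvt_line f x v 1.
  by move=> s s01; rewrite mulr1; exact: df.
by rewrite scale1r mulr1 mul1r => E; exists s.
Qed.

End Lines.

Section Gradient.
Variables (R : realType) (n : nat).

Lemma linear_coord (W : lmodType R) (f : 'rV[R]_n -> W) : linear f ->
  forall v, f v = \sum_i v 0 i *: f 'e_i.
Proof.
move=> lf v.
pose F : {linear 'rV[R]_n -> W} := HB.pack f (GRing.isLinear.Build R _ _ _ f lf).
rewrite -[LHS]/(F v) {1}(row_sum_delta v) linear_sum.
by apply: eq_bigr => i _; rewrite linearZ.
Qed.

Lemma linear_continuous_rV (W : normedModType R) (f : 'rV[R]_n -> W) : linear f -> continuous f.
Proof.
move=> lf.
pose F : {linear 'rV[R]_n -> W} := HB.pack f (GRing.isLinear.Build R _ _ _ f lf).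
apply: (@bounded_linear_continuous _ _ _ F); apply/linear_boundedP.
exists (\sum_i `|f 'e_i|); split => [|r rK v].
  exact: num_real.
rewrite -[F v]/(f v) (linear_coord lf) (le_trans (ler_norm_sum _ _ _))//.
apply: (@le_trans _ _ (`|v| * \sum_i `|f 'e_i|)).
  rewrite mulr_sumr; apply: ler_sum => i _.
  by rewrite normrZ ler_wpM2r// entry_le_norm.
by rewrite mulrC ler_wpM2r// ltW.
Qed.

Lemma differentiable_of_estimate (W : normedModType R) (f : 'rV[R]_n -> W) x
    (L : {linear 'rV[R]_n -> W}) : continuous L ->
  (forall e, 0 < e -> \forall v \near (0 : 'rV[R]_n),
     `|f (v + x) - f x - L v| <= e * `|v|) ->
  differentiable f x /\ forall v, 'D_v f x = L v.
Proof.
move=> cL fL.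
have E : f \o shift x = cst (f x) + L +o_ (0 : 'rV[R]_n) id.
  apply/eqaddoP => e e0; near=> v; rewrite /= !fctE /= opprD addrA.
  by near: v; exact: fL.
have dE := diff_unique cL E.
have df : differentiable f x by apply/diff_locallyP; rewrite dE; split.
by split=> // v; rewrite deriveE// dE.
Unshelve. all: by end_near. Qed.

(* The increment of f is telescoped along the coordinate path x + P 0, ..., x + P n,
   where P k keeps the first k coordinates of v. *)
Lemma C1_differentiable (U : set 'rV[R]_n) (f : 'rV[R]_n -> R) x :
  open U -> Ck 1 U f -> U x -> differentiable f x.
Proof.
move=> oU [_ /= C1] Ux.
pose D (i : 'I_n) : R := 'D_('e_i) f x.
have linL : linear (fun v : 'rV[R]_n => \sum_i v 0 i * D i).
  move=> a u v; rewrite scaler_sumr -big_split/=; apply: eq_bigr => i _.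
  by rewrite !mxE mulrDl -mulrA.
pose L : {linear 'rV[R]_n -> R} := HB.pack (fun v : 'rV[R]_n => \sum_i v 0 i * D i)
  (GRing.isLinear.Build R _ _ _ _ linL).
apply: (@differentiable_of_estimate _ _ _ L _ _).1; first exact: (linear_continuous_rV linL).
move=> e e0.
(* The error is shared among [n] coordinates; [n.+1] keeps the quotient positive in dimension 0. *)
have e'0 : 0 < e / n.+1%:R by rewrite divr_gt0.
have : \forall y \near x, U y /\ forall i : 'I_n, `|D i - 'D_('e_i) f y| <= e / n.+1%:R.
  apply: filterI; first exact: open_nbhs_nbhs.
  have cD (i : 'I_n) : \forall y \near x, `|D i - 'D_('e_i) f y| <= e / n.+1%:R.
    have [_ [cDi _]] := C1 i.
    by have /cvgrPdist_le := cDi x Ux; apply.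
  exact: (filter_forall _ cD).
move=> /nbhs_ballP[d /= d0 dP].
have dP' w : `|w| < d -> U (x + w) /\ forall i : 'I_n, `|D i - 'D_('e_i) f (x + w)| <= e / n.+1%:R.
  by move=> wd; apply: dP; rewrite -ball_normE /ball_/= opprD addrA subrr add0r normrN.
apply/nbhs_ballP; exists d => // v; rewrite -ball_normE /ball_/= sub0r normrN => vd.
pose P k : 'rV[R]_n := \row_j (if (j < k)%N then v 0 j else 0).
have Pv k (i : 'I_n) s : `|s| <= `|v 0 i| -> (k <= i)%N -> `|P k + s *: 'e_i| <= `|v|.
  move=> sv ki; apply: norm_le_entry => // a j; rewrite ord1 !mxE eqxx/=.
  case: ifP => [jk|_].
    rewrite (_ : (j == i) = false) ?mulr0 ?addr0 ?entry_le_norm//.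
    by apply/eqP => ji; move: jk; rewrite ji ltnNge ki.
  rewrite add0r; case: (j == i); rewrite ?mulr0 ?normr0// mulr1.
  by rewrite (le_trans sv)// entry_le_norm.
have PS (i : 'I_n) : P i.+1 = P i + v 0 i *: 'e_i.
  apply/rowP => j; rewrite !mxE eqxx/= ltnS leq_eqVlt -val_eqE/=.
  by case: (ltngtP j i) => //= ji; rewrite ?mulr0 ?addr0// mulr1 add0r; congr (v 0 _); apply/val_inj.
have -> : f (v + x) - f x = \sum_(i < n) (f (x + P i.+1) - f (x + P i)).
  rewrite -(big_mkord xpredT (fun i => f (x + P i.+1) - f (x + P i))).
  rewrite telescope_sumr//; congr (f _ - f _).
    by rewrite addrC; congr (_ + _); apply/rowP => j; rewrite mxE ltn_ord.
  by rewrite (_ : P 0%N = 0) ?addr0//; apply/rowP => j; rewrite !mxE.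
rewrite -sumrB (le_trans (ler_norm_sum _ _ _))//.
apply: (@le_trans _ _ (\sum_(i < n) (e / n.+1%:R * `|v|))); last first.
  rewrite sumr_const card_ord -[leLHS]mulr_natr mulrAC ler_wpM2r// -mulrA.
  by rewrite ler_piMr ?(ltW e0)// mulrC ler_pdivrMr// mul1r ler_nat.
apply: ler_sum => i _.
have inU s : `|s| <= `|v 0 i| -> `|P i + s *: 'e_i| < d.
  by move=> sv; exact: le_lt_trans (Pv _ _ _ sv (leqnn _)) vd.
have sv (s : R) : 0 <= s <= 1 -> `|s * v 0 i| <= `|v 0 i|.
  by move=> /andP[s0 s1]; rewrite normrM ler_piMl// ger0_norm.
have [|s s01] := @mvt_line _ _ f (x + P i) 'e_i (v 0 i).
  move=> s s01; rewrite -addrA; apply: (C1 i).1.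
  by have [] := dP' _ (inU _ (sv s s01)).
rewrite PS !addrA => ->; rewrite -mulrBr normrM mulrC.
rewrite ler_pM// ?entry_le_norm// -normrN opprB -addrA.
by have [_] := dP' _ (inU _ (sv s s01)); apply.
Qed.

End Gradient.

Section SmoothMatrix.
Variables (R : realType) (n : nat).
Variable U : set 'rV[R]_n.
Hypothesis oU : open U.

Lemma mx_differentiable p q (f : 'rV[R]_n -> 'M[R]_(p, q)) x :
  (forall i j, differentiable (fun y => f y i j) x) -> differentiable f x.
Proof.
move=> df.
rewrite (_ : f = \sum_i \sum_j (fun y => f y i j *: delta_mx i j)); last first.
  apply/funext => y; rewrite fct_sumE {1}[f y]matrix_sum_delta.
  by apply: eq_bigr => i _; rewrite fct_sumE.
apply: differentiable_sum => i; apply: differentiable_sum => j.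
exact: differentiableZl.
Qed.

Lemma smooth_entry p q (f : 'rV[R]_n -> 'M[R]_(p, q)) :
  smooth_on U f <-> forall i j, smooth_on U (fun y => f y i j).
Proof.
split=> [sf i j k|sf k]; first by apply: (Ck_mxP k f oU).1; exact: sf.
by apply: (Ck_mxP k f oU).2 => i j; exact: sf.
Qed.

Lemma smooth_differentiable (f : 'rV[R]_n -> R) x :
  smooth_on U f -> U x -> differentiable f x.
Proof. by move=> sf; apply: C1_differentiable => //; exact: sf. Qed.

Lemma smooth_mx_differentiable p q (f : 'rV[R]_n -> 'M[R]_(p, q)) x :
  smooth_on U f -> U x -> differentiable f x.
Proof.
move=> /smooth_entry sf Ux; apply: mx_differentiable => i j.
exact: smooth_differentiable.
Qed.

Lemma smooth_mx_derivable p q (f : 'rV[R]_n -> 'M[R]_(p, q)) x v :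
  smooth_on U f -> U x -> derivable f x v.
Proof. by move=> sf Ux; apply/diff_derivable/smooth_mx_differentiable. Qed.

Lemma smooth_derivable (f : 'rV[R]_n -> R) x v :
  smooth_on U f -> U x -> derivable f x v.
Proof. by move=> sf Ux; apply/diff_derivable/smooth_differentiable. Qed.

Lemma smooth_mx_is_derive p q (f : 'rV[R]_n -> 'M[R]_(p, q)) x :
  smooth_on U f -> forall v, U x -> is_derive x v f ('D_v f x).
Proof. by move=> sf v Ux; apply: derivableP; exact: smooth_mx_derivable. Qed.

Lemma derive_ext (W : normedModType R) (f h : 'rV[R]_n -> W) x v :
  U x -> (forall y, U y -> f y = h y) -> 'D_v f x = 'D_v h x.
Proof.
move=> Ux fh; apply: near_eq_derive.
exact: filterS (open_nbhs_nbhs (conj oU Ux)).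
Qed.

End SmoothMatrix.
Arguments derive_ext {R n U} oU {W f h x v} _ _.

Lemma open_normball (R : realType) n (x0 : 'rV[R]_n) (r : R) : open [set x | `|x - x0| < r].
Proof.
rewrite (_ : [set x | _] = ball x0 r); first exact: ball_open.
by apply/funext => y; apply/propext; rewrite -ball_normE /ball_/= distrC.
Qed.

Section DeriveRules.
Variables (R : realType) (V : normedModType R).

Lemma is_derive_fsum (W : normedModType R) k (h : 'I_k -> V -> W) (dh : 'I_k -> W) x v :
  (forall i, is_derive x v (h i) (dh i)) ->
  is_derive x v (fun y => \sum_i h i y) (\sum_i dh i).
Proof.
move=> H; rewrite (_ : (fun y => _) = \sum_i h i); last first.
  by apply/funext => y; rewrite fct_sumE.
exact: is_derive_sum.
Qed.

Lemma is_derive_mxP p q (M : V -> 'M[R]_(p, q)) (dM : 'M[R]_(p, q)) x v :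
  is_derive x v M dM <-> forall i j, is_derive x v (fun y => M y i j) (dM i j).
Proof.
split=> [[dv <-] i j|H].
  apply: DeriveDef; first exact: (derivable_mxP M x v).1 dv i j.
  by rewrite derive_mx// mxE.
have dv : derivable M x v by apply/derivable_mxP => i j; have [] := H i j.
apply: DeriveDef => //; rewrite derive_mx//; apply/matrixP => i j; rewrite mxE.
by have [] := H i j.
Qed.

Lemma is_derive_mulmx p q r (A : V -> 'M[R]_(p, q)) (B : V -> 'M[R]_(q, r)) dA dB x v :
  is_derive x v A dA -> is_derive x v B dB ->
  is_derive x v (fun y => A y *m B y) (dA *m B x + A x *m dB).
Proof.
move=> /is_derive_mxP HA /is_derive_mxP HB; apply/is_derive_mxP => i j.
rewrite (_ : (fun y => _) = fun y => \sum_k A y i k * B y k j); last first.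
  by apply/funext => y; rewrite mxE.
rewrite !mxE -big_split/=; apply: is_derive_fsum => k.
apply: (is_derive_eq (is_deriveM (HA i k) (HB k j))).
by rewrite addrC /GRing.scale/= [B x k j * _]mulrC.
Qed.

Lemma is_derive_trmx p q (A : V -> 'M[R]_(p, q)) dA x v :
  is_derive x v A dA -> is_derive x v (fun y => (A y)^T) dA^T.
Proof.
move=> /is_derive_mxP HA; apply/is_derive_mxP => i j; rewrite mxE.
by rewrite (_ : (fun y => _) = fun y => A y j i)//; apply/funext => y; rewrite mxE.
Qed.

Lemma is_derive_scalemx p q (a : V -> R) (A : V -> 'M[R]_(p, q)) da dA x v :
  is_derive x v a da -> is_derive x v A dA ->
  is_derive x v (fun y => a y *: A y) (da *: A x + a x *: dA).
Proof.
move=> Ha /is_derive_mxP HA; apply/is_derive_mxP => i j.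
rewrite (_ : (fun y => _) = fun y => a y * A y i j); last first.
  by apply/funext => y; rewrite mxE.
apply: (is_derive_eq (is_deriveM Ha (HA i j))).
by rewrite !mxE addrC /GRing.scale/= [A x i j * _]mulrC.
Qed.

Lemma derive_entry p q (A : V -> 'M[R]_(p, q)) x v i j : derivable A x v ->
  'D_v (fun y => A y i j) x = 'D_v A x i j.
Proof. by move=> dA; rewrite derive_mx// mxE. Qed.

Lemma derive_linear (W : normedModType R) (f : V -> W) x a u v :
  differentiable f x -> 'D_(a *: u + v) f x = a *: 'D_u f x + 'D_v f x.
Proof. by move=> df; rewrite !deriveE// linearP. Qed.

Lemma derive_scale (W : normedModType R) (f : V -> W) x a u :
  differentiable f x -> 'D_(a *: u) f x = a *: 'D_u f x.
Proof. by move=> df; rewrite !deriveE// linearZ. Qed.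

Lemma derive_add (W : normedModType R) (f : V -> W) x u v :
  differentiable f x -> 'D_(u + v) f x = 'D_u f x + 'D_v f x.
Proof. by move=> df; rewrite !deriveE// linearD. Qed.

Lemma is_derive_translate (W : normedModType R) (f : V -> W) x c v :
  derivable f (x + c) v -> is_derive x v (fun y => f (y + c)) ('D_v f (x + c)).
Proof.
have E : (fun h : R => h^-1 *: (f (h *: v + x + c) - f (x + c)))
    = (fun h => h^-1 *: (f (h *: v + (x + c)) - f (x + c))).
  by apply/funext => h; rewrite addrA.
by move=> df; apply: DeriveDef; rewrite /derivable /derive /= E.
Qed.

Lemma derive_comp (V' W : normedModType R) (f : V -> V') (g : V' -> W) x v :
  differentiable f x -> differentiable g (f x) ->
  'D_v (fun y => g (f y)) x = 'D_('D_v f x) g (f x).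
Proof.
move=> df dg.
by rewrite !deriveE// ?(@diff_comp _ _ _ _ f g)//; exact: differentiable_comp.
Qed.

End DeriveRules.

Lemma derive_coord (R : realType) n (W : normedModType R) (f : 'rV[R]_n -> W) x v :
  differentiable f x -> 'D_v f x = \sum_i v 0 i *: 'D_('e_i) f x.
Proof.
move=> df; rewrite deriveE// {1}(row_sum_delta v) linear_sum.
by apply: eq_bigr => i _; rewrite linearZ deriveE.
Qed.

Section Smooth.
Variables (R : realType) (n : nat).
Variable U : set 'rV[R]_n.
Hypothesis oU : open U.

Lemma smooth_ext (W : normedModType R) (f g : 'rV[R]_n -> W) :
  (forall x, U x -> f x = g x) -> smooth_on U f -> smooth_on U g.
Proof. by move=> fg sf k; apply: Ck_ext (sf k). Qed.

Lemma smooth_cst (W : normedModType R) (w : W) : smooth_on U (fun _ => w).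
Proof. by move=> k; exact: Ck_cst. Qed.

Lemma smoothD (W : normedModType R) (f g : 'rV[R]_n -> W) :
  smooth_on U f -> smooth_on U g -> smooth_on U (fun y => f y + g y).
Proof. by move=> sf sg k; exact: CkD. Qed.

Lemma smoothM (f g : 'rV[R]_n -> R) :
  smooth_on U f -> smooth_on U g -> smooth_on U (fun y => f y * g y).
Proof. by move=> sf sg k; exact: CkM. Qed.

Lemma Ck_sum (W : normedModType R) k I (r : seq I) (P : pred I) (f : I -> 'rV[R]_n -> W) :
  (forall i, Ck k U (f i)) -> Ck k U (fun y => \sum_(i <- r | P i) f i y).
Proof.
move=> sf; elim: r => [|i r IH].
  by apply: Ck_ext (Ck_cst k U 0) => // x _; rewrite big_nil.
case Pi : (P i).
  by apply: Ck_ext (CkD oU (sf i) IH) => // x _; rewrite big_cons Pi.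
by apply: Ck_ext IH => // x _; rewrite big_cons Pi.
Qed.

Lemma smooth_sum (W : normedModType R) I (r : seq I) (P : pred I) (f : I -> 'rV[R]_n -> W) :
  (forall i, smooth_on U (f i)) -> smooth_on U (fun y => \sum_(i <- r | P i) f i y).
Proof. by move=> sf k; apply: Ck_sum => i; exact: sf. Qed.

Lemma smooth_prod I (r : seq I) (P : pred I) (f : I -> 'rV[R]_n -> R) :
  (forall i, smooth_on U (f i)) -> smooth_on U (fun y => \prod_(i <- r | P i) f i y).
Proof.
move=> sf; elim: r => [|i r IH].
  by apply: smooth_ext (@smooth_cst R 1) => // x _; rewrite big_nil.
case Pi : (P i).
  by apply: smooth_ext (smoothM (sf i) IH) => // x _; rewrite big_cons Pi.
by apply: smooth_ext IH => // x _; rewrite big_cons Pi.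
Qed.

Lemma smooth_mulmx p q r (A : 'rV[R]_n -> 'M[R]_(p, q)) (B : 'rV[R]_n -> 'M[R]_(q, r)) :
  smooth_on U A -> smooth_on U B -> smooth_on U (fun y => A y *m B y).
Proof.
move=> /(smooth_entry oU) sA /(smooth_entry oU) sB; apply/(smooth_entry oU) => i j.
apply: (@smooth_ext _ (fun y => \sum_k A y i k * B y k j)) => [x _|]; first by rewrite mxE.
by apply: smooth_sum => k; exact: smoothM.
Qed.

Lemma smooth_trmx p q (A : 'rV[R]_n -> 'M[R]_(p, q)) :
  smooth_on U A -> smooth_on U (fun y => (A y)^T).
Proof.
move=> /(smooth_entry oU) sA; apply/(smooth_entry oU) => i j.
by apply: smooth_ext (sA j i) => x _; rewrite mxE.
Qed.

Lemma smooth_scalemx p q (a : 'rV[R]_n -> R) (A : 'rV[R]_n -> 'M[R]_(p, q)) :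
  smooth_on U a -> smooth_on U A -> smooth_on U (fun y => a y *: A y).
Proof.
move=> sa /(smooth_entry oU) sA; apply/(smooth_entry oU) => i j.
by apply: smooth_ext (smoothM sa (sA i j)) => x _; rewrite mxE.
Qed.

Lemma smooth_mxN p q (A : 'rV[R]_n -> 'M[R]_(p, q)) :
  smooth_on U A -> smooth_on U (fun y => - A y).
Proof.
move=> sA; apply: smooth_ext (smooth_scalemx (@smooth_cst R (-1)) sA) => x _.
by rewrite scaleN1r.
Qed.

Lemma smooth_mxB p q (A B : 'rV[R]_n -> 'M[R]_(p, q)) :
  smooth_on U A -> smooth_on U B -> smooth_on U (fun y => A y - B y).
Proof. by move=> sA sB; apply: smoothD => //; exact: smooth_mxN. Qed.

Lemma smoothN (f : 'rV[R]_n -> R) : smooth_on U f -> smooth_on U (fun y => - f y).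
Proof.
move=> sf; apply: smooth_ext (smoothM (@smooth_cst R (-1)) sf) => x _.
by rewrite mulN1r.
Qed.

Lemma smoothB (f g : 'rV[R]_n -> R) :
  smooth_on U f -> smooth_on U g -> smooth_on U (fun y => f y - g y).
Proof. by move=> sf sg; apply: smoothD => //; exact: smoothN. Qed.

Lemma smoothX (f : 'rV[R]_n -> R) k : smooth_on U f -> smooth_on U (fun y => f y ^+ k).
Proof.
move=> sf; elim: k => [|k IH]; first exact: smooth_cst.
by apply: smooth_ext (smoothM sf IH) => x _; rewrite exprS.
Qed.

(** Induction on the order: the partial derivative - f^-2 f' involves 1/f only to the order already
    reached. *)
Lemma smoothV (f : 'rV[R]_n -> R) : (forall x, U x -> f x != 0) ->
  smooth_on U f -> smooth_on U (fun y => (f y)^-1).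
Proof.
move=> f0 sf; elim=> [|k IH].
  by split=> // x Ux; apply: continuousV; [exact: f0|case: (sf 0%N) => c _; exact: c].
split=> [x Ux|i].
  by apply: continuousV; [exact: f0|case: (sf 0%N) => c _; exact: c].
have [_ /(_ i)[di _]] := sf 1%N.
split=> [x Ux|]; first by apply: derivableV; [exact: f0|exact: di].
have [_ /(_ i)[_ ci]] := sf k.+1.
have := CkM oU (Ck_cst k U (-1 : R)) (CkM oU (CkM oU IH IH) ci).
apply: Ck_ext => // x Ux; rewrite deriveV//; [|exact: f0|exact: di].
by rewrite !fctE -exprVn expr2 mulN1r /GRing.scale/= mulNr.
Qed.

Lemma smooth_det p (A : 'rV[R]_n -> 'M[R]_p) :
  smooth_on U A -> smooth_on U (fun y => \det (A y)).
Proof.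
move=> /(smooth_entry oU) sA; apply: smooth_sum => s; apply: smoothM; first exact: smooth_cst.
by apply: smooth_prod.
Qed.

(** By Cramer's formula the inverse is the adjugate, polynomial in the entries, divided by a
    nonvanishing determinant. *)
Lemma smooth_invmx p (A : 'rV[R]_n -> 'M[R]_p) : (forall x, U x -> A x \in unitmx) ->
  smooth_on U A -> smooth_on U (fun y => invmx (A y)).
Proof.
move=> uA sA.
apply: (@smooth_ext _ (fun y => (\det (A y))^-1 *: \adj (A y))) => [x Ux|].
  by rewrite /invmx uA.
apply: smooth_scalemx.
  apply: smoothV; last exact: smooth_det.
  by move=> x Ux; rewrite -unitfE; exact: uA.
apply/(smooth_entry oU) => i j.
apply: (@smooth_ext _ (fun y => cofactor (A y) j i)) => [x _|]; first by rewrite mxE.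
apply: smoothM; first exact: smooth_cst.
apply: smooth_det; apply/(smooth_entry oU) => a b.
apply: (@smooth_ext _ (fun y => A y (lift j a) (lift i b))) => [x _|]; first by rewrite !mxE.
by move/(smooth_entry oU): sA.
Qed.

(** [Ck] provides derivatives along coordinate vectors only; total differentiability turns ['D_v]
    into a linear combination of them. *)
Lemma smooth_derive (f : 'rV[R]_n -> R) v : smooth_on U f -> smooth_on U ('D_v f).
Proof.
move=> sf; apply: (@smooth_ext _ (fun y => \sum_i v 0 i * 'D_('e_i) f y)).
  by move=> x Ux; rewrite [RHS]derive_coord//; exact: (smooth_differentiable oU sf Ux).
apply: smooth_sum => i; apply: smoothM; first exact: smooth_cst.
by move=> k; have [_ /(_ i)[_]] := sf k.+1.
Qed.

Lemma smooth_mx_derive p q (f : 'rV[R]_n -> 'M[R]_(p, q)) v :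
  smooth_on U f -> smooth_on U ('D_v f).
Proof.
move=> sf; apply/(smooth_entry oU) => i j.
apply: smooth_ext (smooth_derive v ((smooth_entry oU f).1 sf i j)) => x Ux.
by rewrite derive_entry//; exact: (smooth_mx_derivable oU).
Qed.

Lemma smooth_continuous (W : normedModType R) (f : 'rV[R]_n -> W) x :
  smooth_on U f -> U x -> {for x, continuous f}.
Proof. by move=> /(_ 0%N)[+ _]; apply. Qed.

(* The second difference of f over a parallelogram is t^2 times either mixed derivative
   at a nearby point. *)
Let second_difference (f : 'rV[R]_n -> R) x u v d t :
  smooth_on U f -> (forall y, `|y| < d -> U (x + y)) ->
  0 <= t -> t * (`|u| + `|v|) < d ->
  exists2 y, `|y| < d & f (x + t *: u + t *: v) - f (x + t *: u) - (f (x + t *: v) - f x)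
    = t * (t * 'D_v ('D_u f) (x + y)).
Proof.
move=> sf dU t0 td.
have bnd a b : `|a| <= `|t| -> `|b| <= `|t| -> `|a *: u + b *: v| < d.
  rewrite (ger0_norm t0) => at_ bt; apply: le_lt_trans td.
  by rewrite (le_trans (ler_normD _ _))// !normrZ mulrDr lerD// ler_wpM2r.
have b0 : `|0 : R| <= `|t| by rewrite normr0.
have bt : `|t| <= `|t| by [].
have dphi a : `|a| <= `|t| ->
    is_derive (x + a *: u) u (fun y => f (y + t *: v) - f y)
      ('D_u f (x + a *: u + t *: v) - 'D_u f (x + a *: u)).
  move=> at_; apply: is_deriveB.
    apply: is_derive_translate; apply: (smooth_derivable oU) => //.
    by rewrite -addrA; apply/dU/bnd.
  apply: derivableP; apply: (smooth_derivable oU) => //.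
  by apply: dU; have := bnd a 0 at_ b0; rewrite scale0r addr0.
have t1 s : 0 <= s <= 1 -> `|s * t| <= `|t|.
  by move=> /andP[s0 s1]; rewrite normrM ler_piMl// ger0_norm.
have df y : `|y| < d -> differentiable f (x + y).
  by move=> yd; apply: (smooth_differentiable oU sf); exact: dU.
have dDf y : `|y| < d -> differentiable ('D_u f) (x + y).
  by move=> yd; apply: (smooth_differentiable oU (smooth_derive u sf)); exact: dU.
have dg a : `|a| <= `|t| -> differentiable (fun y => f (y + t *: v) - f y) (x + a *: u).
  move=> at_; apply: differentiableB; last first.
    by apply: df; have := bnd a 0 at_ b0; rewrite scale0r addr0.
  apply: (@differentiable_comp _ _ _ _ (fun y => y + t *: v) f).
    exact: differentiableD.
  by rewrite -addrA; apply/df/bnd.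
have [|a0 a01 E] := @mvt_segment_line R _ (fun y => f (y + t *: v) - f y) x (t *: u).
  move=> a a01; apply: diff_derivable; rewrite scalerA; apply: dg; exact: t1.
set a := a0 * t; have at_ : `|a| <= `|t| by exact: t1.
have [|b0' b01 E'] := @mvt_segment_line R _ ('D_u f) (x + a *: u) (t *: v).
  move=> b b01; apply: diff_derivable; rewrite scalerA -addrA; apply: dDf.
  by apply: bnd => //; exact: t1.
exists (a *: u + (b0' * t) *: v); first by apply: bnd => //; exact: t1.
rewrite E scalerA -/a (derive_scale _ _ (dg a at_)).
have [_ ->] := dphi a at_; rewrite E' scalerA -addrA.
rewrite derive_scale//; apply: dDf; apply: bnd => //; exact: t1.
Qed.

(** The second difference is symmetric in [u] and [v], so one mixed derivative at a point near [x]
    equals the other one at a second such point. Continuity of both brings the two points back to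
    [x]. *)
Lemma derive_comm (f : 'rV[R]_n -> R) x u v : smooth_on U f -> U x ->
  'D_u ('D_v f) x = 'D_v ('D_u f) x.
Proof.
move=> sf Ux; set a := LHS; set b := RHS.
apply/eqP; rewrite -subr_eq0 -normr_le0; apply/ler_addgt0Pl => e e0; rewrite addr0.
have s1 : smooth_on U ('D_u ('D_v f)) by do 2 apply: smooth_derive.
have s2 : smooth_on U ('D_v ('D_u f)) by do 2 apply: smooth_derive.
have e2 : 0 < e / 2 by rewrite divr_gt0.
have : \forall y \near x, [/\ U y, `|a - 'D_u ('D_v f) y| <= e / 2
    & `|b - 'D_v ('D_u f) y| <= e / 2].
  have n0 := open_nbhs_nbhs (conj oU Ux).
  have n1 : \forall y \near x, `|a - 'D_u ('D_v f) y| <= e / 2.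
    by have /cvgrPdist_le := smooth_continuous s1 Ux; apply.
  have n2 : \forall y \near x, `|b - 'D_v ('D_u f) y| <= e / 2.
    by have /cvgrPdist_le := smooth_continuous s2 Ux; apply.
  apply: filterS (filterI n0 (filterI n1 n2)) => y [H0 [H1 H2]].
  by split; [exact: H0|exact: H1|exact: H2].
move=> /nbhs_ballP[d /= d0 dP].
have dP' y : `|y| < d -> [/\ U (x + y), `|a - 'D_u ('D_v f) (x + y)| <= e / 2
    & `|b - 'D_v ('D_u f) (x + y)| <= e / 2].
  by move=> yd; apply: dP; rewrite -ball_normE /ball_/= opprD addrA subrr add0r normrN.
have dU y : `|y| < d -> U (x + y) by move=> /dP'[].
(* The added 1 allows division by [M] even when [u] and [v] vanish. *)
pose M := `|u| + `|v| + 1.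
have M0 : 0 < M by rewrite /M ltr_wpDl// addr_ge0.
pose t := d / 2 / M.
have t0 : 0 < t by rewrite !divr_gt0.
have tM : t * (`|u| + `|v|) < d.
  apply: (@le_lt_trans _ _ (t * M)).
    by rewrite ler_wpM2l ?(ltW t0)// /M lerDl.
  by rewrite /t divfK ?gt_eqF// ltr_pdivrMr// ltr_pMr// ltrDl.
have tM' : t * (`|v| + `|u|) < d by rewrite [`|v| + _]addrC.
have [y yd E] := second_difference sf dU (ltW t0) tM.
have [z zd E'] := second_difference sf dU (ltW t0) tM'.
have : t * (t * 'D_v ('D_u f) (x + y)) = t * (t * 'D_u ('D_v f) (x + z)).
  have L (a' b' c' d' : R) : a' - b' - (c' - d') = a' - c' - (b' - d') by ring.
  apply: etrans (esym E) (etrans _ E').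
  by rewrite (addrAC x (t *: v)); exact: L.
move=> /(mulfI (lt0r_neq0 t0)) /(mulfI (lt0r_neq0 t0)) yz.
have [_ _ by_] := dP' y yd; have [_ az _] := dP' z zd.
rewrite yz in by_; rewrite distrC in by_.
rewrite (splitr e); apply: le_trans (lerD az by_).
exact: ler_distD.
Qed.

Lemma mx_derive_comm p q (f : 'rV[R]_n -> 'M[R]_(p, q)) x u v : smooth_on U f -> U x ->
  'D_u ('D_v f) x = 'D_v ('D_u f) x.
Proof.
move=> sf Ux; apply/matrixP => i j.
have H w z : 'D_w ('D_z f) x i j = 'D_w ('D_z (fun y => f y i j)) x.
  rewrite -derive_entry; last by apply: (smooth_mx_derivable oU) => //; exact: smooth_mx_derive.
  apply: (derive_ext oU Ux) => y Uy.
  by rewrite derive_entry//; exact: (smooth_mx_derivable oU).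
apply: etrans (H u v) (etrans _ (esym (H v u))).
exact: (derive_comm u v ((smooth_entry oU f).1 sf i j) Ux).
Qed.

End Smooth.

Section SmoothComp.
Variables (R : realType) (p q : nat).
Variables (U : set 'rV[R]_p) (V : set 'rV[R]_q).
Hypotheses (oU : open U) (oV : open V).

(** Induction on the order with [f] generalised: the chain rule expresses a partial derivative
    through those of [t] and the composites of the partial derivatives of [f] with [t]. *)
Lemma smooth_comp (t : 'rV[R]_p -> 'rV[R]_q) (f : 'rV[R]_q -> R) :
  (forall x, U x -> V (t x)) -> smooth_on U t -> smooth_on V f ->
  smooth_on U (fun x => f (t x)).
Proof.
move=> UV st sf k.
have ct x : U x -> {for x, continuous t} by apply: smooth_continuous.
elim: k f sf => [|k IH] f sf.
  split=> // x Ux; apply: continuous_comp; first exact: ct.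
  by apply: (smooth_continuous sf); exact: UV.
have dt x : U x -> differentiable t x by exact: (smooth_mx_differentiable oU).
have df x : V x -> differentiable f x by exact: (smooth_differentiable oV).
split=> [x Ux|i].
  apply: continuous_comp; first exact: ct.
  by apply: (smooth_continuous sf); exact: UV.
split=> [x Ux|].
  apply: diff_derivable; apply: (@differentiable_comp _ _ _ _ t f); first exact: dt.
  by apply: df; exact: UV.
have : Ck k U (fun x => \sum_j 'D_('e_i) t x 0 j * 'D_('e_j) f (t x)).
  apply: (Ck_sum oU) => j; apply: (CkM oU).
    have := smooth_mx_derive oU 'e_i st.
    by move=> /(smooth_entry oU)/(_ 0 j); apply.
  by apply: (IH ('D_('e_j) f)); exact: smooth_derive.
apply: (Ck_ext oU) => x Ux.
have dfx : differentiable f (t x) by apply/df/UV.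
by rewrite (derive_comp _ (dt x Ux) dfx) [RHS]derive_coord.
Qed.

End SmoothComp.

(** * Linear ordinary differential equations *)

Section Primitive.
Variable R : realType.

(** Integrating from -1 makes 0 an interior point, so the derivative at 0 is two-sided. *)
Lemma primitive_right (f : R -> R) : continuous f ->
  exists F : R -> R, forall x : R, -1 < x -> is_derive x 1 F (f x).
Proof.
move=> cf.
exists (fun y => (\int[lebesgue_measure]_(t in [set` `[-1, y]]) (f t))%R) => x x1.
have [||||d <-] := @continuous_FTC1_closed R f (-1) x (x + 1).
- by rewrite ltrDl.
- apply: continuous_compact_integrable; first exact: segment_compact.
  exact: continuous_subspaceT.
- exact: x1.
- exact: cf.
exact: (DeriveDef d (esym (derive1E _ _))).
Qed.

(** Freezing the argument below -1/2 makes the primitive continuous on the whole line, which Picard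
    iteration asks for, without disturbing a neighbourhood of any point x >= 0. *)
Lemma primitive_exists (f : R -> R) : continuous f ->
  exists F : R -> R, [/\ F 0 = 0, continuous F &
    forall x : R, 0 <= x -> is_derive x 1 F (f x)].
Proof.
move=> /primitive_right[G dG]; pose c (x : R) := Num.max (- 2^-1) x.
have c1 x : -1 < c x by rewrite lt_max ltrN2 invf_lt1 ?ltr0n ?ltr1n.
have cc : continuous c.
  by move=> x; apply: (@continuous_max R R (fun=> - 2^-1) id) => //; exact: cst_continuous.
have n0 : - 2^-1 < 0 :> R by rewrite oppr_lt0 invr_gt0.
exists (fun x => G (c x) - G (c 0)); split=> [|x|x x0]; first by rewrite subrr.
  apply: continuousB; last exact: cst_continuous.
  apply: (continuous_comp (cc x)); have [d _] := dG _ (c1 x).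
  exact/differentiable_continuous/derivable1_diffP.
have x1 : -1 < x by rewrite (lt_le_trans _ x0)// ltrN10.
have := is_deriveB (dG x x1) (is_derive_cst (G (c 0)) x 1); rewrite subr0.
apply: near_eq_is_derive.
have : nbhs x `](- 2^-1 : R), +oo[%classic.
  by apply: open_nbhs_nbhs; split => //=; rewrite in_itv/= andbT (lt_le_trans n0).
by apply: filterS => y /=; rewrite in_itv/= andbT /c => /ltW/max_idPr ->.
Qed.

Lemma vec_primitive_exists q (f : R -> 'rV[R]_q) : continuous f ->
  exists F : R -> 'rV[R]_q, [/\ F 0 = 0, continuous F &
    forall x : R, 0 <= x -> is_derive x 1 F (f x)].
Proof.
move=> cf.
have P j : exists F : R -> R, [/\ F 0 = 0, continuous F &
    forall x : R, 0 <= x -> is_derive x 1 F (f x 0 j)].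
  by apply: primitive_exists => x; exact: (continuous_mxP f x).1 (cf x) 0 j.
have [F HF] := choice P.
have FE j : (fun x => (\row_j F j x) 0 j) = F j by apply/funext => y; rewrite mxE.
exists (fun x => \row_j F j x); split=> [|x|x x0].
- by apply/rowP => j; rewrite !mxE; have [] := HF j.
- by apply/continuous_mxP => i j; rewrite ord1 FE; have [_ + _] := HF j; apply.
- by apply/is_derive_mxP => i j; rewrite ord1 FE; have [_ _] := HF j; apply.
Qed.

End Primitive.

Section Growth.
Variables (R : realType) (q : nat).

Lemma mvt_vec (d d' : R -> 'rV[R]_q) (a b K : R) : a <= b -> 0 <= K ->
  (forall t : R, a <= t <= b -> is_derive t 1 d (d' t)) ->
  (forall t : R, a <= t <= b -> `|d' t| <= K) -> `|d b - d a| <= K * (b - a).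
Proof.
move=> ab K0 dd dK; apply: norm_le_entry => [|i j]; first by rewrite mulr_ge0 ?subr_ge0.
have dphi (s : R) : s \in `[a, b]%R -> is_derive s 1 (fun t => d t i j) (d' s i j).
  by rewrite in_itv => /dd/is_derive_mxP.
have dphi' (s : R) : s \in `]a, b[%R -> is_derive s 1 (fun t => d t i j) (d' s i j).
  by move=> s01; apply/dphi/subset_itv_oo_cc.
have cphi : {within `[a, b], continuous (fun t => d t i j)}.
  apply: derivable_within_continuous => s s01.
  by have [] := dphi s s01.
have [c] := MVT_segment ab dphi' cphi.
rewrite in_itv/= !mxE => c01 ->; rewrite normrM (@ger0_norm _ (b - a)) ?subr_ge0//.
by rewrite ler_wpM2r ?subr_ge0// (le_trans (entry_le_norm _ _ _))// dK.
Qed.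

(** A substitute for Gronwall's inequality: where |d| attains its maximum D on [0, 1], the mean
    value inequality gives D <= D / 2 + c, and the half is absorbed on the left. *)
Lemma growth_bound (d d' : R -> 'rV[R]_q) (c : R) : 0 <= c -> d 0 = 0 ->
  (forall t : R, 0 <= t <= 1 -> is_derive t 1 d (d' t)) ->
  (forall t : R, 0 <= t <= 1 -> `|d' t| <= 2^-1 * `|d t| + c) ->
  forall t : R, 0 <= t <= 1 -> `|d t| <= 2 * c.
Proof.
move=> c0 d0 dd dc.
have cd : {within `[0, 1], continuous (fun t : R => `|d t|)}.
  apply: continuous_in_subspaceT => t /[1!inE]; rewrite /= in_itv/= => t01.
  have [dt _] := dd t t01.
  apply: (@continuous_comp _ _ _ d (fun v => `|v|)).
    exact/differentiable_continuous/derivable1_diffP.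
  exact: norm_continuous.
have [s s01 smax] := EVT_max (@ler01 R) cd.
have {}smax (t : R) : 0 <= t <= 1 -> `|d t| <= `|d s|.
  by move=> t01; apply: smax; rewrite in_itv.
rewrite in_itv/= in s01; have /andP[s0 s1] := s01.
have : `|d s - d 0| <= (2^-1 * `|d s| + c) * (s - 0).
  apply: (@mvt_vec d d') => //.
  - by rewrite addr_ge0// mulr_ge0// invr_ge0.
  - by move=> t /andP[t0 t1]; apply: dd; rewrite t0 (le_trans t1).
  - move=> t /andP[t0 t1]; have t01 : 0 <= t <= 1 by rewrite t0 (le_trans t1).
    by apply: le_trans (dc t t01) _; rewrite lerD2r ler_wpM2l ?invr_ge0// smax.
rewrite d0 !subr0 => ds t t01; apply: le_trans (smax t t01) _.
have : `|d s| <= 2^-1 * `|d s| + c.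
  apply: le_trans ds _; rewrite ler_piMr// addr_ge0// mulr_ge0// invr_ge0//.
by move: `|d s| => D; lra.
Qed.

End Growth.

Section Clamp.
Variable R : realType.

(** The retraction of the line onto [0, 1]. It extends data given on this interval to continuous
    data on R, so that continuity never has to be relativised to the interval. *)
Definition clamp (t : R) : R := Num.max 0 (Num.min t 1).

Lemma clamp_in (t : R) : 0 <= clamp t <= 1.
Proof. by rewrite /clamp le_max lexx/= ge_max ler01 ge_min lexx orbT. Qed.

Lemma clampE (t : R) : 0 <= t <= 1 -> clamp t = t.
Proof. by move=> /andP[t0 t1]; rewrite /clamp (min_idPl t1) (max_idPr t0). Qed.

Lemma continuous_clamp : continuous clamp.
Proof.
move=> t; apply: (@continuous_max R R (fun=> 0) (fun t => Num.min t 1)).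
  exact: cst_continuous.
by apply: (@continuous_min R R id (fun=> 1)) => //; exact: cst_continuous.
Qed.

End Clamp.

Section LinearODE.
Variables (R : realType) (q : nat) (A : R -> 'rV[R]_q -> 'rV[R]_q) (y0 : 'rV[R]_q).
Hypothesis linA : forall t : R, linear (A t).
Hypothesis contA : forall y : R -> 'rV[R]_q, continuous y -> continuous (fun t => A t (y t)).
Hypothesis smallA : forall (t : R) y, 0 <= t <= 1 -> `|A t y| <= 2^-1 * `|y|.

(* Picard iteration; by smallA the iterates contract with ratio 1/2 on [0, 1]. *)
Lemma linear_ode_exists : exists y : R -> 'rV[R]_q, y 0 = y0 /\
  forall t : R, 0 <= t <= 1 -> is_derive t 1 y (A t (y t)).
Proof.
have Q (a : R) : 0 < a -> a / 4 + (a / 4 + a / 4) <= a by move=> ?; lra.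
have Q2 (a e : R) : 0 < e -> a <= e / 2 -> 2^-1 * a + 2^-1 * a <= e by move=> ? ?; lra.
have AB (t : R) u v : A t (u - v) = A t u - A t v.
  have A0 : A t 0 = 0.
    by have := linA t (-1) 0 0; rewrite scaler0 addr0 scaleN1r addNr.
  by rewrite addrC -scaleN1r linA scaleN1r addrC.
(* Continuity is moved under the existential so that the choice of a primitive is a total operation;
   a discontinuous [f] receives an arbitrary value. *)
have : forall f : R -> 'rV[R]_q, exists F : R -> 'rV[R]_q,
    continuous f ->
    [/\ F 0 = 0, continuous F & forall x : R, 0 <= x -> is_derive x 1 F (f x)].
  move=> f; have [cf|ncf] := pselect (continuous f); last by exists f.
  by have [F HF] := vec_primitive_exists cf; exists F.
move=> /choice[P HP].
pose T (y : R -> 'rV[R]_q) := fun t => y0 + P (fun s => A s (y s)) t.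
have T0 y : continuous y -> T y 0 = y0.
  by move=> cy; have [P0 _ _] := HP _ (contA cy); rewrite /T P0 addr0.
have dT y (t : R) : continuous y -> 0 <= t -> is_derive t 1 (T y) (A t (y t)).
  move=> cy t0; have [_ _ /(_ t t0) d] := HP _ (contA cy).
  by have := is_deriveD (is_derive_cst y0 t 1) d; rewrite add0r.
have cT y : continuous y -> continuous (T y).
  move=> cy t; have [_ cP _] := HP _ (contA cy).
  by apply: continuousD; [exact: cst_continuous|exact: cP].
pose y k := iter k T (cst y0).
have cy k : continuous (y k).
  by elim: k => [|k IH]; [move=> t; exact: cst_continuous|exact: cT].
pose C := `|y0|.
have C0 : 0 <= C by exact: normr_ge0.
have h0 k : 0 <= (2^-1 : R) ^+ k by rewrite exprn_ge0 ?invr_ge0.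
have Ch0 k : 0 <= C * 2^-1 ^+ k by exact: mulr_ge0.
have Ch1 k : 0 <= 2 * C * 2^-1 ^+ k by rewrite -mulrA mulr_ge0.
have T_lip (u v : R -> 'rV[R]_q) K : continuous u -> continuous v -> 0 <= K ->
    (forall t : R, 0 <= t <= 1 -> `|u t - v t| <= K) ->
    forall t : R, 0 <= t <= 1 -> `|T u t - T v t| <= 2^-1 * K.
  move=> cu cv K0 uv t /andP[t0 t1].
  have := @mvt_vec R q (fun t => T u t - T v t) (fun t => A t (u t) - A t (v t)) 0 t (2^-1 * K) t0.
  rewrite !T0// subrr subr0; rewrite subr0 => H.
  apply: (@le_trans _ _ (2^-1 * K * t)).
    apply: H; first by rewrite mulr_ge0// invr_ge0.
      by move=> s /andP[s0 _]; apply: is_deriveB; exact: dT.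
    move=> s /andP[s0 s1]; rewrite -AB.
    have s01 : 0 <= s <= 1 by rewrite s0 (le_trans s1).
    by rewrite (le_trans (smallA _ s01))// ler_wpM2l ?invr_ge0// uv.
  by rewrite ler_piMr// mulr_ge0// invr_ge0.
have step k (t : R) : 0 <= t <= 1 -> `|y k.+1 t - y k t| <= C * (2^-1) ^+ k.
  elim: k t => [|k IH] t t01.
    rewrite expr0 mulr1 /y/=; have /andP[t0 t1] := t01.
    have := @mvt_vec R q (T (cst y0)) (fun t => A t y0) 0 t C t0.
    rewrite T0 ?subr0 => H; last by move=> ?; exact: cst_continuous.
    apply: (@le_trans _ _ (C * t)); last by rewrite ler_piMr// /C.
    apply: H => [|s|s]; first exact: normr_ge0.
      by move=> /andP[s0 _]; apply: dT => // ?; exact: cst_continuous.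
    move=> /andP[s0 s1]; have s01 : 0 <= s <= 1 by rewrite s0 (le_trans s1).
    by rewrite (le_trans (smallA _ s01))// ler_piMl// invf_le1 ?ltr0n// ler1n.
  have := T_lip _ _ (C * 2^-1 ^+ k) (cy k.+1) (cy k) _ IH t t01.
  by rewrite exprS mulrCA; apply.
have step' k m (t : R) : 0 <= t <= 1 -> `|y (k + m)%N t - y k t| <= 2 * C * (2^-1) ^+ k.
  move=> t01.
  (* The partial sum of the geometric series is kept exactly: the bound without the subtracted tail
     would not be inductive in [m]. *)
  suff : `|y (k + m)%N t - y k t| <= 2 * C * (2^-1) ^+ k - 2 * C * (2^-1) ^+ (k + m).
    move=> H; apply: le_trans H _; rewrite gerDl oppr_le0.
    exact: Ch1.
  elim: m => [|m IH]; first by rewrite addn0 !subrr normr0.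
  rewrite addnS; have := ler_distD (y (k + m)%N t) (y (k + m).+1 t) (y k t).
  move=> H; apply: le_trans H _; apply: le_trans (lerD (step _ t t01) IH) _.
  rewrite [in leRHS]exprS; move: (2^-1 ^+ (k + m)) (2^-1 ^+ k) => a b.
  by rewrite le_eqVlt; apply/orP; left; apply/eqP; field.
have geo0 (e : R) : 0 < e -> exists k, 2 * C * (2^-1) ^+ k <= e.
  move=> e0; have : (2 * C * (2^-1) ^+ k : R) @[k --> \oo] --> (2 * C * 0 : R).
    apply: cvgM; first exact: cvg_cst.
    by apply: cvg_expr; rewrite ger0_norm ?invr_ge0// invf_lt1 ?ltr0n// ltr1n.
  rewrite mulr0 => /cvgrPdist_le/(_ e e0)[k _ /(_ k (leqnn k))].
  rewrite sub0r normrN ger0_norm; first by exists k.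
  exact: Ch1.
have cvg_y (t : R) : 0 <= t <= 1 -> cvgn (fun k => y k t).
  move=> t01; apply/cauchy_cvgP/cauchy_exP => e e0.
  have e4 : 0 < e / 2 by rewrite divr_gt0.
  have [k ke] := geo0 _ e4.
  exists (y k t); exists k => // m /= km.
  rewrite -ball_normE /ball_/= distrC.
  have Ha := step' k (m - k)%N t t01; rewrite subnKC// in Ha.
  apply: le_lt_trans Ha _; apply: le_lt_trans ke _.
  by rewrite ltr_pdivrMr// ltr_pMr// ltrDl.
(* Convergence is known on [0, 1] only; clamping makes the limit continuous on R, hence a legitimate
   argument of [T]. *)
pose z (t : R) := lim (y k (clamp t) @[k --> \oo]).
have yz k (t : R) : 0 <= t <= 1 -> `|z t - y k t| <= 2 * C * (2^-1) ^+ k.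
  move=> t01; rewrite /z (clampE t01).
  have H : `|y m t - y k t| @[m --> \oo] --> `|lim (y m t @[m --> \oo]) - y k t|.
    apply: cvg_norm; apply: cvgB; [exact: cvg_y|exact: cvg_cst].
  rewrite -(cvg_lim _ H)//; apply: limr_le; [exact: (cvgP _ H)|near=> m].
  have km : (k <= m)%N by near: m; exact: nbhs_infty_ge.
  by have := step' k (m - k)%N t t01; rewrite subnKC.
have cz : continuous z.
  move=> t; apply/cvgrPdist_le => e e0.
  have e4 : 0 < e / 4 by rewrite divr_gt0.
  have [k ke] := geo0 _ e4.
  have zc s : z s = z (clamp s) by rewrite /z (clampE (clamp_in s)).
  have cyk : {for t, continuous (fun s => y k (clamp s))}.
    apply: continuous_comp; [exact: continuous_clamp|exact: cy].
  have /cvgrPdist_le/(_ _ e4) := cyk.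
  apply: filterS => s Hs; rewrite (zc t) (zc s).
  have H1 := yz k _ (clamp_in t); have H2 := yz k _ (clamp_in s).
  rewrite distrC in H2.
  apply: le_trans (ler_distD (y k (clamp t)) _ _) _.
  have H3 : `|y k (clamp t) - z (clamp s)| <= e / 4 + e / 4.
    apply: le_trans (ler_distD (y k (clamp s)) _ _) _.
    by apply: lerD => //; exact: le_trans H2 ke.
  apply: le_trans (lerD (le_trans H1 ke) H3) _.
  exact: Q.
have Tz (t : R) : 0 <= t <= 1 -> T z t = z t.
  move=> t01; apply/eqP; rewrite -subr_eq0 -normr_le0.
  apply/ler_addgt0Pl => e e0; rewrite addr0.
  have e2 : 0 < e / 2 by rewrite divr_gt0.
  have [k ke] := geo0 _ e2.
  have H1 := T_lip _ _ _ cz (cy k) (Ch1 k) (yz k) t t01.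
  have H2 := yz k.+1 t t01; rewrite distrC exprS mulrCA in H2.
  apply: le_trans (ler_distD (y k.+1 t) _ _) _.
  apply: le_trans (lerD H1 H2) _.
  exact: Q2.
(* [z] is constant outside [0, 1] and need not be differentiable at the endpoints. [T z] agrees with
   it on [0, 1] and, being a primitive, has two-sided derivatives there. *)
exists (T z); split; first exact: T0.
by move=> t t01; rewrite (Tz t t01); apply: dT => //; case/andP: t01.
Unshelve. all: by end_near. Qed.

End LinearODE.

(** * Total linear differential systems *)

Section LinearCoord.
Variables (R : realType) (n : nat).

Lemma continuous_fsum (T : topologicalType) (W : normedModType R) k (h : 'I_k -> T -> W) :
  (forall i, continuous (h i)) -> continuous (fun y => \sum_i h i y).
Proof.
move=> ch; rewrite (_ : (fun y => _) = \sum_i h i); last first.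
  by apply/funext => y; rewrite fct_sumE.
apply: (big_ind (fun f : T -> W => continuous f)) => //.
- exact: cst_continuous.
- by move=> f g cf cg x; apply: continuousD; [exact: cf|exact: cg].
Qed.

Lemma norm_comb_le (W : normedModType R) (c : 'I_n -> W) (v : 'rV[R]_n) M :
  (forall i, `|c i| <= M) -> `|\sum_i v 0 i *: c i| <= n%:R * M * `|v|.
Proof.
move=> cM; rewrite (le_trans (ler_norm_sum _ _ _))//.
apply: (@le_trans _ _ (\sum_(i < n) `|v| * M)).
  by apply: ler_sum => i _; rewrite normrZ ler_pM// entry_le_norm.
by rewrite sumr_const card_ord -[leLHS]mulr_natl -mulrA [M * _]mulrC.
Qed.

End LinearCoord.

Section Bounds.
Variables (R : realType) (n : nat) (U : set 'rV[R]_n) (x0 : 'rV[R]_n) (r M : R).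
Hypotheses (oU : open U) (rU : forall z, `|z - x0| < r -> U z) (M0 : 0 <= M).

Lemma segment_in_ball z v s : `|z - x0| < r -> `|z + v - x0| < r -> 0 <= s <= 1 ->
  `|z + s *: v - x0| < r.
Proof.
move=> zr vr /andP[s0 s1].
have -> : z + s *: v - x0 = (1 - s) *: (z - x0) + s *: (z + v - x0).
  by apply/rowP => i; rewrite !mxE; ring.
apply: le_lt_trans (ler_normD _ _) _; rewrite !normrZ !ger0_norm ?subr_ge0//.
have [->|sn] := eqVneq s 0; first by rewrite subr0 mul1r mul0r addr0.
have sp : 0 < s by rewrite lt_neqAle eq_sym sn.
apply: (@lt_le_trans _ _ ((1 - s) * r + s * r)); last by rewrite -mulrDl subrK mul1r.
by rewrite ler_ltD ?ltr_pM2l// ler_wpM2l ?subr_ge0// ltW.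
Qed.

Lemma lipschitz_of_bound (f : 'rV[R]_n -> R) : smooth_on U f ->
  (forall z, `|z - x0| < r -> forall i : 'I_n, `|'D_('e_i) f z| <= M) ->
  forall z v, `|z - x0| < r -> `|z + v - x0| < r -> `|f (z + v) - f z| <= n%:R * M * `|v|.
Proof.
move=> sf fM z v zr vr.
have [|s s01 ->] := @mvt_segment_line R _ f z v.
  by move=> s s01; apply: (smooth_derivable oU sf); apply/rU/segment_in_ball.
rewrite derive_coord; last first.
  by apply: (smooth_differentiable oU sf); apply/rU/segment_in_ball.
by apply: norm_comb_le => i; apply/fM/segment_in_ball.
Qed.

(** Mean value theorem for [f], then the Lipschitz bound for its partial derivatives. The constant
    is not sharp; only the order in |v| matters. *)
Lemma taylor_of_bound (f : 'rV[R]_n -> R) : smooth_on U f ->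
  (forall z, `|z - x0| < r -> forall i j : 'I_n, `|'D_('e_j) ('D_('e_i) f) z| <= M) ->
  forall z v, `|z - x0| < r -> `|z + v - x0| < r ->
  `|f (z + v) - f z - 'D_v f z| <= n%:R * n%:R * M * `|v| ^+ 2.
Proof.
move=> sf fM z v zr vr.
have [|s s01 ->] := @mvt_segment_line R _ f z v.
  by move=> s s01; apply: (smooth_derivable oU sf); apply/rU/segment_in_ball.
have sr := segment_in_ball zr vr s01.
rewrite !derive_coord; [|exact: (smooth_differentiable oU sf (rU zr))|
  exact: (smooth_differentiable oU sf (rU sr))].
rewrite -sumrB (eq_bigr (fun i => v 0 i *: ('D_('e_i) f (z + s *: v) - 'D_('e_i) f z))); last first.
  by move=> i _; rewrite scalerBr.
apply: (@le_trans _ _ (n%:R * (n%:R * M * `|v|) * `|v|)); last first.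
  by rewrite expr2 !mulrA.
apply: norm_comb_le => i.
apply: (@le_trans _ _ (n%:R * M * `|s *: v|)).
  apply: (lipschitz_of_bound (smooth_derive oU 'e_i sf)) => //.
  by move=> y yr j; exact: fM.
have /andP[s0 s1] := s01.
by rewrite ler_wpM2l ?mulr_ge0// normrZ ger0_norm// ler_piMl.
Qed.

End Bounds.

Lemma finite_family_bound (R : realType) n (I : finType) (g : I -> 'rV[R]_n -> R) x0 :
  (forall i, {for x0, continuous (g i)}) ->
  exists2 M, 0 <= M & \forall z \near x0, forall i, `|g i z| <= M.
Proof.
move=> cg; exists (\sum_i (`|g i x0| + 1)); first by apply: sumr_ge0 => i _; rewrite addr_ge0.
have H i : \forall z \near x0, `|g i z| <= \sum_i (`|g i x0| + 1).
  have /cvgrPdist_le/(_ 1 ltr01) := cg i; apply: filterS => z zi.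
  rewrite (bigD1 i)//= -[leLHS]addr0 lerD//; last by apply: sumr_ge0 => j _; rewrite addr_ge0.
  have := ler_normD (g i z - g i x0) (g i x0); rewrite subrK => h.
  by apply: le_trans h _; rewrite addrC lerD2l distrC.
exact: (filter_forall _ H).
Qed.

Lemma ler_prod4 (R : realType) (a b b' c c' d d' : R) :
  0 <= a -> 0 <= b -> 0 <= c -> 0 <= d -> b <= b' -> c <= c' -> d <= d' ->
  a * b * c * d <= a * b' * c' * d'.
Proof.
move=> a0 b0 c0 d0 bb cc dd; apply: ler_pM => //; first by rewrite !mulr_ge0.
by apply: ler_pM => //; [rewrite mulr_ge0|exact: ler_wpM2l].
Qed.

Section Frobenius.
Variables (R : realType) (n q : nat) (U : set 'rV[R]_n) (x0 : 'rV[R]_n).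
Variable A : 'rV[R]_n -> 'rV[R]_n -> 'rV[R]_q -> 'rV[R]_q.
Hypotheses (oU : open U) (Ux0 : U x0).
Hypothesis linAv : forall x y, linear (fun v => A x v y).
Hypothesis linAy : forall x v, linear (A x v).
Hypothesis smoothA : forall v y, smooth_on U (fun x => A x v y).
Hypothesis flatA : forall x u v y, U x ->
  'D_u (fun x => A x v y) x + A x v (A x u y) =
  'D_v (fun x => A x u y) x + A x u (A x v y).

Let F i j z : 'rV[R]_q := A z 'e_i 'e_j.

Lemma frob_smooth i j : smooth_on U (F i j).
Proof. exact: (smoothA 'e_i 'e_j). Qed.

Lemma frob_expand x v y : A x v y = \sum_i \sum_j (v 0 i * y 0 j) *: F i j x.
Proof.
rewrite (linear_coord (linAv x y)); apply: eq_bigr => i _.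
rewrite (linear_coord (linAy x 'e_i)) scaler_sumr; apply: eq_bigr => j _.
by rewrite scalerA.
Qed.

Lemma frob_norm (c : 'I_n -> 'I_q -> 'rV[R]_q) (v : 'rV[R]_n) (y : 'rV[R]_q) M :
  (forall i j, `|c i j| <= M) ->
  `|\sum_i \sum_j (v 0 i * y 0 j) *: c i j| <= n%:R * q%:R * M * `|v| * `|y|.
Proof.
move=> cM.
rewrite (eq_bigr (fun i => v 0 i *: \sum_j y 0 j *: c i j)); last first.
  by move=> i _; rewrite scaler_sumr; apply: eq_bigr => j _; rewrite scalerA.
apply: le_trans (norm_comb_le v (M := q%:R * M * `|y|) _) _.
  by move=> i; exact: norm_comb_le.
by rewrite !mulrA [leRHS]mulrAC.
Qed.

Lemma frob_derive x v y w : U x ->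
  'D_w (fun x => A x v y) x = \sum_i \sum_j (v 0 i * y 0 j) *: 'D_w (F i j) x.
Proof.
move=> Ux.
have -> : (fun x => A x v y) = fun x => \sum_i \sum_j (v 0 i * y 0 j) *: F i j x.
  by apply/funext => z; rewrite frob_expand.
have d i j : is_derive x w (F i j) ('D_w (F i j) x).
  by apply: derivableP; exact: (smooth_mx_derivable oU (frob_smooth i j) Ux).
suff [] : is_derive x w (fun x => \sum_i \sum_j (v 0 i * y 0 j) *: F i j x)
   (\sum_i \sum_j (v 0 i * y 0 j) *: 'D_w (F i j) x) by [].
apply: is_derive_fsum => i; apply: is_derive_fsum => j.
Qed.

(** By bilinearity [A] is governed by the finitely many entries of the maps [F i j]. Bounds near
    [x0] for these, their first and their second derivatives give the three estimates; n q counts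
    the terms of the expansion. *)
Lemma frob_estimates : exists r K : R, [/\ 0 < r, 0 <= K,
  forall z, `|z - x0| < r -> U z,
  forall z v y, `|z - x0| < r -> `|A z v y| <= K * `|v| * `|y| &
  (forall z w v y, `|z - x0| < r -> `|z + w - x0| < r ->
     `|A (z + w) v y - A z v y| <= K * `|w| * `|v| * `|y|) /\
  (forall z w v y, `|z - x0| < r -> `|z + w - x0| < r ->
     `|A (z + w) v y - A z v y - 'D_w (fun z => A z v y) z| <=
     K * `|w| ^+ 2 * `|v| * `|y|)].
Proof.
pose G (i : 'I_n) (j k : 'I_q) z := F i j z 0 k.
have sG i j k : smooth_on U (G i j k).
  exact: (smooth_entry oU _).1 (smoothA 'e_i 'e_j) 0 k.
have [M0 M00 HM0] := @finite_family_bound R n ('I_n * 'I_q * 'I_q)%type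
  (fun p => G p.1.1 p.1.2 p.2) x0 (fun p => smooth_continuous (sG _ _ _) Ux0).
have [M1 M10 HM1] := @finite_family_bound R n ('I_n * 'I_q * 'I_q * 'I_n)%type
  (fun p => 'D_('e_p.2) (G p.1.1.1 p.1.1.2 p.1.2)) x0
  (fun p => smooth_continuous (smooth_derive oU 'e_p.2 (sG _ _ _)) Ux0).
have [M2 M20 HM2] := @finite_family_bound R n ('I_n * 'I_q * 'I_q * 'I_n * 'I_n)%type
  (fun p => 'D_('e_p.2) ('D_('e_p.1.2) (G p.1.1.1.1 p.1.1.1.2 p.1.1.2))) x0
  (fun p => smooth_continuous (smooth_derive oU 'e_p.2 (smooth_derive oU 'e_p.1.2 (sG _ _ _))) Ux0).
have nU := open_nbhs_nbhs (conj oU Ux0).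
have HM : nbhs x0 (U `&` ([set z | forall p : 'I_n * 'I_q * 'I_q, `|G p.1.1 p.1.2 p.2 z| <= M0] `&`
  ([set z | forall p : 'I_n * 'I_q * 'I_q * 'I_n, `|'D_('e_p.2) (G p.1.1.1 p.1.1.2 p.1.2) z| <= M1] `&`
   [set z | forall p : 'I_n * 'I_q * 'I_q * 'I_n * 'I_n,
      `|'D_('e_p.2) ('D_('e_p.1.2) (G p.1.1.1.1 p.1.1.1.2 p.1.1.2)) z| <= M2]))).
  by do 3! [apply: filterI => //].
move: HM => /nbhs_ballP[r /= r0 Hr].
have {}Hr z : `|z - x0| < r -> [/\ U z, forall i j k, `|G i j k z| <= M0,
    forall i j k a, `|'D_('e_a) (G i j k) z| <= M1 &
    forall i j k a b, `|'D_('e_b) ('D_('e_a) (G i j k)) z| <= M2].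
  move=> zr; have [|Uz [h0 [h1 h2]]] := Hr z.
    by rewrite -ball_normE /ball_/= distrC.
  split=> //.
  - by move=> i j k; exact: (h0 (i, j, k)).
  - by move=> i j k a; exact: (h1 (i, j, k, a)).
  - by move=> i j k a b; exact: (h2 (i, j, k, a, b)).
have rU z : `|z - x0| < r -> U z by move=> /Hr[].
pose K' := M0 + n%:R * M1 + n%:R * n%:R * M2.
have K'0 : 0 <= K' by rewrite /K' !addr_ge0 // !mulr_ge0.
have K'M0 : M0 <= K' by rewrite /K' -addrA lerDl addr_ge0// !mulr_ge0.
have K'M1 : n%:R * M1 <= K' by rewrite /K' addrAC lerDr addr_ge0// !mulr_ge0.
have K'M2 : n%:R * n%:R * M2 <= K' by rewrite /K' lerDr addr_ge0// !mulr_ge0.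
exists r, (n%:R * q%:R * K'); split => //.
- by rewrite !mulr_ge0.
- move=> z v y zr; rewrite frob_expand; apply: frob_norm => i j.
  apply: norm_le_entry => // a k; rewrite ord1.
  by have [_ h _ _] := Hr z zr; apply: le_trans (h i j k) _.
- split=> z w v y zr wr.
    rewrite !frob_expand -sumrB.
    under eq_bigr do (rewrite -sumrB; under eq_bigr do rewrite -scalerBr).
    apply: le_trans (frob_norm (M := K' * `|w|) v y _) _; last by rewrite mulrA.
    move=> i j; apply: norm_le_entry => [|a k]; first by rewrite mulr_ge0.
    rewrite ord1 !mxE; apply: le_trans (_ : _ <= n%:R * M1 * `|w|) _; last by rewrite ler_wpM2r.
    apply: (lipschitz_of_bound oU rU (sG i j k)) => // z' z'r b.
    by have [_ _ h _] := Hr z' z'r.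
rewrite !frob_expand (frob_derive _ _ _ (rU z zr)) -!sumrB.
under eq_bigr do (rewrite -!sumrB; under eq_bigr do rewrite -!scalerBr).
apply: le_trans (frob_norm (M := K' * `|w| ^+ 2) v y _) _; last by rewrite mulrA.
move=> i j; apply: norm_le_entry => [|a k]; first by rewrite mulr_ge0// exprn_ge0.
rewrite ord1 !mxE -derive_entry; last exact: (smooth_mx_derivable oU (frob_smooth i j) (rU z zr)).
apply: le_trans (_ : _ <= n%:R * n%:R * M2 * `|w| ^+ 2) _; last by rewrite ler_wpM2r// exprn_ge0.
apply: (taylor_of_bound oU rU M20 (sG i j k)) => // z' z'r b c.
by have [_ _ _ h] := Hr z' z'r.
Qed.

Lemma frob_continuous_path (c : R -> 'rV[R]_n) a (y : R -> 'rV[R]_q) :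
  (forall t, U (c t)) -> continuous c -> continuous y ->
  continuous (fun t => A (c t) a (y t)).
Proof.
move=> Uc cc cy.
have -> : (fun t => A (c t) a (y t)) = fun t => \sum_i \sum_j (a 0 i * y t 0 j) *: F i j (c t).
  by apply/funext => z; rewrite frob_expand.
apply: continuous_fsum => i; apply: continuous_fsum => j t.
apply: cvgZ.
  apply: cvgM; first exact: cvg_cst.
  exact: (continuous_mxP y t).1 (cy t) 0 j.
apply: (continuous_comp (cc t)); apply: (smooth_continuous (smoothA _ _)).
exact: Uc.
Qed.

Lemma frob_derive_path a v (y : R -> 'rV[R]_q) dy t :
  U (x0 + t *: a) -> is_derive t 1 y dy ->
  is_derive t 1 (fun t => A (x0 + t *: a) v (y t))
    ('D_a (fun z => A z v (y t)) (x0 + t *: a) + A (x0 + t *: a) v dy).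
Proof.
move=> Ut /is_derive_mxP hy.
rewrite (frob_derive _ _ _ Ut) frob_expand -big_split/=.
have -> : (fun t => A (x0 + t *: a) v (y t)) =
    fun t => \sum_i \sum_j (v 0 i * y t 0 j) *: F i j (x0 + t *: a).
  by apply/funext => z; rewrite frob_expand.
apply: is_derive_fsum => i; rewrite -big_split/=; apply: is_derive_fsum => j.
rewrite addrC; apply: is_derive_scalemx; last first.
  by apply: is_derive_line; exact: (smooth_mx_derivable oU (frob_smooth i j) Ut).
Qed.

(** K r <= 1/2 is the contraction hypothesis of [linear_ode_exists] for the ray ending at [x]. The
    clamped parameter keeps the base point in the ball at all real times. *)
Lemma frobenius_rays (r K : R) (y0 : 'rV[R]_q) : 0 <= K -> K * r <= 2^-1 ->
  (forall z, `|z - x0| < r -> U z) ->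
  (forall z v y, `|z - x0| < r -> `|A z v y| <= K * `|v| * `|y|) ->
  exists Y : 'rV[R]_n -> R -> 'rV[R]_q, forall x, `|x - x0| < r -> Y x 0 = y0 /\
    forall t : R, 0 <= t <= 1 ->
      is_derive t 1 (Y x) (A (x0 + t *: (x - x0)) (x - x0) (Y x t)).
Proof.
move=> K0 Kr rU b1.
have : forall x, exists y : R -> 'rV[R]_q, `|x - x0| < r -> y 0 = y0 /\
    forall t : R, 0 <= t <= 1 ->
      is_derive t 1 y (A (x0 + t *: (x - x0)) (x - x0) (y t)).
  move=> x; have [xr|xr] := ltP `|x - x0| r; last by exists (fun=> 0).
  have seg (t : R) : 0 <= t <= 1 -> `|x0 + t *: (x - x0) - x0| < r.
    move=> /andP[t0 t1]; rewrite addrAC subrr add0r normrZ ger0_norm//.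
    by rewrite (le_lt_trans _ xr)// ler_piMl.
  have [|||y [yz yd]] := @linear_ode_exists R q
    (fun t => A (x0 + clamp t *: (x - x0)) (x - x0)) y0.
  - by move=> t; exact: linAy.
  - move=> y cy; apply: (frob_continuous_path (c := fun t => x0 + clamp t *: (x - x0))) => //.
      by move=> t; apply/rU/seg/clamp_in.
    move=> t; apply: cvgD; first exact: cvg_cst.
    by apply: cvgZr_tmp; exact: continuous_clamp.
  - move=> t y t01; apply: le_trans (b1 _ _ _ (seg _ (clamp_in t))) _.
    rewrite ler_wpM2r// (le_trans _ Kr)// ler_wpM2l// ltW//.
  exists y => _; split=> // t t01; have := yd t t01.
  by rewrite clampE.
by move=> /choice[Y HY]; exists Y.
Qed.

(* Solving the equation along the rays from x0 gives Y, and u x := Y x 1. By flatness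
   w t := Y (x + v) t - Y x t - t A v (Y x t) satisfies |w'| <= |w| / 2 + C |v|^2, so that
   u (x + v) = u x + A x v (u x) + O(|v|^2). *)
Theorem frobenius (y0 : 'rV[R]_q) :
  exists r : R, 0 < r /\ (forall x, `|x - x0| < r -> U x) /\
  exists u : 'rV[R]_n -> 'rV[R]_q,
    [/\ smooth_on [set x | `|x - x0| < r] u, u x0 = y0 &
     forall x v, `|x - x0| < r -> 'D_v u x = A x v (u x)].
Proof.
have [r0 [K [r00 K0 r0U b1' [b2' b3']]]] := frob_estimates.
(* The three constraints: the estimates hold, factors |x - x0| may be bounded by 1, and K r <= 1/2
   feeds the absorption in [growth_bound]; K + 1 covers K = 0. *)
pose r := Num.min r0 (Num.min 1 (2^-1 / (K + 1))).
have K1 : 0 < K + 1 by rewrite ltr_wpDl.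
have rp : 0 < r by rewrite !lt_min r00 ltr01 divr_gt0.
have rr0 : r <= r0 by rewrite ge_min lexx.
have r1 : r <= 1 by rewrite !ge_min lexx !orbT.
have Kr : K * r <= 2^-1.
  have : r <= 2^-1 / (K + 1) by rewrite !ge_min lexx !orbT.
  rewrite ler_pdivlMr// => h; apply: le_trans h.
  by rewrite mulrC ler_wpM2l ?(ltW rp)// lerDl.
have lr x : `|x - x0| < r -> `|x - x0| < r0 by move=> h; exact: lt_le_trans rr0.
have rU x : `|x - x0| < r -> U x by move=> /lr /r0U.
have b1 z v y : `|z - x0| < r -> `|A z v y| <= K * `|v| * `|y| by move=> /lr; exact: b1'.
have b2 z w v y : `|z - x0| < r -> `|z + w - x0| < r ->
    `|A (z + w) v y - A z v y| <= K * `|w| * `|v| * `|y|.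
  by move=> /lr h1 /lr h2; exact: b2'.
have b3 z w v y : `|z - x0| < r -> `|z + w - x0| < r ->
    `|A (z + w) v y - A z v y - 'D_w (fun z => A z v y) z| <= K * `|w| ^+ 2 * `|v| * `|y|.
  by move=> /lr h1 /lr h2; exact: b3'.
have [Y HY] := frobenius_rays y0 K0 Kr rU b1.
have ADv z u v y : A z (u + v) y = A z u y + A z v y.
  by have := linAv z y 1 u v; rewrite !scale1r.
have ADy z v y y' : A z v (y + y') = A z v y + A z v y'.
  by have := linAy z v 1 y y'; rewrite !scale1r.
have A0y z v : A z v 0 = 0 by apply: (addIr (A z v 0)); rewrite -ADy !add0r.
have A0v z y : A z 0 y = 0 by apply: (addIr (A z 0 y)); rewrite -ADv !add0r.
have AZy z v a y : A z v (a *: y) = a *: A z v y.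
  by have := linAy z v a y 0; rewrite A0y !addr0.
have ANy z v y : A z v (- y) = - A z v y by rewrite -scaleN1r AZy scaleN1r.
have seg x (t : R) : `|x - x0| < r -> 0 <= t <= 1 -> `|x0 + t *: (x - x0) - x0| < r.
  move=> xr /andP[t0 t1]; rewrite addrAC subrr add0r normrZ ger0_norm//.
  by rewrite (le_lt_trans _ xr)// ler_piMl.
pose H := 2 * `|y0|.
have H0 : 0 <= H by rewrite mulr_ge0.
have small z a y : `|z - x0| < r -> `|a| < r -> `|A z a y| <= 2^-1 * `|y|.
  move=> zr ar; apply: le_trans (b1 _ _ _ zr) _; rewrite ler_wpM2r//.
  by rewrite (le_trans _ Kr)// ler_wpM2l// ltW.
have eqle (a b : R) : a = b -> a <= b by move=> ->.
have Q1 (a : R) : 2 * (2^-1 * a) = a by field.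
have YH x (t : R) : `|x - x0| < r -> 0 <= t <= 1 -> `|Y x t| <= H.
  move=> xr t01; have [Y0 dY] := HY x xr.
  have := @growth_bound R q (fun t => Y x t - y0)
    (fun t => A (x0 + t *: (x - x0)) (x - x0) (Y x t)) (2^-1 * `|y0|).
  rewrite Y0 subrr Q1// => /(_ _ erefl _ _ t t01) h.
  have h' : `|Y x t - y0| <= `|y0|.
    apply: h.
    - by rewrite mulr_ge0// invr_ge0.
    - move=> s s01; have := is_deriveB (dY s s01) (is_derive_cst y0 s 1).
      by rewrite subr0.
    - move=> s s01; apply: le_trans (small _ _ _ (seg _ _ xr s01) xr) _.
      rewrite -mulrDr ler_wpM2l ?invr_ge0//.
      by have := ler_normD (Y x s - y0) y0; rewrite subrK.
  have := ler_normD (Y x t - y0) y0; rewrite subrK => h2.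
  by apply: le_trans h2 _; rewrite /H mulr_natl mulr2n lerD2r.
pose L := 2 * (K * H + K * H).
have KH : 0 <= K * H by rewrite mulr_ge0.
have L0 : 0 <= L by rewrite mulr_ge0// addr_ge0.
have shift x v (t : R) : x0 + t *: (x + v - x0) = x0 + t *: (x - x0) + t *: v.
  by rewrite (addrAC x v) scalerDr addrA.
have YL x v (t : R) : `|x - x0| < r -> `|x + v - x0| < r -> 0 <= t <= 1 ->
    `|Y (x + v) t - Y x t| <= L * `|v|.
  move=> xr vr t01; have [Y0 dY] := HY x xr; have [Y0' dY'] := HY _ vr.
  rewrite /L -mulrA.
  apply: (@growth_bound R q (fun t => Y (x + v) t - Y x t) (fun t =>
    A (x0 + t *: (x + v - x0)) (x + v - x0) (Y (x + v) t)
    - A (x0 + t *: (x - x0)) (x - x0) (Y x t))) => //.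
  - by rewrite mulr_ge0// addr_ge0.
  - by rewrite Y0 Y0' subrr.
  - by move=> s s01; apply: is_deriveB; [exact: dY'|exact: dY].
  move=> s s01; set xi := x0 + s *: (x - x0); set xi' := x0 + s *: (x + v - x0).
  have xir : `|xi - x0| < r by exact: seg.
  have xir' : `|xi' - x0| < r by exact: seg.
  (* Only the first summand contains the difference of the two solutions, and it is at most half of
     it; the others are O(|v|). *)
  have -> : A xi' (x + v - x0) (Y (x + v) s) - A xi (x - x0) (Y x s) =
      A xi' (x + v - x0) (Y (x + v) s - Y x s) +
      (A xi' (x - x0) (Y x s) - A xi (x - x0) (Y x s) + A xi' v (Y x s)).
    rewrite ADy ANy (addrAC x v (- x0)) !(ADv xi' (x - x0) v).
    set e1 := A xi' (x - x0) (Y (x + v) s); set e2 := A xi' v (Y (x + v) s).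
    set e3 := A xi' (x - x0) _; set e4 := A xi' v _; set e5 := A xi _ _.
    by apply/rowP => i; rewrite !mxE; ring.
  apply: le_trans (ler_normD _ _) _; apply: lerD; first exact: small.
  apply: le_trans (ler_normD _ _) _; rewrite mulrDl; apply: lerD.
    rewrite {1}/xi' shift -/xi.
    apply: le_trans (b2 _ _ _ _ xir _) _; first by rewrite /xi -shift.
    have /andP[s0 s1] := s01.
    rewrite normrZ (ger0_norm s0).
    apply: (@le_trans _ _ (K * (1 * `|v|) * 1 * H)); last by rewrite mul1r mulr1 mulrAC.
    rewrite ler_pM ?mulr_ge0 ?YH// ler_pM ?mulr_ge0//; last by rewrite ltW// (lt_le_trans xr).
    by rewrite ler_wpM2l// ler_wpM2r.
  apply: le_trans (b1 _ _ _ xir') _.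
  by rewrite [leRHS]mulrAC ler_wpM2l ?mulr_ge0// YH.
pose C := K * H + K * K * H + K * L + K * H.
have KK := mulr_ge0 K0 K0.
have KKH := mulr_ge0 KK H0.
have KL := mulr_ge0 K0 L0.
have C0 : 0 <= C by rewrite /C !addr_ge0.
pose u x := Y x 1.
have main x v : `|x - x0| < r -> `|x + v - x0| < r ->
    `|u (x + v) - u x - A x v (u x)| <= 2 * C * `|v| ^+ 2.
  move=> xr vr; have [Y0 dY] := HY x xr; have [Y0' dY'] := HY _ vr.
  pose a := x - x0.
  pose xi (t : R) := x0 + t *: a.
  pose xi' (t : R) := xi t + t *: v.
  have xiE' t : x0 + t *: (x + v - x0) = xi' t by exact: shift.
  have aE : x + v - x0 = a + v by rewrite addrAC.
  have x1 : xi 1 = x by rewrite /xi scale1r addrC subrK.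
  (* When the endpoint moves by [v], the point at time [t] of the ray moves by t v; the subtracted
     term is the expected first variation. *)
  pose w (t : R) := Y (x + v) t - Y x t - t *: A (xi t) v (Y x t).
  pose w' (t : R) := A (xi' t) (a + v) (Y (x + v) t) - A (xi t) a (Y x t)
     - (1 *: A (xi t) v (Y x t) + t *: ('D_a (fun z => A z v (Y x t)) (xi t)
          + A (xi t) v (A (xi t) a (Y x t)))).
  have -> : u (x + v) - u x - A x v (u x) = w 1 by rewrite /w x1 scale1r.
  rewrite -mulrA.
  apply: (@growth_bound R q w w') => //; first by rewrite mulr_ge0// exprn_ge0.
  - by rewrite /w Y0 Y0' subrr scale0r subrr.
  - move=> t t01; apply: is_deriveB.
      apply: is_deriveB; last exact: dY.
      by have := dY' t t01; rewrite xiE' aE.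
    apply: is_derive_scalemx.
    apply: frob_derive_path; last exact: dY.
    exact/rU/seg.
  - move=> t t01; have /andP[t0 t1] := t01.
    have xir : `|xi t - x0| < r by exact: seg.
    have xir' : `|xi' t - x0| < r by rewrite -xiE'; exact: seg.
    have fl := flatA a v (Y x t) (rU _ xir).
    set y := Y x t in fl *; set y' := Y (x + v) t.
    have dZ : 'D_(t *: v) (fun z => A z a y) (xi t) = t *: 'D_v (fun z => A z a y) (xi t).
      apply: derive_scale; exact: (smooth_mx_differentiable oU (smoothA _ _) (rU _ xir)).
    (* Flatness [fl] exchanges the derivative along [a] for the one along [v]. The terms of first
       order in [v] then cancel outside [A (xi' t) a (w t)], and the remaining four groups are
       quadratic in |v|, one for each summand of [C]. *)
    have -> : w' t = A (xi' t) a (w t)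
      + (A (xi' t) a y - A (xi t) a y - 'D_(t *: v) (fun z => A z a y) (xi t))
      + t *: (A (xi' t) a (A (xi t) v y) - A (xi t) a (A (xi t) v y))
      + A (xi' t) v (y' - y)
      + (A (xi' t) v y - A (xi t) v y).
      rewrite /w' -/y -/y' fl dZ /w -/y -/y' !ADy !ANy AZy !(ADv (xi' t) a v).
      set e1 := A _ a y'; set e2 := A _ v y'; set e3 := A _ a y.
      set e4 := A _ v y; set e5 := derive _ _ _; set e6 := A (xi t) a e4.
      set e7 := A (xi' t) a e4; set e8 := A (xi' t) a y; set e9 := A (xi' t) v y.
      by apply/rowP => i; rewrite !mxE; ring.
    have ar : `|a| < r by [].
    have a1 : `|a| <= 1 by rewrite ltW// (lt_le_trans ar).
    have tv : `|t *: v| <= `|v| by rewrite normrZ ger0_norm// ler_piMl.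
    have yH : `|y| <= H by exact: YH.
    have v2 : 0 <= `|v| ^+ 2 by rewrite exprn_ge0.
    apply: le_trans (ler_normD _ _) _; apply: le_trans (_ : _ <= (2^-1 * `|w t| +
      K * H * `|v| ^+ 2 + K * K * H * `|v| ^+ 2 + K * L * `|v| ^+ 2) + K * H * `|v| ^+ 2) _;
      last by rewrite /C !mulrDl !addrA.
    apply: lerD; last first.
      apply: le_trans (b2 _ _ _ _ xir xir') _.
      apply: le_trans (ler_prod4 K0 _ _ _ tv (lexx _) yH) _ => //.
      by apply: eqle; ring.
    apply: le_trans (ler_normD _ _) _; apply: lerD; last first.
      apply: le_trans (b1 _ _ _ xir') _.
      apply: (@le_trans _ _ (K * `|v| * (L * `|v|))); last by apply: eqle; ring.
      by rewrite ler_wpM2l ?mulr_ge0// YL.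
    apply: le_trans (ler_normD _ _) _; apply: lerD; last first.
      rewrite normrZ ger0_norm//; apply: le_trans (ler_piMl _ t1) _ => //.
      apply: le_trans (b2 _ _ _ _ xir xir') _.
      have h : `|A (xi t) v y| <= K * `|v| * H.
        by apply: le_trans (b1 _ _ _ xir) _; rewrite ler_wpM2l ?mulr_ge0.
      apply: le_trans (ler_prod4 K0 _ _ _ tv a1 h) _ => //.
      by apply: eqle; ring.
    apply: le_trans (ler_normD _ _) _; apply: lerD; first exact: small.
    apply: le_trans (b3 _ _ _ _ xir xir') _.
    have tv2 : `|t *: v| ^+ 2 <= `|v| ^+ 2 by rewrite lerXn2r ?nnegrE.
    apply: le_trans (ler_prod4 K0 _ _ _ tv2 a1 yH) _ => //.
    by apply: eqle; ring.
  - by rewrite ler01 lexx.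
have oB : open [set x | `|x - x0| < r] by exact: open_normball.
have est x : `|x - x0| < r -> differentiable u x /\ forall v, 'D_v u x = A x v (u x).
  move=> xr.
  have linL : linear (fun v => A x v (u x)) by exact: linAv.
  pose Lx : {linear 'rV[R]_n -> 'rV[R]_q} :=
    HB.pack (fun v => A x v (u x)) (GRing.isLinear.Build R _ _ _ _ linL).
  apply: (@differentiable_of_estimate _ _ _ u x Lx).
    exact: (linear_continuous_rV linL).
  move=> e e0.
  have : \forall y \near x, `|y - x0| < r by apply: open_nbhs_nbhs.
  move=> /nbhs_ballP[d /= d0 dP].
  pose d' := Num.min d (e / (2 * C + 1)).
  have C1 : 0 < 2 * C + 1 by rewrite ltr_wpDl// mulr_ge0.
  have d'0 : 0 < d' by rewrite lt_min d0 divr_gt0.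
  apply/nbhs_ballP; exists d' => // v; rewrite -ball_normE /ball_/= sub0r normrN lt_min => /andP[vd ve].
  rewrite (addrC v x); apply: le_trans (main x v xr _) _.
    by apply: dP; rewrite -ball_normE /ball_/= opprD addrA subrr add0r normrN.
  rewrite expr2 mulrA ler_wpM2r//.
  move: ve; rewrite ltr_pdivlMr// => /ltW; apply: le_trans.
  by rewrite mulrC ler_wpM2l// lerDl.
exists r; split=> //; split=> //; exists u; split.
(* Bootstrap: the partial derivatives of [u] are given by the equation as smooth coefficients times
   entries of [u], so each order of regularity yields the next. *)
- move=> k; elim: k => [|k IH].
    by split=> // x /= /est[du _]; exact: differentiable_continuous.
  split=> [x /= /est[du _]|i]; first exact: differentiable_continuous.
  split=> [x /= /est[du _]|]; first exact: diff_derivable.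
  have cu j : Ck k [set x | `|x - x0| < r] (fun x => u x 0 j) by exact: ((Ck_mxP k u oB).1 IH 0 j).
  suff : Ck k [set x | `|x - x0| < r] (fun x => A x 'e_i (u x)).
    by apply: (Ck_ext oB) => x /= xr; have [_ ->] := est x xr.
  apply: (Ck_ext oB (f := fun x => \sum_j u x 0 j *: A x 'e_i 'e_j)).
    by move=> x _; rewrite [RHS](linear_coord (linAy x 'e_i)).
  apply/(Ck_mxP _ _ oB) => i' j'.
  apply: (Ck_ext oB (f := fun x => \sum_j u x 0 j * A x 'e_i 'e_j i' j')).
    by move=> x _; rewrite summxE; apply: eq_bigr => j _; rewrite mxE.
  apply: (Ck_sum oB) => j; apply: (CkM oB); first exact: cu.
  apply: (@Ck_sub _ _ _ _ U); first by move=> x /= /rU.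
  exact: (smooth_entry oU _).1 (smoothA 'e_i 'e_j) i' j' k.
(* The ray from [x0] to itself has zero velocity, so its solution keeps the value [y0]. *)
- have [|Y0 dY] := HY x0; first by rewrite subrr normr0.
  apply/eqP; rewrite -subr_eq0 -normr_le0 -(mulr0 2).
  apply: (@growth_bound R q (fun t => Y x0 t - y0) (fun=> 0)) => //.
  + by rewrite Y0 subrr.
  + move=> t t01; have := is_deriveB (dY t t01) (is_derive_cst y0 t 1).
    by rewrite subrr A0v subrr.
  + by move=> t _; rewrite normr0 addr0 mulr_ge0// invr_ge0.
  + by rewrite ler01 lexx.
- by move=> x v /est[].
Qed.

End Frobenius.

(** * Levi-Civita connection and curvature *)

Section Inner.
Variables (R : realType) (n : nat).
Implicit Types (G H : 'M[R]_n) (u v w : 'rV[R]_n).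

Lemma innerDl G u v w : inner G (u + v) w = inner G u w + inner G v w.
Proof. by rewrite /inner !mulmxDl mxE. Qed.

Lemma innerDr G u v w : inner G w (u + v) = inner G w u + inner G w v.
Proof. by rewrite /inner linearD/= mulmxDr mxE. Qed.

Lemma innerZl G a u w : inner G (a *: u) w = a * inner G u w.
Proof. by rewrite /inner -!scalemxAl mxE. Qed.

Lemma innerZr G a u w : inner G w (a *: u) = a * inner G w u.
Proof. by rewrite /inner linearZ/= -scalemxAr mxE. Qed.

Lemma innerNl G u w : inner G (- u) w = - inner G u w.
Proof. by rewrite -scaleN1r innerZl mulN1r. Qed.

Lemma innerNr G u w : inner G w (- u) = - inner G w u.
Proof. by rewrite -scaleN1r innerZr mulN1r. Qed.

Lemma innerBl G u v w : inner G (u - v) w = inner G u w - inner G v w.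
Proof. by rewrite innerDl innerNl. Qed.

Lemma inner0l G w : inner G 0 w = 0.
Proof. by rewrite /inner !mul0mx mxE. Qed.

Lemma inner0r G w : inner G w 0 = 0.
Proof. by rewrite /inner trmx0 mulmx0 mxE. Qed.

Lemma innerZg G a u w : inner (a *: G) u w = a * inner G u w.
Proof. by rewrite /inner -scalemxAr -scalemxAl mxE. Qed.

Lemma innerDg G H u w : inner (G + H) u w = inner G u w + inner H u w.
Proof. by rewrite /inner mulmxDr mulmxDl mxE. Qed.

Lemma innerC G u v : G^T = G -> inner G u v = inner G v u.
Proof.
move=> sG; rewrite /inner -[in RHS](trmxK (v *m G *m u^T)) [RHS]mxE.
by rewrite !trmx_mul trmxK sG mulmxA.
Qed.

Lemma inner_nondeg G u v : G \in unitmx -> (forall w, inner G u w = inner G v w) -> u = v.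
Proof.
move=> uG uv; apply: (can_inj (mulmxK uG)); apply/rowP => k.
have := uv 'e_k; rewrite /inner !trmx_delta -!colE !mxE; exact.
Qed.

Lemma inner_sharp G (a : 'rV[R]_n -> R) w : G \in unitmx -> linear a ->
  inner G (sharp G a) w = a w.
Proof.
move=> uG la; rewrite /inner /sharp -(mulmxA (\row_k _)) mulVmx// mulmx1 mxE.
pose F : {linear 'rV[R]_n -> R} := HB.pack a (GRing.isLinear.Build R _ _ _ a la).
rewrite -[RHS]/(F w) {2}(row_sum_delta w) linear_sum/=; apply: eq_bigr => k _.
by rewrite -[a (_ *: _)]/(F _) linearZ/= !mxE mulrC.
Qed.

Lemma is_derive_inner (V : normedModType R) (g : V -> 'M[R]_n) (X Y : V -> 'rV[R]_n) (x v : V)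
    (dg : 'M[R]_n) (dX dY : 'rV[R]_n) :
  is_derive x v g dg -> is_derive x v X dX -> is_derive x v Y dY ->
  is_derive x v (fun y => inner (g y) (X y) (Y y))
    (inner dg (X x) (Y x) + inner (g x) dX (Y x) + inner (g x) (X x) dY).
Proof.
move=> hg hX hY.
have /is_derive_mxP H := is_derive_mulmx (is_derive_mulmx hX hg) (is_derive_trmx hY).
apply: (is_derive_eq (H 0 0)).
rewrite /inner mulmxDl [LHS]mxE [X in X + _ = _]mxE; congr (_ + _); exact: addrC.
Qed.

End Inner.

(** Once scalar products are variables, symmetry and compatibility facts pushed into the goal become
    equations between atoms, fit for rewriting, [ring] and [lra]. *)
Ltac gen_inner := repeat match goal with |- context [inner ?a ?b ?c] =>
  generalize (inner a b c); intro end.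

Ltac gen_derive := repeat match goal with |- context [derive ?f ?x ?v] =>
  generalize (derive f x v); intro end.

(** Nondegeneracy is what the Koszul formula relies on; positivity is added in [riemannian_on],
    where orthonormal bases come in. *)
Record metric_on (R : realType) n (U : set 'rV[R]_n) (g : 'rV[R]_n -> 'M[R]_n) : Prop := MetricOn {
  metric_open : open U;
  metric_smooth : smooth_on U g;
  metric_sym : forall x, U x -> (g x)^T = g x;
  metric_unit : forall x, U x -> g x \in unitmx }.

Lemma smooth_inner (R : realType) n (U : set 'rV[R]_n) (h : 'rV[R]_n -> 'M[R]_n)
    (X Y : 'rV[R]_n -> 'rV[R]_n) : open U ->
  smooth_on U h -> smooth_on U X -> smooth_on U Y ->
  smooth_on U (fun y => inner (h y) (X y) (Y y)).
Proof.
move=> oU sh sX sY.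
have := smooth_mulmx oU (smooth_mulmx oU sX sh) (smooth_trmx oU sY).
by move=> /(smooth_entry oU)/(_ 0 0).
Qed.

Section Christoffel.
Variables (R : realType) (n : nat) (U : set 'rV[R]_n) (g : 'rV[R]_n -> 'M[R]_n).
Hypothesis mg : metric_on U g.

Let oU := metric_open mg.
Let smooth_g := metric_smooth mg.
Let sym_g := metric_sym mg.
Let unit_g := metric_unit mg.

Lemma derive_inner_cst x u v w : U x ->
  'D_w (fun y => inner (g y) u v) x = inner ('D_w g x) u v.
Proof.
move=> Ux.
have [_ ->] := is_derive_inner (smooth_mx_is_derive oU smooth_g w Ux)
  (is_derive_cst u x w) (is_derive_cst v x w).
by rewrite inner0l inner0r !addr0.
Qed.

Lemma derive_metric_sym x w : U x -> ('D_w g x)^T = 'D_w g x.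
Proof.
move=> Ux; have [_ <-] := is_derive_trmx (smooth_mx_is_derive oU smooth_g w Ux).
apply: (derive_ext oU Ux) => y.
exact: sym_g.
Qed.

Lemma koszulE x u v w : U x -> koszul g x u v w =
  2^-1 * (inner ('D_u g x) v w + inner ('D_v g x) u w - inner ('D_w g x) u v).
Proof. by move=> Ux; rewrite /koszul !derive_inner_cst. Qed.

Lemma koszul_linear x u v : U x -> linear (koszul g x u v).
Proof.
move=> Ux a w w'; rewrite !koszulE// (derive_linear a w w' (smooth_mx_differentiable oU smooth_g Ux)).
gen_derive; rewrite !innerDr !innerZr innerDg innerZg.
have sc (b : R) : a *: b = a * b by [].
by rewrite sc; gen_inner; ring.
Qed.

Lemma christoffelE x u v w : U x ->
  inner (g x) (christoffel g x u v) w = koszul g x u v w.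
Proof. by move=> Ux; rewrite inner_sharp ?unit_g//; exact: koszul_linear. Qed.

Lemma christoffel_sym x u v : U x -> christoffel g x u v = christoffel g x v u.
Proof.
move=> Ux; apply: (inner_nondeg (unit_g Ux)) => w; rewrite !christoffelE// !koszulE//.
have := innerC u v (derive_metric_sym w Ux); gen_inner => ->; ring.
Qed.

Lemma christoffel_linear x u : U x -> linear (christoffel g x u).
Proof.
move=> Ux a v w; apply: (inner_nondeg (unit_g Ux)) => z.
rewrite innerDl innerZl !christoffelE// !koszulE//.
rewrite (derive_linear a v w (smooth_mx_differentiable oU smooth_g Ux)); gen_derive.
by rewrite !innerDl !innerDr !innerZl !innerZr innerDg innerZg; gen_inner; ring.
Qed.

Lemma christoffelDr x u v w : U x ->
  christoffel g x u (v + w) = christoffel g x u v + christoffel g x u w.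
Proof. by move=> Ux; have := christoffel_linear u Ux 1 v w; rewrite !scale1r. Qed.

Lemma christoffel0r x u : U x -> christoffel g x u 0 = 0.
Proof.
move=> Ux; apply: (addIr (christoffel g x u 0)).
by rewrite -christoffelDr// !add0r.
Qed.

Lemma christoffelZr x u a v : U x ->
  christoffel g x u (a *: v) = a *: christoffel g x u v.
Proof.
by move=> Ux; have := christoffel_linear u Ux a v 0; rewrite christoffel0r// !addr0.
Qed.

Lemma christoffelBr x u v w : U x ->
  christoffel g x u (v - w) = christoffel g x u v - christoffel g x u w.
Proof. by move=> Ux; rewrite christoffelDr// -scaleN1r christoffelZr// scaleN1r. Qed.

Lemma christoffelDl x u v w : U x ->
  christoffel g x (v + w) u = christoffel g x v u + christoffel g x w u.
Proof. by move=> Ux; rewrite !(christoffel_sym _ u)// christoffelDr. Qed.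

Lemma christoffelZl x u a v : U x ->
  christoffel g x (a *: v) u = a *: christoffel g x v u.
Proof. by move=> Ux; rewrite !(christoffel_sym _ u)// christoffelZr. Qed.

Lemma christoffel0l x u : U x -> christoffel g x 0 u = 0.
Proof. by move=> Ux; rewrite christoffel_sym// christoffel0r. Qed.

Lemma metric_compat x u v w : U x -> inner ('D_u g x) v w =
  inner (g x) (christoffel g x u v) w + inner (g x) v (christoffel g x u w).
Proof.
move=> Ux; rewrite (innerC v _ (sym_g Ux)).
have := christoffelE u v w Ux; rewrite (koszulE _ _ _ Ux).
have := christoffelE u w v Ux; rewrite (koszulE _ _ _ Ux).
have := innerC w v (derive_metric_sym u Ux).
have := innerC u w (derive_metric_sym v Ux).
have := innerC u v (derive_metric_sym w Ux).
by gen_inner => -> -> -> -> ->; field.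
Qed.

Lemma christoffel_expand z (a b : 'rV[R]_n) : U z -> christoffel g z a b =
  \sum_i \sum_j (a 0 i * b 0 j) *: christoffel g z 'e_i 'e_j.
Proof.
move=> Uz.
have E c u : christoffel g z c u = \sum_j u 0 j *: christoffel g z c 'e_j.
  exact: linear_coord (christoffel_linear c Uz) u.
rewrite christoffel_sym// E; apply: eq_bigr => i _.
rewrite christoffel_sym// E scaler_sumr; apply: eq_bigr => j _.
by rewrite scalerA.
Qed.

(** The product rule for the Christoffel symbol applied to moving vectors, at a moving base point
    [t y]: the identity map serves the Bianchi identity, a change of charts serves naturality. *)
Lemma christoffel_is_derive_along x (v w : 'rV[R]_n) (t X Y : 'rV[R]_n -> 'rV[R]_n)
    (dX dY : 'rV[R]_n) : (\forall y \near x, U (t y)) -> U (t x) ->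
  (forall a b, is_derive x v (fun y : 'rV[R]_n => christoffel g (t y) a b)
     ('D_w (fun z : 'rV[R]_n => christoffel g z a b) (t x))) ->
  is_derive x v X dX -> is_derive x v Y dY ->
  is_derive x v (fun y : 'rV[R]_n => christoffel g (t y) (X y) (Y y))
    ('D_w (fun z : 'rV[R]_n => christoffel g z (X x) (Y x)) (t x)
     + christoffel g (t x) dX (Y x) + christoffel g (t x) (X x) dY).
Proof.
move=> nU Ux hG; pose F i j (z : 'rV[R]_n) := christoffel g z 'e_i 'e_j.
have general (X' Y' : 'rV[R]_n -> 'rV[R]_n) (dX' dY' : 'rV[R]_n) :
    is_derive x v X' dX' -> is_derive x v Y' dY' ->
  is_derive x v (fun y : 'rV[R]_n => christoffel g (t y) (X' y) (Y' y))
  (\sum_i \sum_j (X' x 0 i * Y' x 0 j) *: 'D_w (F i j) (t x)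
  + christoffel g (t x) dX' (Y' x) + christoffel g (t x) (X' x) dY').
  move=> /is_derive_mxP hX' /is_derive_mxP hY'.
  have hF i j : is_derive x v (fun y => F i j (t y)) ('D_w (F i j) (t x)) := hG 'e_i 'e_j.
  have D := is_derive_fsum (fun i => is_derive_fsum (fun j =>
    is_derive_scalemx (is_deriveM (hX' 0 i) (hY' 0 j)) (hF i j))).
  apply: near_eq_is_derive (is_derive_eq D _).
    by apply: filterS nU => y Uy; rewrite christoffel_expand.
  rewrite (christoffel_expand dX' _ Ux) (christoffel_expand _ dY' Ux).
  rewrite -!big_split/=; apply: eq_bigr => i _; rewrite -!big_split/=; apply: eq_bigr => j _.
  rewrite -/(F i j (t x)); generalize (F i j (t x)) ('D_w (F i j) (t x)) => p q.
  have sc (a b : R) : a *: b = a * b by [].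
  have -> : ((fun y : 'rV[R]_n => X' y 0 i) * (fun y : 'rV[R]_n => Y' y 0 j)) x =
    X' x 0 i * Y' x 0 j by [].
  by rewrite !sc; apply/rowP => l; rewrite !mxE; ring.
(* A second use of [general], with the vectors frozen at [x], identifies the coordinate sum with the
   derivative of the symbol itself. *)
move=> hX hY; apply: (is_derive_eq (general X Y dX dY hX hY)); congr (_ + _ + _).
have [_ G0] := general _ _ _ _ (is_derive_cst (X x) x v) (is_derive_cst (Y x) x v).
have [_ E] := hG (X x) (Y x).
apply: (etrans _ E); apply: (etrans _ (esym G0)).
by rewrite christoffel0r// christoffel0l// !addr0.
Qed.

Lemma smooth_christoffel u v : smooth_on U (fun y => christoffel g y u v).
Proof.
apply: (smooth_mulmx oU); last exact: smooth_invmx.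
apply/(smooth_entry oU) => i k.
apply: (smooth_ext oU (f := fun y => koszul g y u v 'e_k)).
  by move=> y _; rewrite !mxE.
apply: (smooth_ext oU (f := fun y => 2^-1 * (inner ('D_u g y) v 'e_k
   + inner ('D_v g y) u 'e_k - inner ('D_('e_k) g y) u v))).
  by move=> y Uy; rewrite koszulE.
have sD w a b : smooth_on U (fun y => inner ('D_w g y) a b).
  by apply: (smooth_inner oU); [exact: smooth_mx_derive|exact: smooth_cst|exact: smooth_cst].
apply: (smoothM oU); first exact: smooth_cst.
by apply: (smoothB oU) => //; apply: (smoothD oU).
Qed.

Lemma nabla_cstE x u X : nabla g (cst u) X x = 'D_u X x + christoffel g x u (X x).
Proof. by []. Qed.

Lemma nabla_ext x u (X Y : 'rV[R]_n -> 'rV[R]_n) : U x -> (forall y, U y -> X y = Y y) ->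
  nabla g (cst u) X x = nabla g (cst u) Y x.
Proof.
move=> Ux XY.
exact: (congr2 (fun a b => a + b) (derive_ext oU Ux XY) (congr1 (christoffel g x u) (XY x Ux))).
Qed.

Lemma nabla_cst_cst u v : nabla g (cst u) (cst v) = fun x => christoffel g x u v.
Proof. by apply/funext => x; rewrite nabla_cstE derive_cst add0r. Qed.

Lemma derive_inner_nabla x u (X Y : 'rV[R]_n -> 'rV[R]_n) : U x ->
  derivable X x u -> derivable Y x u ->
  'D_u (fun y => inner (g y) (X y) (Y y)) x =
  inner (g x) (nabla g (cst u) X x) (Y x) + inner (g x) (X x) (nabla g (cst u) Y x).
Proof.
move=> Ux dX dY.
have [_ ->] := is_derive_inner (smooth_mx_is_derive oU smooth_g u Ux)
  (derivableP dX) (derivableP dY).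
rewrite (metric_compat u _ _ Ux) !nabla_cstE.
by gen_derive; rewrite innerDl innerDr; gen_inner; ring.
Qed.

Lemma curvatureE x u v w : U x -> curvature g x u v w =
  nabla g (cst v) (fun y => christoffel g y u w) x
  - nabla g (cst u) (fun y => christoffel g y v w) x.
Proof.
move=> Ux; rewrite /curvature /curvature_op !nabla_cst_cst opprB.
have -> : lie_bracket (cst u) (cst v) = cst 0.
  by apply/funext => y; rewrite /lie_bracket !derive_cst subrr.
by rewrite nabla_cst_cst christoffel0l// add0r.
Qed.

Lemma riemannE x u v w z : U x -> riemann g x u v w z =
  inner (g x) (nabla g (cst v) (fun y => christoffel g y u w) x) z
  - inner (g x) (nabla g (cst u) (fun y => christoffel g y v w) x) z.
Proof. by move=> Ux; rewrite /riemann curvatureE// innerBl. Qed.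

Lemma riemann_antisym12 x u v w z : U x -> riemann g x u v w z = - riemann g x v u w z.
Proof. by move=> Ux; rewrite !riemannE// opprB. Qed.

Lemma christoffel_derivable x u v w : U x -> derivable (fun y => christoffel g y u v) x w.
Proof. by move=> Ux; exact: (smooth_mx_derivable oU (smooth_christoffel u v) Ux). Qed.

Lemma christoffel_is_derive u v w x : U x ->
  is_derive x w (fun y => christoffel g y u v) ('D_w (fun y => christoffel g y u v) x).
Proof. by move=> Ux; apply: derivableP; exact: christoffel_derivable. Qed.

(* Second derivatives of the function g(w, z) commute. *)
Lemma riemann_antisym34 x u v w z : U x -> riemann g x u v w z = - riemann g x u v z w.
Proof.
move=> Ux.
have D1 (a b y : 'rV[R]_n) : U y -> 'D_a (fun y => inner (g y) w b) y =
    inner (g y) (christoffel g y a w) b + inner (g y) w (christoffel g y a b).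
  by move=> Uy; rewrite derive_inner_cst// metric_compat.
have D2 (a b : 'rV[R]_n) : 'D_b ('D_a (fun y => inner (g y) w z)) x =
    inner (g x) (nabla g (cst b) (fun y => christoffel g y a w) x) z
    + inner (g x) (christoffel g x a w) (christoffel g x b z)
    + (inner (g x) (christoffel g x b w) (christoffel g x a z)
    + inner (g x) w (nabla g (cst b) (fun y => christoffel g y a z) x)).
  transitivity ('D_b (fun y => inner (g y) (christoffel g y a w) z
       + inner (g y) w (christoffel g y a z)) x).
    apply: (derive_ext oU Ux) => y Uy.
    exact: D1.
  have d1 : derivable (fun y => inner (g y) (christoffel g y a w) z) x b.
    by have [] := is_derive_inner (smooth_mx_is_derive oU smooth_g b Ux)
       (christoffel_is_derive a w b Ux) (is_derive_cst z x b).
  have d2 : derivable (fun y => inner (g y) w (christoffel g y a z)) x b.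
    by have [] := is_derive_inner (smooth_mx_is_derive oU smooth_g b Ux)
       (is_derive_cst w x b) (christoffel_is_derive a z b Ux).
  rewrite (deriveD d1 d2).
  rewrite (derive_inner_nabla Ux (christoffel_derivable Ux) (derivable_cst z x b)).
  rewrite (derive_inner_nabla Ux (derivable_cst w x b) (christoffel_derivable Ux)).
  by rewrite !nabla_cst_cst.
have sm : smooth_on U (fun y => inner (g y) w z).
  by apply: (smooth_inner oU) => //; exact: smooth_cst.
have := etrans (esym (D2 v u)) (etrans (derive_comm oU u v sm Ux) (D2 u v)).
have := innerC w (nabla g (cst u) (fun y => christoffel g y v z) x) (sym_g Ux).
have := innerC w (nabla g (cst v) (fun y => christoffel g y u z) x) (sym_g Ux).
by rewrite !(riemannE _ _ _ _ Ux); gen_inner; lra.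
Qed.

(** The six terms cancel in pairs because the connection is torsion free, that is, the Christoffel
    symbol is symmetric. *)
Lemma riemann_bianchi x u v w z : U x ->
  riemann g x u v w z + riemann g x v w u z + riemann g x w u v z = 0.
Proof.
move=> Ux; rewrite !riemannE//.
have S (a b c : 'rV[R]_n) : nabla g (cst a) (fun y => christoffel g y b c) x =
    nabla g (cst a) (fun y => christoffel g y c b) x.
  by apply: (nabla_ext a Ux) => y Uy; exact: christoffel_sym.
move: (S v u w) (S u v w) (S w u v).
repeat match goal with |- context [nabla ?a ?b ?c ?d] => generalize (nabla a b c d); intro end.
by move=> -> -> ->; gen_inner; ring.
Qed.

(** The classical octahedron argument: a linear combination of four cyclic identities and the two
    antisymmetries. *)
Lemma riemann_pair x u v w z : U x -> riemann g x u v w z = riemann g x w z u v.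
Proof.
move=> Ux.
have A a b c d := riemann_antisym12 a b c d Ux.
have B a b c d := riemann_antisym34 a b c d Ux.
have C a b c d := riemann_bianchi a b c d Ux.
have := C u v w z; have := C v w z u; have := C w z u v; have := C z u v w.
have := A u v w z; have := A v w u z; have := A w u v z; have := A v w z u.
have := A w z v u; have := A z v w u; have := A w z u v; have := A z u w v.
have := A u w z v; have := A z u v w; have := A u v z w; have := A v z u w.
have := B u v w z; have := B v w u z; have := B w u v z.
have := B w z v u; have := B z v w u; have := B z u w v.
have := B u w z v; have := B v w z u; have := B v z u w; have := B w z u v; have := B z u v w; have := B u v z w.
rewrite /riemann; gen_inner; lra.
Qed.

Lemma riemannDr x u v w z z' : riemann g x u v w (z + z') = riemann g x u v w z + riemann g x u v w z'.
Proof. exact: innerDr. Qed.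

Lemma riemannZr x u v w a z : riemann g x u v w (a *: z) = a * riemann g x u v w z.
Proof. exact: innerZr. Qed.

Lemma smooth_curvature u v w : smooth_on U (fun y => curvature g y u v w).
Proof.
have sG a b c : smooth_on U (fun y => christoffel g y a (christoffel g y b c)).
  apply: (smooth_ext oU (f := fun y => \sum_k christoffel g y b c 0 k *: christoffel g y a 'e_k)).
    move=> y Uy; rewrite [in RHS](row_sum_delta (christoffel g y b c)).
    elim/big_ind2 : _ => [|p p' r r' -> ->|k _]; first by rewrite christoffel0r.
      by rewrite christoffelDr.
    by rewrite christoffelZr.
  apply: (smooth_sum oU) => k; apply: (smooth_scalemx oU); last exact: smooth_christoffel.
  exact: (smooth_entry oU _).1 (smooth_christoffel b c) 0 k.
have sN a b c : smooth_on U (nabla g (cst a) (fun y => christoffel g y b c)).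
  apply: (smooth_ext oU (f := fun y => 'D_a (fun y => christoffel g y b c) y
     + christoffel g y a (christoffel g y b c))) => //.
  apply: (smoothD oU) => //; apply: (smooth_mx_derive oU); exact: smooth_christoffel.
apply: (smooth_ext oU (f := fun y => nabla g (cst v) (fun y => christoffel g y u w) y
  - nabla g (cst u) (fun y => christoffel g y v w) y)).
  by move=> y Uy; rewrite curvatureE.
exact: (smooth_mxB oU).
Qed.

End Christoffel.

(** * Conformal change of metric *)

Lemma conformal_metric (R : realType) n (U : set 'rV[R]_n) (g : 'rV[R]_n -> 'M[R]_n)
    (h : 'rV[R]_n -> R) :
  metric_on U g -> smooth_on U h -> (forall x, U x -> h x != 0) ->
  metric_on U (fun y => h y *: g y).
Proof.
move=> [oU sg symg ug] sh h0; split=> // [|x Ux|x Ux]; first exact: smooth_scalemx.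
  by rewrite linearZ/= symg.
by rewrite unitmxZ ?ug// unitfE h0.
Qed.

(* T is half the gradient of ln h. *)
Section Conformal.
Variables (R : realType) (n : nat) (U : set 'rV[R]_n) (g : 'rV[R]_n -> 'M[R]_n).
Hypothesis mg : metric_on U g.

Let oU := metric_open mg.
Let smooth_g := metric_smooth mg.
Let sym_g := metric_sym mg.
Variables (h : 'rV[R]_n -> R) (T : 'rV[R]_n -> 'rV[R]_n).
Hypothesis smooth_h : smooth_on U h.
Hypothesis h_neq0 : forall x, U x -> h x != 0.
Hypothesis smooth_T : smooth_on U T.
Hypothesis hT : forall x (u : 'rV[R]_n), U x -> 'D_u h x = 2 * h x * inner (g x) (T x) u.

Let gh := fun y => h y *: g y.

Let mgh : metric_on U gh := conformal_metric mg smooth_h h_neq0.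

Lemma conformal_christoffel x (u v : 'rV[R]_n) : U x -> christoffel gh x u v =
  christoffel g x u v + inner (g x) (T x) u *: v + inner (g x) (T x) v *: u
  - inner (g x) u v *: T x.
Proof.
move=> Ux; apply: (inner_nondeg (metric_unit mgh Ux)) => w.
rewrite (christoffelE mgh)//.
rewrite (koszulE mgh)//.
have D (a : 'rV[R]_n) : 'D_a gh x = h x *: 'D_a g x + 'D_a h x *: g x.
  have dh : is_derive x a h ('D_a h x).
    by apply: derivableP; exact: (smooth_derivable oU smooth_h Ux).
  have [_ ] := is_derive_scalemx dh (smooth_mx_is_derive oU smooth_g a Ux).
  by rewrite addrC => <-.
rewrite !D !hT//.
have := christoffelE mg u v w Ux; rewrite (koszulE mg _ _ _ Ux).
have := innerC u v (sym_g Ux); have := innerC u w (sym_g Ux); have := innerC v w (sym_g Ux).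
gen_derive.
rewrite /gh !innerDg !innerZg innerBl !innerDl !innerZl.
move: (h x) => c; gen_inner => -> -> -> ->.
by field.
Qed.

(** [T] is a gradient: its covariant derivative is a Hessian, whose symmetry comes from commuting
    second derivatives of [h] and the absence of torsion. *)
Lemma conformal_hessian_sym x (a b : 'rV[R]_n) : U x ->
  inner (g x) (nabla g (cst a) T x) b = inner (g x) (nabla g (cst b) T x) a.
Proof.
move=> Ux.
have dT (c : 'rV[R]_n) : derivable T x c by exact: (smooth_mx_derivable oU smooth_T Ux).
have dh (c : 'rV[R]_n) : derivable h x c by exact: (smooth_derivable oU smooth_h Ux).
have E (c d : 'rV[R]_n) : 'D_c ('D_d h) x = 2 * (h x * (inner (g x) (nabla g (cst c) T x) d
    + inner (g x) (T x) (christoffel g x c d))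
    + inner (g x) (T x) d * (2 * h x * inner (g x) (T x) c)).
  transitivity ('D_c (fun y => 2 * (h y * inner (g y) (T y) d)) x).
    apply: (derive_ext oU Ux) => y Uy.
    by rewrite hT// mulrA.
  have di : derivable (fun y => inner (g y) (T y) d) x c.
    by have [] := is_derive_inner (smooth_mx_is_derive oU smooth_g c Ux)
       (derivableP (dT c)) (is_derive_cst d x c).
  rewrite -(hT c Ux).
  have [_ ->] := is_deriveZ 2 (is_deriveM (derivableP (dh c)) (derivableP di)).
  rewrite (derive_inner_nabla mg Ux (dT c) (derivable_cst d x c)).
  by rewrite nabla_cst_cst.
have := etrans (esym (E a b)) (etrans (derive_comm oU a b smooth_h Ux) (E b a)).
rewrite (christoffel_sym mg a b Ux).
have := h_neq0 Ux; move: (h x) => c; gen_inner => c0 e; apply: (mulfI c0); lra.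
Qed.

(** The tensor by which the Schouten tensor decreases when g is replaced by h g. *)
Definition conformal_schouten x (a b : 'rV[R]_n) : R :=
  inner (g x) (nabla g (cst a) T x) b - inner (g x) (T x) a * inner (g x) (T x) b
  + 2^-1 * inner (g x) (T x) (T x) * inner (g x) a b.

(** An unsimplified half of the curvature. The terms containing Christoffel symbols, apart from the
    curvature part of g, are symmetric in [u] and [v] once the torsion vanishes, and disappear on
    antisymmetrising. *)
Lemma conformal_nabla x (u v w z : 'rV[R]_n) : U x ->
  inner (g x) (nabla gh (cst v) (fun y => christoffel gh y u w) x) z =
  inner (g x) (nabla g (cst v) (fun y => christoffel g y u w) x) z
  + (inner (g x) (nabla g (cst v) T x) u + inner (g x) (T x) (christoffel g x v u))
    * inner (g x) w z
  + (inner (g x) (nabla g (cst v) T x) w + inner (g x) (T x) (christoffel g x v w))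
    * inner (g x) u z
  - (inner (g x) (christoffel g x v u) w + inner (g x) u (christoffel g x v w))
    * inner (g x) (T x) z
  - inner (g x) u w * inner (g x) (nabla g (cst v) T x) z
  + (inner (g x) (T x) v * inner (g x) (christoffel g x u w) z
     + inner (g x) (T x) (christoffel g x u w) * inner (g x) v z
     - inner (g x) v (christoffel g x u w) * inner (g x) (T x) z)
  + (inner (g x) (T x) u * inner (g x) (christoffel g x v w) z
     + inner (g x) (T x) w * inner (g x) (christoffel g x v u) z)
  + (inner (g x) (T x) v * (inner (g x) (T x) u * inner (g x) w z
       + inner (g x) (T x) w * inner (g x) u z - inner (g x) u w * inner (g x) (T x) z)
     + (2 * inner (g x) (T x) u * inner (g x) (T x) w
        - inner (g x) u w * inner (g x) (T x) (T x)) * inner (g x) v z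
     - (inner (g x) (T x) u * inner (g x) v w + inner (g x) (T x) w * inner (g x) v u
        - inner (g x) u w * inner (g x) (T x) v) * inner (g x) (T x) z).
Proof.
move=> Ux.
have dT : is_derive x v T ('D_v T x).
  by apply: derivableP; exact: (smooth_mx_derivable oU smooth_T Ux).
have dg := smooth_mx_is_derive oU smooth_g v Ux.
have dTa (a : 'rV[R]_n) : is_derive x v (fun y => inner (g y) (T y) a)
    (inner (g x) (nabla g (cst v) T x) a + inner (g x) (T x) (christoffel g x v a)).
  apply: (is_derive_eq (is_derive_inner dg dT (is_derive_cst a x v))).
  rewrite (metric_compat mg)// nabla_cstE inner0r addr0.
  gen_derive; rewrite /cst innerDl; gen_inner; ring.
have dguw : is_derive x v (fun y => inner (g y) u w)
    (inner (g x) (christoffel g x v u) w + inner (g x) u (christoffel g x v w)).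
  apply: (is_derive_eq (is_derive_inner dg (is_derive_cst u x v) (is_derive_cst w x v))).
  by rewrite (metric_compat mg)// inner0l inner0r !addr0.
have dG := christoffel_is_derive mg u w v Ux.
have d1 := is_derive_scalemx (dTa u) (is_derive_cst w x v).
have d2 := is_derive_scalemx (dTa w) (is_derive_cst u x v).
have d3 := is_derive_scalemx dguw dT.
have [_ E] := is_deriveB (is_deriveD (is_deriveD dG d1) d2) d3.
have N : 'D_v (fun y => christoffel gh y u w) x =
    'D_v (fun y => christoffel g y u w + inner (g y) (T y) u *: w
      + inner (g y) (T y) w *: u - inner (g y) u w *: T y) x.
  by apply: (derive_ext oU Ux) => y; exact: conformal_christoffel.
rewrite (nabla_cstE gh) N (etrans E erefl) !conformal_christoffel// {N E}.
have NT : 'D_v T x = nabla g (cst v) T x - christoffel g x v (T x).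
  by rewrite nabla_cstE addrK.
have NG : 'D_v (fun y => christoffel g y u w) x =
    nabla g (cst v) (fun y => christoffel g y u w) x - christoffel g x v (christoffel g x u w).
  by rewrite nabla_cstE addrK.
rewrite NT NG {NT NG}.
move: (nabla g (cst v) (fun y => christoffel g y u w) x) => ng.
move: (nabla g (cst v) T x) => nt.
rewrite !scaler0 !addr0.
rewrite (christoffelBr mg v _ _ Ux) !(christoffelDr mg v _ _ Ux).
rewrite !(christoffelZr mg v _ _ Ux).
move: (christoffel g x v (christoffel g x u w)) => gg.
move: (christoffel g x u w) (christoffel g x v w) (christoffel g x v u) (christoffel g x v (T x)) => g1 g2 g3 g4.
rewrite /cst.
move: (g x) (T x) (sym_g Ux) => G t sG.
rewrite !(innerDl, innerBl, innerZl, innerDr, innerNr, innerZr, innerNl).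
rewrite (innerC v t sG).
gen_inner; ring.
Qed.

Lemma conformal_riemann x (u v w z : 'rV[R]_n) : U x ->
  riemann gh x u v w z =
  h x * (riemann g x u v w z - bullet (conformal_schouten x) (inner (g x)) u v w z).
Proof.
move=> Ux.
have Z (a b : 'rV[R]_n) : inner (gh x) a z - inner (gh x) b z =
    h x * (inner (g x) a z - inner (g x) b z) by rewrite /gh !innerZg mulrBr.
apply: (etrans (etrans (riemannE mgh u v w z Ux)
  (Z _ _))).
congr (_ * _).
apply: (etrans (congr2 (fun a b => a - b) (conformal_nabla u v w z Ux)
  (conformal_nabla v u w z Ux))).
rewrite (riemannE mg u v w z Ux).
rewrite /bullet /conformal_schouten.
have := conformal_hessian_sym u v Ux.
rewrite (christoffel_sym mg v u Ux).
have := innerC u v (sym_g Ux).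
have := innerC u (christoffel g x v w) (sym_g Ux).
have := innerC v (christoffel g x u w) (sym_g Ux).
by gen_inner => -> -> -> ->; field.
Qed.

End Conformal.

(** * The algebraic Osserman condition *)

Section WeylSplit.
Variables (R : realFieldType) (I : finType) (L : pred I).
Variables (W A : I -> I -> I -> I -> R) (S : I -> I -> R).
Let dl (i j : I) : R := (i == j)%:R.
Hypothesis W12 : forall a b c d, W a b c d = - W b a c d.
Hypothesis W34 : forall a b c d, W a b c d = - W a b d c.
Hypothesis Wpair : forall a b c d, W a b c d = W c d a b.
Hypothesis Wtr : forall b d, \sum_a W a b a d = 0.
Hypothesis WE : forall a b c d, W a b c d =
  A a b c d - (S a c * dl b d + S b d * dl a c - S a d * dl b c - S b c * dl a d).
Hypothesis Ssym : forall a b, S a b = S b a.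
Hypothesis Amix : forall a b c d,
  ~~ [&& L a == L b, L a == L c & L a == L d] -> A a b c d = 0.

Lemma WSeq a b c d : ~~ [&& L a == L b, L a == L c & L a == L d] ->
  W a b c d = - (S a c * dl b d + S b d * dl a c - S a d * dl b c - S b c * dl a d).
Proof. by move=> h; rewrite WE Amix// sub0r. Qed.

Lemma dl_sum (f : I -> R) i : \sum_a f a * dl a i = f i.
Proof.
rewrite (bigD1 i)//= /dl eqxx mulr1 big1 ?addr0// => a /negPf ->.
by rewrite mulr0.
Qed.

Lemma dl_neq i j : L i != L j -> dl i j = 0.
Proof. by rewrite /dl; case: (i =P j) => [->|//]; rewrite eqxx. Qed.

Lemma dlC i j : dl i j = dl j i.
Proof. by rewrite /dl eq_sym. Qed.

Lemma dlxx i : dl i i = 1.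
Proof. by rewrite /dl eqxx. Qed.

Hypothesis cardI : (2 < #|I|)%N.

(** For [b] and [d] on different sides [A] drops out of the vanishing trace, which reduces to (2 -
    #|I|) S b d. *)
Lemma S_mix b d : L b != L d -> S b d = 0.
Proof.
move=> bd; have := Wtr b d.
rewrite (eq_bigr (fun a => (S a d * dl a b + S a b * dl a d - S b d))); last first.
  move=> a _; rewrite WSeq.
    by rewrite (dl_neq bd) dlxx (dlC b a) (Ssym b a); ring.
  by apply: contra bd => /and3P[/eqP <- _ /eqP <-].
rewrite sumrB big_split/= !dl_sum sumr_const (Ssym d b) => /eqP.
have -> : S b d + S b d - S b d *+ #|xpredT : pred I| = S b d * (2 - #|I|%:R).
  by rewrite -[_ *+ #|_|]mulr_natr; ring.
rewrite mulf_eq0.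
case/orP=> [/eqP //|]; rewrite subr_eq0 eqr_nat => /eqP h.
by move: cardI; rewrite -h.
Qed.

Lemma W_rep a b d : W a a b d = 0.
Proof. by have := W12 a a b d; lra. Qed.

Lemma W_rep' a b d : W b d a a = 0.
Proof. by have := W34 b d a a; lra. Qed.

Variable K : R.
Hypothesis osserman : forall z : I -> R,
  \sum_a \sum_b (\sum_c \sum_d z c * z d * W c a d b) ^+ 2 = K * (\sum_c z c ^+ 2) ^+ 2.

Lemma expand_point (i j : I) (s : R) a b : i != j ->
  \sum_c \sum_d (dl c i + s * dl c j) * (dl d i + s * dl d j) * W c a d b =
  W i a i b + s ^+ 2 * W j a j b + s * (W i a j b + W j a i b).
Proof.
move=> ij.
rewrite (eq_bigr (fun c => (W c a i b + s * W c a j b) * dl c i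
    + s * (W c a i b + s * W c a j b) * dl c j)).
  by rewrite big_split/= !dl_sum; ring.
move=> c _.
rewrite (eq_bigr (fun d => (dl c i + s * dl c j) * W c a d b * dl d i
   + s * (dl c i + s * dl c j) * W c a d b * dl d j)).
  by rewrite big_split/= !dl_sum; ring.
by move=> d _; ring.
Qed.

Lemma sq_point (i j : I) (s : R) : i != j ->
  \sum_c (dl c i + s * dl c j) ^+ 2 = 1 + s ^+ 2.
Proof.
move=> ij; have ji : dl i j = 0 by rewrite /dl (negPf ij).
rewrite (eq_bigr (fun c => (dl c i + s * dl c j) * dl c i + s * (dl c i + s * dl c j) * dl c j)).
  by rewrite big_split/= !dl_sum (dlC j i) ji !dlxx; ring.
by move=> c _; ring.
Qed.

Lemma osserman_basis i : \sum_a \sum_b (W i a i b) ^+ 2 = K.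
Proof.
have [j ij] : exists j, i != j.
  have : (0 < #|[pred j | j != i]|)%N.
    by rewrite cardC1 -ltnS (ltn_predK cardI) (ltn_trans _ cardI).
  by move=> /card_gt0P[j /=]; rewrite inE eq_sym => ij; exists j.
(* The vector e_i is written e_i + 0 e_j so that [expand_point] applies. *)
have := osserman (fun c => dl c i + 0 * dl c j).
rewrite (eq_bigr _ (fun c _ => erefl)) sq_point// expr0n/= addr0 expr1n mulr1 => <-.
apply: eq_bigr => a _; apply: eq_bigr => b _.
by rewrite expand_point//; congr (_ ^+ 2); ring.
Qed.

Let N i j a b := W i a i b - W j a j b.
Let M i j a b := W i a j b + W j a i b.

(* The coefficient of s^2 in the Osserman condition at e_i + s e_j. *)
Lemma sum_sq_NM i j : i != j ->
  \sum_a \sum_b N i j a b ^+ 2 = \sum_a \sum_b M i j a b ^+ 2.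
Proof.
move=> ij.
(* Only s = 1 and s = -1 are used: their average removes the odd powers of s, and [osserman_basis]
   supplies the pure terms. *)
have H (s : R) : s ^+ 2 = 1 ->
    \sum_a \sum_b (W i a i b + W j a j b + s * M i j a b) ^+ 2 = K * 4.
  move=> s1; have := osserman (fun c => dl c i + s * dl c j).
  rewrite sq_point// s1 => E.
  have -> : K * 4 = K * (1 + 1) ^+ 2 by ring.
  rewrite -E.
  apply: eq_bigr => a _; apply: eq_bigr => b _.
  by rewrite expand_point// s1 mul1r.
have H1 := H 1 (expr1n _ _).
have H2 := H (-1) (etrans (sqrrN 1) (expr1n _ _)).
have Hi := osserman_basis i; have Hj := osserman_basis j.
apply/eqP; rewrite -subr_eq0.
have -> : \sum_a \sum_b N i j a b ^+ 2 - \sum_a \sum_b M i j a b ^+ 2 =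
   2 * (\sum_a \sum_b (W i a i b) ^+ 2 + \sum_a \sum_b (W j a j b) ^+ 2)
   - 2^-1 * (\sum_a \sum_b (W i a i b + W j a j b + 1 * M i j a b) ^+ 2
          + \sum_a \sum_b (W i a i b + W j a j b + -1 * M i j a b) ^+ 2).
  rewrite -!big_split/= !mulr_sumr -!sumrB; apply: eq_bigr => a _.
  rewrite -!big_split/= !mulr_sumr -!sumrB; apply: eq_bigr => b _.
  by rewrite /N /M; field.
by rewrite H1 H2 Hi Hj; apply/eqP; field.
Qed.

Lemma sum_split2 (i j : I) (f : I -> R) : i != j ->
  \sum_a f a = f i + f j + \sum_(a | (a != i) && (a != j)) f a.
Proof.
by move=> ij; rewrite (bigD1 i)//= (bigD1 j) 1?eq_sym//= addrA.
Qed.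

(* When i and j lie on different sides, the mixed entries of N and M are given by S and
   their squares cancel in sum_sq_NM; only the squares of N off {i, j} remain. *)
Lemma W_cross i j a b : L i != L j -> a != i -> a != j -> b != i -> b != j ->
  W i a i b = W j a j b.
Proof.
move=> Lij ai aj bi bj.
have ij : i != j by apply: contra Lij => /eqP ->.
have dij := dl_neq Lij; have dji : dl j i = 0 by rewrite dlC.
have Sij := S_mix Lij; have Sji : S j i = 0 by rewrite Ssym.
have Lji : L j != L i by rewrite eq_sym.
have Mf x y : M i j x y = S i y * dl x j + S x j * dl i y + (S j y * dl x i + S x i * dl j y).
  rewrite /M !WSeq ?negb_and; [|by rewrite Lji orbT|by rewrite Lij orbT].
  by rewrite dij dji Sij Sji; ring.
have Ni x : N i j i x = S j j * dl i x + S i x.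
  rewrite /N W_rep WSeq ?negb_and; last by rewrite Lji.
  by rewrite dij Sij dlxx; ring.
have Nj x : N i j j x = - (S i i * dl j x + S j x).
  rewrite /N W_rep WSeq ?negb_and; last by rewrite Lij.
  by rewrite dji Sji dlxx; ring.
have Nsym x y : N i j x y = N i j y x.
  by rewrite /N (Wpair i x) (Wpair j x).
pose T := \sum_(a | (a != i) && (a != j)) \sum_(b | (b != i) && (b != j)) N i j a b ^+ 2.
pose P := \sum_(b | (b != i) && (b != j)) S i b ^+ 2.
pose Q := \sum_(b | (b != i) && (b != j)) S j b ^+ 2.
have off x : (x != i) && (x != j) ->
    [/\ dl i x = 0, dl x i = 0, dl j x = 0 & dl x j = 0].
  by move=> /andP[xi xj]; rewrite (dlC i) (dlC j) /dl (negPf xi) (negPf xj).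
(* Off the 2 x 2 block of [i], [j], the squares of [N] sum to 2 P + 2 Q + T and those of [M] to 2 P
   + 2 Q. On the block both give 2 (S i i + S j j)^2, so [T] must vanish. *)
have EN : \sum_a \sum_b N i j a b ^+ 2 =
    (N i j i i ^+ 2 + N i j i j ^+ 2 + P) + (N i j j i ^+ 2 + N i j j j ^+ 2 + Q) + (P + Q + T).
  rewrite (sum_split2 _ ij); congr (_ + _ + _).
  - rewrite (sum_split2 _ ij); congr (_ + _); apply: eq_bigr => x /off[h1 h2 h3 h4].
    by rewrite Ni h1 mulr0 add0r.
  - rewrite (sum_split2 _ ij); congr (_ + _); apply: eq_bigr => x /off[h1 h2 h3 h4].
    by rewrite Nj h3 mulr0 add0r sqrrN.
  - rewrite -!big_split/=; apply: eq_bigr => x /off[h1 h2 h3 h4].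
    rewrite (sum_split2 _ ij) (Nsym x i) (Nsym x j) Ni Nj h1 h3.
    by rewrite !mulr0 !add0r sqrrN.
have EM : \sum_a \sum_b M i j a b ^+ 2 =
    (M i j i i ^+ 2 + M i j i j ^+ 2 + Q) + (M i j j i ^+ 2 + M i j j j ^+ 2 + P) + (P + Q).
  rewrite (sum_split2 _ ij); congr (_ + _ + _).
  - rewrite (sum_split2 _ ij); congr (_ + _); apply: eq_bigr => x /off[h1 h2 h3 h4].
    by rewrite Mf dij h1 h3 dlxx !mulr0 mulr1 !add0r addr0.
  - rewrite (sum_split2 _ ij); congr (_ + _); apply: eq_bigr => x /off[h1 h2 h3 h4].
    by rewrite Mf dji h1 h3 dlxx !mulr0 mulr1 !addr0.
  - rewrite -!big_split/=; apply: eq_bigr => x /off[h1 h2 h3 h4].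
    rewrite (sum_split2 _ ij) big1 => [|y /off[g1 g2 g3 g4]]; last first.
      by rewrite Mf g1 g3 h2 h4 !mulr0 !addr0 expr0n.
    rewrite !Mf dlxx dij dji dlxx h2 h4 (Ssym x i) (Ssym x j).
    by rewrite !mulr0 !mulr1 !add0r !addr0 addrC.
have := sum_sq_NM ij; rewrite EN EM !Ni !Nj !Mf !dlxx dij dji Sij Sji => E.
have T0 : T = 0.
  by move: E; rewrite !mulr0 !mulr1 !add0r !addr0 !sqrrN (addrC (S i i)) expr0n/= => E; lra.
have Nx0 x : 0 <= \sum_(b | (b != i) && (b != j)) N i j x b ^+ 2.
  by apply: sumr_ge0 => y _; exact: sqr_ge0.
move/eqP: T0; rewrite psumr_eq0 => [/allP/(_ a (mem_index_enum a))|x _]; last exact: Nx0.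
rewrite ai aj/= psumr_eq0 => [/allP/(_ b (mem_index_enum b))|x _]; last exact: sqr_ge0.
by rewrite bi bj/= sqrf_eq0 /N subr_eq0 => /eqP.
Qed.

Hypothesis Lboth : exists i j, L i != L j.

Lemma other_side k : exists j, L j != L k.
Proof.
have [i [j ij]] := Lboth; have [ik|] := eqVneq (L i) (L k); last by exists i.
by exists j; rewrite -ik eq_sym.
Qed.

Lemma W_val_opposite j k l : L j != L k -> L k = L l -> W j k j l = - (S j j * dl k l + S k l).
Proof.
move=> jk kl; have jl : L j != L l by rewrite -kl.
by rewrite WSeq ?negb_and ?jk// dlxx (dlC k j) (dl_neq jk) (dl_neq jl); ring.
Qed.

(** On a single side the unknown [A] contributes. [W_cross] replaces [a] by an index [j] of the
    other side, where [W] is expressed by [S] alone. *)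
Lemma W_val_any a k l j : a != k -> a != l -> L a = L k -> L k = L l ->
  L j != L k -> W a k a l = - (S j j * dl k l + S k l).
Proof.
move=> ak al Lak kl jk; rewrite -W_val_opposite//.
have jk' : k != j by apply: contra jk => /eqP ->.
have jl' : l != j by apply: contra jk => /eqP <-; rewrite kl.
apply: W_cross => //; [by rewrite Lak eq_sym|by rewrite eq_sym|by rewrite eq_sym].
Qed.

Lemma W_val a k l : a != k -> a != l -> L k = L l ->
  exists2 j, L j != L k & W a k a l = - (S j j * dl k l + S k l).
Proof.
move=> ak al kl; have [Lak|Lak] := eqVneq (L a) (L k).
  by have [j jk] := other_side k; exists j => //; exact: W_val_any.
by exists a => //; exact: W_val_opposite.
Qed.

(** Three indices force two of them, i0 and i1, onto one side. For distinct k, i on the same side, W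
    i k i k = - (S j j + S k k) for every j opposite, so the sum does not depend on j; exchanging i
    and k shows that S k k = S i i. *)
Lemma S_diag_const : exists w, forall k j, L k != L j -> S k k + S j j = w.
Proof.
have [i0 [i1 [j0 [i01 Li Lj]]]] : exists i0 i1 j0, [/\ i0 != i1, L i0 = L i1 & L j0 != L i0].
  have [i [j ij]] := Lboth.
  have ij' : i != j by apply: contra ij => /eqP ->.
  have [x /andP[xi xj]] : exists x, (x != i) && (x != j).
    apply/existsP; apply: contraLR cardI => /existsPn h; rewrite -leqNgt.
    have -> : #|I| = #|pred2 i j|.
      by apply: eq_card => x; rewrite !inE; move: (h x); rewrite negb_and !negbK.
    by rewrite card2; case: (i != j).
  have [xLi|xLi] := eqVneq (L x) (L i).
    by exists i, x, j; split=> //; rewrite eq_sym.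
  exists j, x, i; split => //; first by rewrite eq_sym.
  by case: (L x) (L i) (L j) xLi ij => [] [] [].
exists (S i0 i0 + S j0 j0).
have B k i j j' : i != k -> L i = L k -> L j != L k -> L j' != L k ->
    S k k + S j j = S k k + S j' j'.
  move=> ik Lik jk jk'.
  have := W_val_any ik ik Lik erefl jk; rewrite (W_val_any ik ik Lik erefl jk') dlxx.
  lra.
have A' k i j : i != k -> L i = L k -> L j != L k -> S k k + S j j = S i i + S j j.
  move=> ik Lik jk; have ki : k != i by rewrite eq_sym.
  have Lj' : L j != L i by rewrite Lik.
  have := W_val_any ik ik Lik erefl jk.
  rewrite W12 W34 opprK (W_val_any ki ki (esym Lik) erefl Lj') !dlxx; lra.
have main k j : L k = L i0 -> L j != L i0 -> S k k + S j j = S i0 i0 + S j0 j0.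
  move=> Lk Lj'.
  transitivity (S i0 i0 + S j j); last first.
    by apply: (B i0 i1 j j0 _ (esym Li) Lj' Lj); rewrite eq_sym.
  have [->//|ki] := eqVneq k i0.
  by apply: A'; rewrite ?Lk// eq_sym.
move=> k j kj; have [Lk|Lk] := eqVneq (L k) (L i0).
  by apply: main => //; rewrite -Lk eq_sym.
rewrite addrC; apply: main => //.
by case: (L k) (L i0) (L j) kj Lk => [] [] [].
Qed.

(** All W a k a k with a != k now equal - w, so the trace condition reads (#|I| - 1) w = 0. *)
Lemma S_diag_zero k j : L k != L j -> S k k + S j j = 0.
Proof.
have [w hw] := S_diag_const; move=> kj; rewrite hw//.
have h a : a != k -> W a k a k = - w.
  move=> ak; have [j' jk' ->] := W_val ak ak erefl.
  by rewrite dlxx mulr1 hw.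
have := Wtr k k; rewrite (bigD1 k)//= W_rep add0r (eq_bigr (fun=> - w)) => [|a]; last exact: h.
rewrite sumr_const cardC1 => /eqP; rewrite -[_ *+ _]mulr_natr mulf_eq0 oppr_eq0.
case/orP=> [/eqP//|]; rewrite pnatr_eq0 => /eqP c0.
by move: cardI; case: #|I| c0 => [|[|n]].
Qed.

(** On one side each W a k a l with a outside {k, l} equals - S k l, and the trace condition gives
    (#|I| - 2) S k l = 0. *)
Lemma S_off_zero k l : k != l -> S k l = 0.
Proof.
move=> kl; have [Lkl|] := eqVneq (L k) (L l); last exact: S_mix.
have := Wtr k l; rewrite (sum_split2 _ kl) W_rep W_rep' !add0r.
rewrite (eq_bigr (fun=> - S k l)) => [|a /andP[ak al]]; last first.
  by have [j _ ->] := W_val ak al Lkl; rewrite /dl (negPf kl) mulr0 add0r.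
rewrite sumr_const => /eqP; rewrite -[_ *+ _]mulr_natr mulf_eq0 oppr_eq0.
case/orP=> [/eqP//|]; rewrite pnatr_eq0 => /eqP c0; exfalso.
have h0 : #|[predC pred2 k l]| = 0%N by rewrite -c0; apply: eq_card => x; rewrite !inE negb_or.
have h2 := cardC (pred2 k l); rewrite card2 kl h0 addn0 in h2.
by move: cardI; rewrite -h2.
Qed.

Lemma jacobi_basis_zero i a b : W i a i b = 0.
Proof.
have [->|ia] := eqVneq i a; first by rewrite W_rep.
have [->|ib] := eqVneq i b; first by rewrite W_rep'.
have [Lab|Lab] := eqVneq (L a) (L b); last first.
  rewrite WSeq ?negb_and.
    have e1 : dl a i = 0 by rewrite /dl eq_sym (negPf ia).
    have e2 : dl i b = 0 by rewrite /dl (negPf ib).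
    by rewrite (dl_neq Lab) (S_mix Lab) e1 e2; ring.
  by case: (L i) (L a) (L b) Lab => [] [] [].
have [j ja ->] := W_val ia ib Lab.
have [->|ab] := eqVneq a b; last first.
  have e : dl a b = 0 by rewrite /dl (negPf ab).
  by rewrite e (S_off_zero ab) mulr0 addr0 oppr0.
by rewrite dlxx mulr1 S_diag_zero ?oppr0// -Lab.
Qed.

Hypothesis Wbianchi : forall a b c d, W a b c d + W b c a d + W c a b d = 0.

(** With K = 0 every square in the Osserman sum vanishes; at e_i + e_j this makes [W] antisymmetric
    in its first and third arguments. It is then alternating in the first three, and the Bianchi
    identity becomes 3 W = 0. *)
Theorem weyl_split_zero a b c d : W a b c d = 0.
Proof.
have K0 : K = 0.
  have [i _] := Lboth; rewrite -(osserman_basis i).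
  by apply: big1 => x _; apply: big1 => y _; rewrite jacobi_basis_zero expr0n.
have sw i x j y : W i x j y = - W j x i y.
  have [->|ij] := eqVneq i j; first by rewrite !jacobi_basis_zero oppr0.
  have := osserman (fun c => dl c i + 1 * dl c j); rewrite K0 mul0r => /eqP.
  rewrite psumr_eq0 => [/allP/(_ x (mem_index_enum x))/=|z _]; last first.
    by apply: sumr_ge0 => t _; exact: sqr_ge0.
  rewrite psumr_eq0 => [/allP/(_ y (mem_index_enum y))/=|z _]; last exact: sqr_ge0.
  rewrite sqrf_eq0 expand_point// !jacobi_basis_zero => /eqP; lra.
have := Wbianchi a b c d.
have := sw a b c d; have := sw a c b d; have := W12 b c a d; have := W12 c a b d; lra.
Qed.

End WeylSplit.

(** * Traces of squares from eigenspace dimensions, and orthonormal bases *)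

Section SpectralTrace.
Import complex.

Lemma rank_diag_mx (F : fieldType) n (d : 'rV[F]_n) :
  \rank (diag_mx d) = (\sum_i (d 0 i != 0)%R)%N.
Proof.
elim: n d => [|n IH] d.
  by rewrite big_ord0; apply/eqP; rewrite -leqn0 rank_leq_row.
rewrite -[n.+1]/(1 + n)%N in d *; rewrite -(hsubmxK d) diag_mx_row rank_diag_block_mx IH.
rewrite big_split_ord/= big_ord1 row_mxEl; congr (_ + _)%N; last first.
  by apply: eq_bigr => i _; rewrite row_mxEr.
rewrite rank_rV; congr (~~ _ : nat); apply/eqP/eqP => [/matrixP/(_ 0 0)|h].
  by rewrite !mxE eqxx mulr1n.
by apply/matrixP => i j; rewrite !ord1 !mxE eqxx mulr1n; move: h; rewrite mxE.
Qed.

Lemma rank_conj (F : fieldType) n (P A : 'M[F]_n) : P \in unitmx ->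
  \rank (invmx P *m A *m P) = \rank A.
Proof.
move=> uP; rewrite mxrankMfree ?row_free_unit// -mxrank_tr trmx_mul mxrankMfree ?mxrank_tr//.
by rewrite row_free_unit unitmx_tr unitmx_inv.
Qed.

(* Diagonalises S over R[i], where the spectral theorem for Hermitian matrices applies. *)
Lemma symmetric_spectrum (R : realType) n (S : 'M[R]_n) : S^T = S ->
  exists d : 'rV[R]_n, (forall a, \rank (eigenspace S a) = (\sum_i (d 0 i == a)%R)%N) /\
    \tr (S *m S) = \sum_i d 0 i ^+ 2.
Proof.
move=> symS; pose f : {rmorphism R -> R[i]} := real_complex R.
pose Sc := map_mx f S.
have realf x : f x \is Num.real by apply/complex_realP; exists x.
have hermS : Sc \is hermsymmx.
  apply: realsym_hermsym; last by apply/mxOverP => i j; rewrite mxE realf.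
  by apply/is_hermitianmxP; rewrite expr0 scale1r map_mx_id// map_trmx symS.
have /orthomx_spectralP := hermitian_normalmx hermS.
set P := spectralmx _; set D := spectral_diag _ => SE.
have uP : P \in unitmx by exact: spectral_unit.
have realD i : exists x, D 0 i = f x.
  have /mxOverP/(_ 0 i)/complex_realP[x ->] := hermitian_spectral_diag_real hermS.
  by exists x.
have [d Dd] := choice realD.
exists (\row_i d i); split => [a|].
  rewrite -(mxrank_map f) map_eigenspace -/Sc /eigenspace mxrank_ker.
  have -> : Sc - (f a)%:M = invmx P *m diag_mx (D - const_mx (f a)) *m P.
    rewrite linearB/= diag_const_mx mulmxBr mulmxBl -SE mul_mx_scalar -scalemxAl.
    by rewrite mulVmx// scalemx1.
  rewrite rank_conj// rank_diag_mx.
  rewrite (eq_bigr (fun i => (d i != a) : nat)); last first.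
    by move=> i _; rewrite !mxE Dd subr_eq0 (inj_eq (fmorph_inj f)).
  apply/eqP; rewrite -(eqn_add2r (\sum_i (d i != a : nat))) subnK; last first.
    by rewrite -[leqRHS]card_ord -sum1_card; apply: leq_sum => i _; case: (_ != _).
  rewrite -big_split/= -[X in X == _]card_ord -sum1_card; apply/eqP/eq_bigr => i _.
  by rewrite mxE; case: (_ == _).
apply: (fmorph_inj f); rewrite -trace_map_mx map_mxM -/Sc SE.
rewrite !mulmxA -(mulmxA _ P (invmx P)) mulmxV// mulmx1 mxtrace_mulC !mulmxA mulmxV// mul1mx.
rewrite mulmx_diag mxtrace_diag rmorph_sum; apply: eq_bigr => i _.
by rewrite !mxE rmorphXn/= -Dd expr2.
Qed.

(** For symmetric matrices the eigenspace dimensions count all eigenvalues, so the two lists of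
    eigenvalues are permutations of each other. *)
Lemma trace_sq_eq (R : realType) n (S T : 'M[R]_n) : S^T = S -> T^T = T ->
  (forall a, \rank (eigenspace S a) = \rank (eigenspace T a)) ->
  \tr (S *m S) = \tr (T *m T).
Proof.
move=> /symmetric_spectrum[d [rS ->]] /symmetric_spectrum[e [rT ->]] ST.
have pe : perm_eq (codom (d 0)) (codom (e 0)).
  have cnt (c : 'rV[R]_n) a : count_mem a (codom (c 0)) = (\sum_i (c 0 i == a)%R)%N.
    by rewrite codomE count_map -sum1_count big_mkcond big_enum/=; apply: eq_bigr => i _; case: eqP.
  by apply/allP => a _ /=; rewrite !cnt -rS -rT ST.
transitivity (\sum_(x <- codom (d 0)) x ^+ 2); first by rewrite codomE big_map big_enum.
by rewrite (perm_big _ pe) codomE big_map big_enum.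
Qed.

End SpectralTrace.

(** Gram-Schmidt in block form: splitting off the first coordinate leaves the Schur complement [G1],
    again positive definite. *)
Lemma orthonormal_basis_exists (R : realType) n (G : 'M[R]_n) : G^T = G ->
  (forall u, u != 0 -> 0 < inner G u u) -> exists E : 'M[R]_n, E *m G *m E^T = 1%:M.
Proof.
elim: n G => [|n IH] G symG posG; first by exists 0; apply/matrixP => -[].
rewrite -[n.+1]/(1 + n)%N in G symG posG *.
rewrite -(submxK G) in symG posG *.
move: (ulsubmx G) (ursubmx G) (dlsubmx G) (drsubmx G) symG posG => {G} A b c G.
rewrite tr_block_mx => /eq_block_mx[_ bc _ symG] posG.
have cb : b = c^T by rewrite -bc.
rewrite {}cb in posG *.
pose a := A 0 0; have AE : A = a%:M by exact: mx11_scalar.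
have a0 : 0 < a.
  have := posG (row_mx 1%:M 0); rewrite /inner mul_row_block tr_row_mx mul_row_col.
  rewrite !trmx0 !mulmx0 !mul0mx !addr0 trmx1 mulmx1 mul1mx; apply.
  apply/eqP => /matrixP/(_ 0 (lshift n 0)); rewrite row_mxEl !mxE eqxx => /eqP.
  by rewrite oner_eq0.
pose G1 := G - a^-1 *: (c *m c^T).
have symG1 : G1^T = G1 by rewrite /G1 linearB/= linearZ/= trmx_mul trmxK symG.
have posG1 u : u != 0 -> 0 < inner G1 u u.
  (* This [t] makes (t, u) orthogonal to the first basis vector, so that [G] on it reduces to [G1]
     on [u]. *)
  move=> u0; pose t : 'M[R]_1 := - a^-1 *: (u *m c).
  have := posG (row_mx t u) _.
  have -> : inner (block_mx A c^T c G) (row_mx t u) (row_mx t u) = inner G1 u u.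
    rewrite /inner mul_row_block tr_row_mx mul_row_col AE.
    have -> : t *m a%:M + u *m c = 0.
      by rewrite mul_mx_scalar /t scalerA mulrN divff ?gt_eqF// scaleN1r addNr.
    rewrite mul0mx add0r; congr ((_ *m _) 0 0).
    by rewrite /G1 mulmxBr /t -scalemxAl -scalemxAr mulmxA scaleNr addrC.
  apply; apply: contra_neq u0 => /eqP; rewrite row_mx_eq0 => /andP[_ /eqP//].
have [E1 HE1] := IH G1 symG1 posG1.
pose s := (Num.sqrt a)^-1.
have ss : s * s * a = 1.
  by rewrite /s -invfM -expr2 sqr_sqrtr ?ltW// mulVf// gt_eqF.
exists (block_mx s%:M 0 (- a^-1 *: (E1 *m c)) E1).
rewrite mulmx_block tr_block_mx mulmx_block AE.
rewrite !trmx0 !mulmx0 !mul0mx !addr0 tr_scalar_mx.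
have -> : - a^-1 *: (E1 *m c) *m a%:M + E1 *m c = 0.
  by rewrite mul_mx_scalar scalerA mulrN divff ?gt_eqF// scaleN1r addNr.
have e1 : s%:M *m a%:M *m s%:M = 1%:M :> 'M[R]_1.
  by rewrite -!scalar_mxM mulrAC ss.
have e2 : s%:M *m a%:M *m (- a^-1 *: (E1 *m c))^T + s%:M *m c^T *m E1^T = 0.
  rewrite linearZ/= trmx_mul -scalar_mxM mul_scalar_mx scalerA -mulmxA mul_scalar_mx.
  by rewrite mulrN mulfK ?gt_eqF// scaleNr addNr.
have e3 : - a^-1 *: (E1 *m c) *m c^T + E1 *m G = E1 *m G1.
  by rewrite /G1 mulmxBr -scalemxAr -scalemxAl scaleNr mulmxA addrC.
by rewrite !mul0mx add0r e1 e2 e3 HE1 -scalar_mx_block.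
Qed.

(** * Schouten and Weyl tensors *)

Section Bilinear.
Variables (R : realType) (n : nat).
Implicit Types (G E : 'M[R]_n) (u v w z : 'rV[R]_n) (S P : 'rV[R]_n -> 'rV[R]_n -> R).

Definition functional (f : 'rV[R]_n -> R) := forall a u v, f (a *: u + v) = a * f u + f v.

Definition bilinear_form S := (forall u, functional (S u)) /\ (forall v, functional (S^~ v)).

Lemma functional0 f : functional f -> f 0 = 0.
Proof. by move=> lf; have := lf (-1) 0 0; rewrite scaler0 addr0; lra. Qed.

Lemma functionalD f u v : functional f -> f (u + v) = f u + f v.
Proof. by move=> lf; have := lf 1 u v; rewrite scale1r mul1r. Qed.

Lemma functionalZ f a u : functional f -> f (a *: u) = a * f u.
Proof. by move=> lf; have := lf a u 0; rewrite (functional0 lf) !addr0. Qed.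

Lemma functional_sum f I (r : seq I) (p : pred I) (F : I -> 'rV[R]_n) : functional f ->
  f (\sum_(i <- r | p i) F i) = \sum_(i <- r | p i) f (F i).
Proof.
move=> lf; apply: (big_morph f) => [u v|]; [exact: functionalD|exact: functional0].
Qed.

Lemma functional_coord f u : functional f -> f u = \sum_k u 0 k * f 'e_k.
Proof.
move=> lf; rewrite {1}(row_sum_delta u) functional_sum//.
by apply: eq_bigr => k _; rewrite functionalZ.
Qed.

Lemma inner_bilinear G : bilinear_form (inner G).
Proof.
by split=> u a v w; rewrite ?innerDr ?innerZr ?innerDl ?innerZl.
Qed.

Lemma bilinear_inner S : bilinear_form S ->
  S = inner (\matrix_(i, j) S 'e_i 'e_j).
Proof.
move=> [Sr Sl]; apply/funext => u; apply/funext => v.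
have [Ir Il] := inner_bilinear (\matrix_(i, j) S 'e_i 'e_j).
rewrite (functional_coord u (Sl v)) (functional_coord u (Il v)); apply: eq_bigr => i _.
congr (_ * _); rewrite (functional_coord v (Sr _)) (functional_coord v (Ir _)).
apply: eq_bigr => j _; congr (_ * _).
by rewrite /inner -rowE trmx_delta -colE !mxE.
Qed.

Lemma mtrace_basis G E S : E *m G *m E^T = 1%:M -> bilinear_form S ->
  mtrace G S = \sum_i S (row i E) (row i E).
Proof. by move=> EGE bS; rewrite (bilinear_inner bS) (mtraceE _ EGE). Qed.

Lemma basis_orthonormal G E i j : E *m G *m E^T = 1%:M ->
  inner G (row i E) (row j E) = (i == j)%:R.
Proof.
move=> EGE; transitivity ((E *m G *m E^T) i j); last by rewrite EGE mxE.
by rewrite /inner -row_mul [RHS]mxE [LHS]mxE; apply: eq_bigr => k _; rewrite !mxE.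
Qed.

Lemma basis_expand G E u : G^T = G -> E *m G *m E^T = 1%:M ->
  u = \sum_i inner G u (row i E) *: row i E.
Proof.
move=> sG EGE; have GE : E^T *m E *m G = 1%:M.
  by rewrite -mulmxA; apply: mulmx1C; rewrite EGE.
have {}GE : G *m (E^T *m E) = 1%:M.
  by have := congr1 trmx GE; rewrite trmx1 !trmx_mul trmxK sG.
rewrite -{1}(mulmx1 u) -GE !mulmxA mulmx_sum_row; apply: eq_bigr => i _.
by congr (_ *: _); rewrite /inner [LHS]mxE [RHS]mxE; apply: eq_bigr => k _; rewrite !mxE.
Qed.

Lemma basis_contract G E f u : G^T = G -> E *m G *m E^T = 1%:M -> functional f ->
  \sum_i inner G u (row i E) * f (row i E) = f u.
Proof.
move=> sG EGE lf; rewrite [in RHS](basis_expand u sG EGE) functional_sum//.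
by apply: eq_bigr => i _; rewrite functionalZ.
Qed.

(** Linearity is recorded in the last argument; the symmetries carry it to the other three. *)
Record curvature_like (A : 'rV[R]_n -> 'rV[R]_n -> 'rV[R]_n -> 'rV[R]_n -> R) : Prop := {
  curv_lin : forall u v w, functional (A u v w);
  curv12 : forall u v w z, A u v w z = - A v u w z;
  curv34 : forall u v w z, A u v w z = - A u v z w;
  curv_pair : forall u v w z, A u v w z = A w z u v;
  curv_bianchi : forall u v w z, A u v w z + A v w u z + A w u v z = 0 }.

Section CurvatureLike.
Variable A : 'rV[R]_n -> 'rV[R]_n -> 'rV[R]_n -> 'rV[R]_n -> R.
Hypothesis cA : curvature_like A.

Lemma curv_lin3 u v z : functional (fun w => A u v w z).
Proof.
move=> a w w'; rewrite !(curv34 cA u v _ z) (curv_lin cA); ring.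
Qed.

Lemma curv_lin2 u w z : functional (fun v => A u v w z).
Proof. by move=> a v v'; rewrite !(curv_pair cA u _ w z) (curv_lin cA). Qed.

Lemma curv_lin1 v w z : functional (fun u => A u v w z).
Proof. by move=> a u u'; rewrite !(curv_pair cA _ v w z) curv_lin3. Qed.

End CurvatureLike.

Lemma curvature_like_sub A A' : curvature_like A -> curvature_like A' ->
  curvature_like (fun u v w z => A u v w z - A' u v w z).
Proof.
move=> cA cA'; split=> [u v w a z z'|u v w z|u v w z|u v w z|u v w z].
- rewrite (curv_lin cA) (curv_lin cA').
  by move: (A u v w z) (A u v w z') (A' u v w z) (A' u v w z') => *; ring.
- by rewrite (curv12 cA) (curv12 cA'); ring.
- by rewrite (curv34 cA) (curv34 cA'); ring.
- by rewrite (curv_pair cA) (curv_pair cA').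
- by have := curv_bianchi cA u v w z; have := curv_bianchi cA' u v w z; lra.
Qed.

Lemma curvature_like_bullet G P : G^T = G -> bilinear_form P -> (forall u v, P u v = P v u) ->
  curvature_like (bullet P (inner G)).
Proof.
move=> sG [Pr Pl] sP; have [Ir Il] := inner_bilinear G.
have sI u v : inner G u v = inner G v u := innerC u v sG.
split=> [u v w a z z'|u v w z|u v w z|u v w z|u v w z]; rewrite /bullet.
- by rewrite (Pr v) (Pr u) (Ir v) (Ir u); ring.
- ring.
- ring.
- by rewrite (sP u w) (sP v z) (sP u z) (sP v w) (sI u w) (sI v z) (sI u z) (sI v w); ring.
- rewrite (sP v u) (sP w u) (sP w v) (sI v u) (sI w u) (sI w v); ring.
Qed.

Lemma bullet_trace G E P u v : G^T = G -> E *m G *m E^T = 1%:M -> bilinear_form P ->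
  (forall u v, P u v = P v u) ->
  \sum_i bullet P (inner G) u (row i E) v (row i E) =
  (n%:R - 2) * P u v + (\sum_i P (row i E) (row i E)) * inner G u v.
Proof.
move=> sG EGE [Pr Pl] sP; rewrite /bullet.
have -> : \sum_i (P u v * inner G (row i E) (row i E) + P (row i E) (row i E) * inner G u v
    - P u (row i E) * inner G (row i E) v - P (row i E) v * inner G u (row i E)) =
  \sum_i (P u v + P (row i E) (row i E) * inner G u v
    - inner G v (row i E) * P u (row i E) - inner G u (row i E) * P v (row i E)).
  apply: eq_bigr => i _; rewrite (basis_orthonormal i i EGE) eqxx mulr1.
  by rewrite (innerC (row i E) v sG) (sP (row i E) v); ring.
rewrite !sumrB big_split/= !(basis_contract _ sG EGE)// sumr_const card_ord -mulr_suml.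
by rewrite -[P u v *+ n]mulr_natr (sP v u); ring.
Qed.

End Bilinear.

Record riemannian_on (R : realType) n (U : set 'rV[R]_n) (g : 'rV[R]_n -> 'M[R]_n) : Prop :=
  RiemannianOn {
    riemannian_metric :> metric_on U g;
    riemannian_pos : forall x u, U x -> u != 0 -> 0 < inner (g x) u u }.

Lemma riemannian_basis (R : realType) n (U : set 'rV[R]_n) g x : riemannian_on U g -> U x ->
  exists E : 'M[R]_n, E *m g x *m E^T = 1%:M.
Proof.
move=> rg Ux; apply: orthonormal_basis_exists; first exact: (metric_sym rg).
by move=> u; exact: (riemannian_pos rg).
Qed.

Lemma posdef_riemannian_on (R : realType) n (U : set 'rV[R]_n) (g : 'rV[R]_n -> 'M[R]_n) :
  open U -> smooth_on U g -> (forall x, U x -> (g x)^T = g x) ->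
  (forall x u, U x -> u != 0 -> 0 < inner (g x) u u) -> riemannian_on U g.
Proof.
move=> oU sg symg pos; split=> //; split=> // x Ux.
have [E EGE] := orthonormal_basis_exists (symg x Ux) (fun u => @pos x u Ux).
have : E *m (g x *m E^T) = 1%:M by rewrite mulmxA.
by move=> /mulmx1C; rewrite -mulmxA => /mulmx1_unit[].
Qed.

Lemma riemannian_on_sub (R : realType) n (U V : set 'rV[R]_n) (g : 'rV[R]_n -> 'M[R]_n) :
  open V -> V `<=` U -> riemannian_on U g -> riemannian_on V g.
Proof.
move=> oV VU [[oU sg symg ug] pos]; split; first split => //.
- by move=> k; exact: (Ck_sub VU (sg k)).
- by move=> x /VU; exact: symg.
- by move=> x /VU; exact: ug.
- by move=> x u /VU; exact: pos.
Qed.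

Section WeylAlgebra.
Variables (R : realType) (n : nat) (U : set 'rV[R]_n) (g : 'rV[R]_n -> 'M[R]_n).
Hypothesis rg : riemannian_on U g.

Lemma riemann_curvature_like x : U x -> curvature_like (riemann g x).
Proof.
move=> Ux; split=> [u v w a z z'|u v w z|u v w z|u v w z|u v w z].
- by rewrite riemannDr riemannZr.
- exact: (riemann_antisym12 rg).
- exact: (riemann_antisym34 rg).
- exact: (riemann_pair rg).
- exact: (riemann_bianchi rg).
Qed.

Section Point.
Variables (x : 'rV[R]_n) (E : 'M[R]_n).
Hypothesis Ux : U x.
Hypothesis EGE : E *m g x *m E^T = 1%:M.

Let cR := riemann_curvature_like Ux.
Let sG := metric_sym rg Ux.

Lemma ricci_basis u v : ricci g x u v = \sum_i riemann g x u (row i E) v (row i E).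
Proof.
rewrite /ricci; apply: (mtrace_basis EGE); split=> [e|e].
  exact: (curv_lin cR).
exact: (curv_lin2 cR).
Qed.

Lemma ricci_sym u v : ricci g x u v = ricci g x v u.
Proof. by rewrite !ricci_basis; apply: eq_bigr => i _; rewrite (curv_pair cR). Qed.

Lemma ricci_bilinear : bilinear_form (ricci g x).
Proof.
have H u : functional (ricci g x u).
  move=> a v w; rewrite !ricci_basis mulr_sumr -big_split/=; apply: eq_bigr => i _.
  exact: (curv_lin3 cR).
split=> [|u a v w]; first exact: H.
by rewrite (ricci_sym _ u) (ricci_sym v u) (ricci_sym w u); exact: H.
Qed.

Lemma scalar_basis : scalar_curvature g x = \sum_i ricci g x (row i E) (row i E).
Proof. exact: (mtrace_basis EGE ricci_bilinear). Qed.

Lemma schouten_sym u v : schouten g x u v = schouten g x v u.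
Proof. by rewrite /schouten ricci_sym (innerC u v sG). Qed.

Lemma schouten_bilinear : bilinear_form (schouten g x).
Proof.
have H u : functional (schouten g x u).
  move=> a v w; rewrite /schouten (ricci_bilinear.1 u a v w).
  rewrite ((inner_bilinear (g x)).1 u a v w).
  move: (ricci g x u v) (ricci g x u w) (scalar_curvature g x) => r r' s.
  by gen_inner; ring.
split=> [|u a v w]; first exact: H.
by rewrite (schouten_sym _ u) (schouten_sym v u) (schouten_sym w u); exact: H.
Qed.

Lemma weyl_curvature_like : curvature_like (weyl g x).
Proof.
apply: curvature_like_sub => //; apply: curvature_like_bullet => //.
  exact: schouten_bilinear.
exact: schouten_sym.
Qed.

Hypothesis n_gt2 : (2 < n)%N.

Lemma dim_neq0 : (n%:R - 2 != 0 :> R) /\ (n%:R - 1 != 0 :> R).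
Proof.
have h : 2 < n%:R :> R by rewrite ltr_nat.
by split; apply: lt0r_neq0; lra.
Qed.

Lemma schouten_trace : \sum_i schouten g x (row i E) (row i E) =
  scalar_curvature g x / (2 * (n%:R - 1)).
Proof.
rewrite /schouten -mulr_sumr sumrB -scalar_basis -mulr_sumr.
under eq_bigr do rewrite (basis_orthonormal _ _ EGE) eqxx.
rewrite sumr_const card_ord; have [h2 h1] := dim_neq0.
by move: (scalar_curvature g x) => s; rewrite -[true%:R]/(1 : R); field; rewrite h2 h1.
Qed.

(** The constants n - 2 and 2 (n - 1) in [schouten] are those for which the contraction
    [bullet_trace] gives back the Ricci tensor. *)
Lemma weyl_trace u v : \sum_i weyl g x u (row i E) v (row i E) = 0.
Proof.
rewrite /weyl sumrB -ricci_basis bullet_trace//; last 2 first.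
- exact: schouten_bilinear.
- exact: schouten_sym.
rewrite schouten_trace /schouten; have [h2 h1] := dim_neq0.
move: (ricci g x u v) (scalar_curvature g x) (inner _ _ _) => r s i.
by field; rewrite h2 h1.
Qed.

(** One contraction of P . g gives (n - 2) P + tr(P) g, a second one 2 (n - 1) tr(P), which
    determines P when n > 2. *)
Lemma schouten_unique P : bilinear_form P -> (forall u v, P u v = P v u) ->
  (forall u v w z, riemann g x u v w z = bullet P (inner (g x)) u v w z) ->
  forall u v, schouten g x u v = P u v.
Proof.
move=> bP sP RP u v; have [h2 h1] := dim_neq0.
have ric a b : ricci g x a b = (n%:R - 2) * P a b + (\sum_i P (row i E) (row i E)) * inner (g x) a b.
  by rewrite ricci_basis -bullet_trace//; apply: eq_bigr => i _; rewrite RP.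
have scal : scalar_curvature g x = 2 * (n%:R - 1) * \sum_i P (row i E) (row i E).
  rewrite scalar_basis; under eq_bigr do rewrite ric (basis_orthonormal _ _ EGE) eqxx mulr1.
  by rewrite big_split/= -mulr_sumr sumr_const card_ord -[_ *+ n]mulr_natr; ring.
rewrite /schouten ric scal; field.
by rewrite h2 h1.
Qed.

End Point.

Lemma weyl_eq0_of_bullet x P : (2 < n)%N -> U x -> bilinear_form P -> (forall u v, P u v = P v u) ->
  (forall u v w z, riemann g x u v w z = bullet P (inner (g x)) u v w z) ->
  forall u v w z, weyl g x u v w z = 0.
Proof.
move=> n2 Ux bP sP RP u v w z.
have [E EGE] := riemannian_basis rg Ux.
by rewrite /weyl RP /bullet !(schouten_unique Ux EGE n2 bP sP RP) subrr.
Qed.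

End WeylAlgebra.

(** * The second Bianchi identity and the Cotton tensor *)

Section CodazziAlgebra.
Variables (R : realType) (n : nat) (G E : 'M[R]_n).
Hypothesis sG : G^T = G.
Hypothesis EGE : E *m G *m E^T = 1%:M.
Hypothesis n_gt3 : (3 < n)%N.
Variable C : 'rV[R]_n -> 'rV[R]_n -> 'rV[R]_n -> R.
Hypothesis C12 : forall a b w, C a b w = - C b a w.
Hypothesis lin1C : forall b w, functional (fun a => C a b w).
Hypothesis lin3C : forall a b, functional (C a b).
Hypothesis cyclC : forall a b c w z,
  inner G c z * C a b w + inner G a z * C b c w + inner G b z * C c a w
  - inner G c w * C a b z - inner G a w * C b c z - inner G b w * C c a z = 0.

Let t a := \sum_i C a (row i E) (row i E).

(* The contraction of cyclC over c = z; contracting once more gives (2n - 4) t = 0. *)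
Lemma codazzi_contract a b w :
  (n%:R - 3) * C a b w - inner G a w * t b + inner G b w * t a = 0.
Proof.
have lin2C c d : functional (fun b => C c b d).
  by move=> k u v; rewrite !(C12 c) (lin1C c d k u v); ring.
have : \sum_i (inner G (row i E) (row i E) * C a b w + inner G a (row i E) * C b (row i E) w
   + inner G b (row i E) * C (row i E) a w
  - inner G (row i E) w * C a b (row i E) - inner G a w * C b (row i E) (row i E)
  - inner G b w * C (row i E) a (row i E)) = 0 by apply: big1 => i _; exact: cyclC.
rewrite !sumrB !big_split/= -!mulr_sumr -/(t b).
rewrite (basis_contract a sG EGE (lin2C b w)) (basis_contract b sG EGE (lin1C a w)).
have -> : \sum_i inner G (row i E) w * C a b (row i E) = C a b w.
  rewrite -(basis_contract w sG EGE (lin3C a b)); apply: eq_bigr => i _.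
  by rewrite (innerC _ w sG).
have -> : \sum_i C (row i E) a (row i E) = - t a.
  by rewrite -sumrN; apply: eq_bigr => i _; rewrite C12.
have -> : \sum_i inner G (row i E) (row i E) * C a b w = n%:R * C a b w.
  under eq_bigr do rewrite (basis_orthonormal _ _ EGE) eqxx mul1r.
  by rewrite sumr_const card_ord mulr_natl.
rewrite (C12 b a w) => <-; ring.
Qed.

(** Once the trace [t] vanishes, the contracted identity is (n - 3) C = 0: here dimension at least 4
    is decisive. *)
Lemma codazzi_zero a b w : C a b w = 0.
Proof.
have n4 : 3 < n%:R :> R by rewrite ltr_nat.
have t0 c : t c = 0.
  have : \sum_i ((n%:R - 3) * C c (row i E) (row i E) - inner G c (row i E) * t (row i E)
    + inner G (row i E) (row i E) * t c) = 0.
    by apply: big1 => i _; exact: codazzi_contract.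
  rewrite !big_split/= -mulr_sumr -/(t c) sumrN.
  rewrite (basis_contract c sG EGE (f := t)); last first.
    move=> k u v; rewrite /t mulr_sumr -big_split/=; apply: eq_bigr => i _; exact: lin1C.
  have -> : \sum_i inner G (row i E) (row i E) * t c = n%:R * t c.
    under eq_bigr do rewrite (basis_orthonormal _ _ EGE) eqxx mul1r.
    by rewrite sumr_const card_ord mulr_natl.
  move=> e; apply: (mulfI (x := 2 * n%:R - 4)); first by apply: lt0r_neq0; lra.
  by rewrite mulr0 -[RHS]e; ring.
have := codazzi_contract a b w; rewrite !t0 !mulr0 subr0 addr0 => /eqP.
by rewrite mulf_eq0 => /orP[/eqP|/eqP//]; lra.
Qed.

End CodazziAlgebra.

Section Bianchi.
Variables (R : realType) (n : nat) (U : set 'rV[R]_n) (g : 'rV[R]_n -> 'M[R]_n).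
Hypothesis mg : metric_on U g.

Let oU := metric_open mg.
Let smooth_g := metric_smooth mg.
Let sym_g := metric_sym mg.

Lemma christoffel_field x (u v : 'rV[R]_n) (X : 'rV[R]_n -> 'rV[R]_n) : U x ->
  derivable X x v ->
  is_derive x v (fun y => christoffel g y u (X y))
    ('D_v (fun y : 'rV[R]_n => christoffel g y u (X x)) x + christoffel g x u ('D_v X x)).
Proof.
move=> Ux dX.
have := christoffel_is_derive_along mg (t := id) (open_nbhs_nbhs (conj oU Ux)) Ux
  (fun a b => christoffel_is_derive mg a b v Ux) (is_derive_cst u x v) (derivableP dX).
by rewrite (christoffel0l mg _ Ux) addr0.
Qed.

Lemma nabla_derivable x (u v : 'rV[R]_n) (X : 'rV[R]_n -> 'rV[R]_n) : U x -> smooth_on U X ->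
  derivable (nabla g (cst u) X) x v.
Proof.
move=> Ux sX.
have dX : derivable X x v by exact: (smooth_mx_derivable oU sX Ux).
have dDX : derivable ('D_u X) x v.
  by apply: (smooth_mx_derivable oU _ Ux); exact: smooth_mx_derive.
by have [] := is_deriveD (derivableP dDX) (christoffel_field u Ux dX).
Qed.

Lemma nabla_sub x (u : 'rV[R]_n) (X Y : 'rV[R]_n -> 'rV[R]_n) : U x ->
  derivable X x u -> derivable Y x u ->
  nabla g (cst u) (fun y => X y - Y y) x = nabla g (cst u) X x - nabla g (cst u) Y x.
Proof.
move=> Ux dX dY; have [_ E] := is_deriveB (derivableP dX) (derivableP dY).
rewrite !nabla_cstE (etrans E erefl) (christoffelBr mg _ _ _ Ux).
by rewrite opprD addrACA.
Qed.

Lemma nabla_nabla x (u v : 'rV[R]_n) (X : 'rV[R]_n -> 'rV[R]_n) : U x -> smooth_on U X ->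
  nabla g (cst v) (nabla g (cst u) X) x =
  'D_v ('D_u X) x + ('D_v (fun y : 'rV[R]_n => christoffel g y u (X x)) x
  + christoffel g x u ('D_v X x)) + (christoffel g x v ('D_u X x)
  + christoffel g x v (christoffel g x u (X x))).
Proof.
move=> Ux sX.
have dX : derivable X x v by exact: (smooth_mx_derivable oU sX Ux).
have dDX : derivable ('D_u X) x v.
  by apply: (smooth_mx_derivable oU _ Ux); exact: smooth_mx_derive.
have E : 'D_v (nabla g (cst u) X) x = 'D_v ('D_u X) x +
    ('D_v (fun y : 'rV[R]_n => christoffel g y u (X x)) x + christoffel g x u ('D_v X x)).
  by have [_] := is_deriveD (derivableP dDX) (christoffel_field u Ux dX).
rewrite (nabla_cstE g x v) E nabla_cstE.
exact: (congr2 (fun p q => p + q) erefl (christoffelDr mg v ('D_u X x)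
  (christoffel g x u (X x)) Ux)).
Qed.

(** [curvature] is defined through constant fields; the Bianchi identity also applies it to the
    field [christoffel g y a w]. The derivatives of [X] cancel by antisymmetry. *)
Lemma curvature_tensorial x (u v : 'rV[R]_n) (X : 'rV[R]_n -> 'rV[R]_n) : U x -> smooth_on U X ->
  nabla g (cst v) (nabla g (cst u) X) x - nabla g (cst u) (nabla g (cst v) X) x =
  curvature g x u v (X x).
Proof.
move=> Ux sX; rewrite (nabla_nabla u v Ux sX) (nabla_nabla v u Ux sX).
rewrite (curvatureE mg _ _ _ Ux) !nabla_cstE.
rewrite (mx_derive_comm oU v u sX Ux).
gen_derive; intros.
repeat match goal with |- context [christoffel ?a ?b ?c ?d] =>
  generalize (christoffel a b c d); intro end.
by apply/rowP => k; rewrite !mxE; ring.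
Qed.

(* The Jacobi identity for the operators nabla_a, nabla_b, nabla_c. *)
Lemma second_bianchi x (a b c w : 'rV[R]_n) : U x ->
  (nabla g (cst a) (fun y => curvature g y b c w) x - curvature g x b c (christoffel g x a w))
  + (nabla g (cst b) (fun y => curvature g y c a w) x - curvature g x c a (christoffel g x b w))
  + (nabla g (cst c) (fun y => curvature g y a b w) x - curvature g x a b (christoffel g x c w))
  = 0.
Proof.
move=> Ux.
have sG d : smooth_on U (fun y => christoffel g y d w) := smooth_christoffel mg d w.
have dN (d e f : 'rV[R]_n) : derivable (nabla g (cst e) (fun y => christoffel g y d w)) x f.
  exact: nabla_derivable.
have K (d e f : 'rV[R]_n) : nabla g (cst f) (fun y => curvature g y d e w) x =
    nabla g (cst f) (nabla g (cst e) (fun y => christoffel g y d w)) x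
    - nabla g (cst f) (nabla g (cst d) (fun y => christoffel g y e w)) x.
  rewrite -(nabla_sub Ux (dN _ _ _) (dN _ _ _)); apply: (nabla_ext mg f Ux) => y Uy.
  exact: (curvatureE mg).
have T (d e f : 'rV[R]_n) : curvature g x d e (christoffel g x f w) =
    nabla g (cst e) (nabla g (cst d) (fun y => christoffel g y f w)) x
    - nabla g (cst d) (nabla g (cst e) (fun y => christoffel g y f w)) x.
  by rewrite (curvature_tensorial d e Ux (sG f)).
rewrite !K !T.
repeat match goal with |- context [nabla g ?b ?c x] =>
  generalize (nabla g b c x); intro end.
by apply/rowP => k; rewrite !mxE; ring.
Qed.

(** The corrections in the first two arguments cancel in the cyclic sum, the connection being
    torsion free. The derivatives are parameters so that [cotton_cyclic] can supply expanded
    ones. *)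
Lemma riemann_second_bianchi x (a b c w z : 'rV[R]_n) (da db dc : R) : U x ->
  'D_a (fun y : 'rV[R]_n => riemann g y b c w z) x = da ->
  'D_b (fun y : 'rV[R]_n => riemann g y c a w z) x = db ->
  'D_c (fun y : 'rV[R]_n => riemann g y a b w z) x = dc ->
  da - riemann g x b c w (christoffel g x a z) - riemann g x b c (christoffel g x a w) z
  + (db - riemann g x c a w (christoffel g x b z) - riemann g x c a (christoffel g x b w) z)
  + (dc - riemann g x a b w (christoffel g x c z) - riemann g x a b (christoffel g x c w) z)
  = 0.
Proof.
move=> Ux.
have DI (d e f : 'rV[R]_n) : 'D_d (fun y : 'rV[R]_n => riemann g y e f w z) x =
    inner (g x) (nabla g (cst d) (fun y : 'rV[R]_n => curvature g y e f w) x) z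
    + inner (g x) (curvature g x e f w) (christoffel g x d z).
  have dK : derivable (fun y : 'rV[R]_n => curvature g y e f w) x d.
    by apply: (smooth_mx_derivable oU _ Ux); exact: (smooth_curvature mg).
  apply: (etrans (derive_inner_nabla mg Ux dK (derivable_cst z x d))).
  by rewrite nabla_cst_cst.
move=> Da Db Dc; move: (etrans (esym Da) (DI a b c)) (etrans (esym Db) (DI b c a))
  (etrans (esym Dc) (DI c a b)) (congr1 (fun k => inner (g x) k z) (second_bianchi a b c w Ux)).
rewrite /riemann.
repeat match goal with |- context [nabla ?a ?b ?c ?d] => generalize (nabla a b c d); intro end.
repeat match goal with |- context [curvature g x ?b ?c ?d] =>
  generalize (curvature g x b c d); intro end.
by rewrite inner0l !innerDl !innerNl; gen_inner => -> -> -> {Da Db Dc DI}; lra.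
Qed.

Section Codazzi.
Variable P : 'rV[R]_n -> 'M[R]_n.
Hypothesis smooth_P : smooth_on U P.
Hypothesis sym_P : forall x, U x -> (P x)^T = P x.
Hypothesis RP : forall x u v w z, U x ->
  riemann g x u v w z = bullet (inner (P x)) (inner (g x)) u v w z.

Definition cov_derive (x a b w : 'rV[R]_n) : R := inner ('D_a P x) b w
  - inner (P x) (christoffel g x a b) w - inner (P x) b (christoffel g x a w).

Definition cotton (x a b w : 'rV[R]_n) : R := cov_derive x a b w - cov_derive x b a w.

(** The second Bianchi identity for R = P . g: since g is parallel, only the covariant derivatives
    of [P] survive, and they pair up into Cotton tensors. *)
Lemma cotton_cyclic x (a b c w z : 'rV[R]_n) : U x ->
  inner (g x) c z * cotton x a b w + inner (g x) a z * cotton x b c w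
  + inner (g x) b z * cotton x c a w - inner (g x) c w * cotton x a b z
  - inner (g x) a w * cotton x b c z - inner (g x) b w * cotton x c a z = 0.
Proof.
move=> Ux.
have dP (d : 'rV[R]_n) : is_derive x d P ('D_d P x) := smooth_mx_is_derive oU smooth_P d Ux.
have dg (d : 'rV[R]_n) : is_derive x d g ('D_d g x) := smooth_mx_is_derive oU smooth_g d Ux.
have iP (d e f : 'rV[R]_n) : is_derive x d (fun y => inner (P y) e f) (inner ('D_d P x) e f).
  apply: (is_derive_eq (is_derive_inner (dP d) (is_derive_cst e x d) (is_derive_cst f x d))).
  by rewrite inner0l inner0r !addr0.
have ig (d e f : 'rV[R]_n) : is_derive x d (fun y => inner (g y) e f)
    (inner (g x) (christoffel g x d e) f + inner (g x) e (christoffel g x d f)).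
  apply: (is_derive_eq (is_derive_inner (dg d) (is_derive_cst e x d) (is_derive_cst f x d))).
  by rewrite (metric_compat mg _ _ _ Ux) inner0l inner0r !addr0.
have D (d e f : 'rV[R]_n) : 'D_d (fun y : 'rV[R]_n => riemann g y e f w z) x =
    inner ('D_d P x) e w * inner (g x) f z
    + inner (P x) e w * (inner (g x) (christoffel g x d f) z + inner (g x) f (christoffel g x d z))
    + (inner ('D_d P x) f z * inner (g x) e w
    + inner (P x) f z * (inner (g x) (christoffel g x d e) w + inner (g x) e (christoffel g x d w)))
    - (inner ('D_d P x) e z * inner (g x) f w
    + inner (P x) e z * (inner (g x) (christoffel g x d f) w + inner (g x) f (christoffel g x d w)))
    - (inner ('D_d P x) f w * inner (g x) e z
    + inner (P x) f w * (inner (g x) (christoffel g x d e) z + inner (g x) e (christoffel g x d z))).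
  transitivity ('D_d (fun y => inner (P y) e w * inner (g y) f z + inner (P y) f z * inner (g y) e w
     - inner (P y) e z * inner (g y) f w - inner (P y) f w * inner (g y) e z) x).
    apply: (derive_ext oU Ux) => y Uy.
    exact: RP.
  have [_ F] := is_deriveB (is_deriveB (is_deriveD (is_deriveM (iP d e w) (ig d f z))
    (is_deriveM (iP d f z) (ig d e w))) (is_deriveM (iP d e z) (ig d f w)))
    (is_deriveM (iP d f w) (ig d e z)).
  apply: (etrans F) => {F}; gen_derive.
  have sc (p q : R) : p *: q = p * q by [].
  by rewrite !sc; gen_inner; ring.
have := riemann_second_bianchi Ux (D a b c) (D b c a) (D c a b) => {D}.
rewrite (RP b c w (christoffel g x a z) Ux) (RP b c (christoffel g x a w) z Ux).
rewrite (RP c a w (christoffel g x b z) Ux) (RP c a (christoffel g x b w) z Ux).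
rewrite (RP a b w (christoffel g x c z) Ux) (RP a b (christoffel g x c w) z Ux).

rewrite (christoffel_sym mg b a Ux).
rewrite (christoffel_sym mg c a Ux).
rewrite (christoffel_sym mg c b Ux).
rewrite /cotton /cov_derive /bullet.
rewrite (christoffel_sym mg b a Ux).
rewrite (christoffel_sym mg c a Ux).
rewrite (christoffel_sym mg c b Ux).
gen_derive.
move: (g x) (P x) (sym_g Ux) (sym_P Ux) => G Q sG sQ e.
rewrite -[RHS]e; gen_inner; ring.
Qed.

End Codazzi.

End Bianchi.

(** * The tractor connection *)

Definition sharpP (R : realType) (n : nat) (g P : 'rV[R]_n -> 'M[R]_n) (x v : 'rV[R]_n) :
  'rV[R]_n := v *m P x *m invmx (g x).

Lemma inner_sharpP (R : realType) (n : nat) (g P : 'rV[R]_n -> 'M[R]_n) (x v z : 'rV[R]_n) :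
  g x \in unitmx -> inner (g x) (sharpP g P x v) z = inner (P x) v z.
Proof. by move=> ug; rewrite /inner /sharpP -(mulmxA (v *m P x)) mulVmx// mulmx1. Qed.

Section Tractor.
Variables (R : realType) (n : nat) (U : set 'rV[R]_n) (g P : 'rV[R]_n -> 'M[R]_n).
Hypothesis rg : riemannian_on U g.
Hypothesis smooth_P : smooth_on U P.
Hypothesis sym_P : forall x, U x -> (P x)^T = P x.
Hypothesis RP : forall x u v w z, U x ->
  riemann g x u v w z = bullet (inner (P x)) (inner (g x)) u v w z.
Hypothesis n_gt3 : (3 < n)%N.

Let mg := riemannian_metric rg.
Let oU := metric_open mg.
Let smooth_g := metric_smooth mg.
Let sym_g := metric_sym mg.
Let unit_g := metric_unit mg.

Lemma cov_derive_lin1 x b w : U x -> functional (fun a => cov_derive g P x a b w).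
Proof.
move=> Ux a u v; rewrite /cov_derive.
rewrite (derive_linear a u v (smooth_mx_differentiable oU smooth_P Ux)).
rewrite !(christoffelDl mg) ?(christoffelZl mg)//.
gen_derive; rewrite innerDg innerZg innerDl innerZl innerDr innerZr.
by gen_inner; ring.
Qed.

Lemma cov_derive_lin2 x a w : U x -> functional (fun b => cov_derive g P x a b w).
Proof.
move=> Ux k u v; rewrite /cov_derive.
rewrite (christoffelDr mg)// (christoffelZr mg)//.
by gen_derive; rewrite !innerDl !innerZl; gen_inner; ring.
Qed.

Lemma cov_derive_lin3 x a b : U x -> functional (cov_derive g P x a b).
Proof.
move=> Ux k u v; rewrite /cov_derive.
rewrite (christoffelDr mg)// (christoffelZr mg)//.
by gen_derive; rewrite !innerDr !innerZr; gen_inner; ring.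
Qed.

Lemma cotton_zero x a b w : U x -> cov_derive g P x a b w = cov_derive g P x b a w.
Proof.
move=> Ux; apply/eqP; rewrite -subr_eq0; apply/eqP.
have [E EGE] := riemannian_basis rg Ux.
apply: (codazzi_zero (sym_g Ux) EGE n_gt3 (C := cotton g P x)).
- by move=> c d e; exact: esym (opprB _ _).
- move=> c d k u v; rewrite /cotton (cov_derive_lin1 c d Ux k u v) (cov_derive_lin2 c d Ux k u v).
  by move: (cov_derive g P x) => F; ring.
- move=> c d k u v; rewrite /cotton (cov_derive_lin3 c d Ux k u v) (cov_derive_lin3 d c Ux k u v).
  by move: (cov_derive g P x) => F; ring.
- by move=> c d e u v; exact: (cotton_cyclic mg smooth_P sym_P RP).
Qed.

Local Notation q := (1 + (n + 1))%N.
(** A triple is stored as one row of length n + 2, since [frobenius] solves for row vectors. *)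
Definition tpack (s : R) (m : 'rV[R]_n) (r : R) : 'rV[R]_q := row_mx s%:M (row_mx m r%:M).
Definition tscale (y : 'rV[R]_q) : R := lsubmx y 0 0.
Definition tvec (y : 'rV[R]_q) : 'rV[R]_n := lsubmx (rsubmx y).
Definition trho (y : 'rV[R]_q) : R := rsubmx (rsubmx y) 0 0.

Lemma tpackE s m r : (tscale (tpack s m r) = s) * (tvec (tpack s m r) = m) * (trho (tpack s m r) = r).
Proof. by rewrite /tscale /tvec /trho /tpack !(row_mxKl, row_mxKr) !mxE eqxx !mulr1n. Qed.

Lemma tpack_comb a s s' m m' r r' :
  a *: tpack s m r + tpack s' m' r' = tpack (a * s + s') (a *: m + m') (a * r + r').
Proof. by rewrite /tpack !scale_row_mx !add_row_mx !scale_scalar_mx -!raddfD. Qed.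

(* Sections (s, m, r) parallel for this connection describe the flat metrics s^-2 g when
   g(m, m) = 2 s r; m is then the gradient of s. The value 0 outside U makes the system
   bilinear everywhere. *)
Definition tractor (x v : 'rV[R]_n) (y : 'rV[R]_q) : 'rV[R]_q :=
  if `[< U x >] then tpack (inner (g x) v (tvec y))
    (- christoffel g x v (tvec y) - tscale y *: sharpP g P x v + trho y *: v)
    (- inner (P x) v (tvec y))
  else 0.

Lemma tractorE x v y : U x -> tractor x v y = tpack (inner (g x) v (tvec y))
    (- christoffel g x v (tvec y) - tscale y *: sharpP g P x v + trho y *: v)
    (- inner (P x) v (tvec y)).
Proof. by move=> Ux; rewrite /tractor asboolT. Qed.

Lemma tractor_linl (x : 'rV[R]_n) y : linear (fun v => tractor x v y).
Proof.
move=> a u v; rewrite /tractor; case: asboolP => Ux; last by rewrite scaler0 addr0.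
rewrite tpack_comb; congr tpack.
- by rewrite innerDl innerZl.
- rewrite (christoffelDl mg)// (christoffelZl mg)//.
  rewrite /sharpP !mulmxDl -!scalemxAl.
  move: (christoffel _ _ _ _) (christoffel _ _ _ _) (u *m _ *m _) (v *m _ *m _) => c d e f.
  by apply/rowP => k; rewrite !mxE; ring.
- by rewrite innerDl innerZl; gen_inner; ring.
Qed.

Lemma tractor_linr (x v : 'rV[R]_n) : linear (tractor x v).
Proof.
move=> a y z; rewrite /tractor; case: asboolP => Ux; last by rewrite scaler0 addr0.
have vE : tvec (a *: y + z) = a *: tvec y + tvec z by rewrite /tvec !linearP.
have sE : tscale (a *: y + z) = a * tscale y + tscale z by rewrite /tscale linearP !mxE.
have rE : trho (a *: y + z) = a * trho y + trho z by rewrite /trho !linearP !mxE.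
rewrite tpack_comb vE sE rE; congr tpack.
- by rewrite innerDr innerZr.
- rewrite (christoffelDr mg)// (christoffelZr mg)//.
  move: (christoffel _ _ _ _) (christoffel _ _ _ _) (sharpP _ _) => c d e.
  by apply/rowP => k; rewrite !mxE; ring.
- by rewrite innerDr innerZr; gen_inner; ring.
Qed.

Lemma smooth_tpack (s : 'rV[R]_n -> R) (m : 'rV[R]_n -> 'rV[R]_n) (r : 'rV[R]_n -> R) :
  smooth_on U s -> smooth_on U m -> smooth_on U r ->
  smooth_on U (fun x => tpack (s x) (m x) (r x)).
Proof.
move=> ss sm sr; apply/(smooth_entry oU) => i j; rewrite /tpack.
case: (split_ordP j) => {}j ->.
  apply: (smooth_ext oU (f := s)) => // x _.
  by rewrite row_mxEl !ord1 mxE eqxx mulr1n.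
case: (split_ordP j) => {}j ->.
  apply: (smooth_ext oU (f := fun x => m x i j)) => [x _|]; first by rewrite row_mxEr row_mxEl.
  exact: (smooth_entry oU _).1.
apply: (smooth_ext oU (f := r)) => // x _.
by rewrite row_mxEr row_mxEr !ord1 mxE eqxx mulr1n.
Qed.

Lemma smooth_sharpP v : smooth_on U (fun x => sharpP g P x v).
Proof.
apply: (smooth_mulmx oU); last exact: smooth_invmx.
by apply: (smooth_mulmx oU) => //; exact: smooth_cst.
Qed.

Lemma smooth_tractor v y : smooth_on U (fun x => tractor x v y).
Proof.
apply: (smooth_ext oU (f := fun x => tpack (inner (g x) v (tvec y))
    (- christoffel g x v (tvec y) - tscale y *: sharpP g P x v + trho y *: v)
    (- inner (P x) v (tvec y)))); first by move=> x Ux; rewrite tractorE.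
apply: smooth_tpack.
- by apply: (smooth_inner oU) => //; exact: smooth_cst.
- apply: (smoothD oU); last exact: smooth_cst.
  apply: (smooth_mxB oU).
    by apply: (smooth_mxN oU); exact: smooth_christoffel.
  by apply: (smooth_scalemx oU); [exact: smooth_cst|exact: smooth_sharpP].
- by apply: (smoothN oU); apply: (smooth_inner oU) => //; exact: smooth_cst.
Qed.

Lemma is_derive_tpack x v (s : 'rV[R]_n -> R) (m : 'rV[R]_n -> 'rV[R]_n) (r : 'rV[R]_n -> R) ds dm dr :
  is_derive x v s ds -> is_derive x v m dm -> is_derive x v r dr ->
  is_derive x v (fun x => tpack (s x) (m x) (r x)) (tpack ds dm dr).
Proof.
move=> Hs /is_derive_mxP Hm Hr; apply/is_derive_mxP => i j; rewrite /tpack.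
case: (split_ordP j) => {}j ->.
  under eq_fun do rewrite row_mxEl !ord1 mxE eqxx mulr1n.
  by rewrite row_mxEl !ord1 mxE eqxx mulr1n.
case: (split_ordP j) => {}j ->.
  by under eq_fun do rewrite row_mxEr row_mxEl; rewrite row_mxEr row_mxEl; exact: Hm.
under eq_fun do rewrite row_mxEr row_mxEr !ord1 mxE eqxx mulr1n.
by rewrite row_mxEr row_mxEr !ord1 mxE eqxx mulr1n.
Qed.

(** Obtained by differentiating g(P# v, z) = P(v, z), which avoids the derivative of the inverse
    matrix inside [sharpP]. *)
Lemma derive_sharpP x u v z : U x ->
  inner (g x) ('D_u (fun y : 'rV[R]_n => sharpP g P y v) x) z =
  inner ('D_u P x) v z - inner (g x) (christoffel g x u (sharpP g P x v)) z
  - inner (P x) v (christoffel g x u z).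
Proof.
move=> Ux.
have dsP := smooth_mx_is_derive oU (smooth_sharpP v) u Ux.
have [_ E1] := is_derive_inner (smooth_mx_is_derive oU smooth_g u Ux) dsP (is_derive_cst z x u).
have [_ E2] := is_derive_inner (smooth_mx_is_derive oU smooth_P u Ux) (is_derive_cst v x u) (is_derive_cst z x u).
have E : 'D_u (fun y : 'rV[R]_n => inner (g y) (sharpP g P y v) z) x =
    'D_u (fun y : 'rV[R]_n => inner (P y) v z) x.
  apply: (derive_ext oU Ux) => y Uy.
  by apply: inner_sharpP; exact: unit_g.
move: (etrans (etrans (esym E1) E) E2) => {E E1 E2}.
rewrite (metric_compat mg _ _ _ Ux) inner0l !inner0r !addr0.
rewrite (inner_sharpP P _ _ (unit_g Ux)) /cst.
by gen_derive; gen_inner => <-; ring.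
Qed.

(** Component by component: the first needs only metric compatibility and the symmetry of [P]; the
    second is R = P . g applied to m plus s times the Codazzi equation; the third is the Codazzi
    equation at m plus the symmetry of the square of [P]. *)
Lemma tractor_flat x u v y : U x ->
  'D_u (fun x => tractor x v y) x + tractor x v (tractor x u y) =
  'D_v (fun x => tractor x u y) x + tractor x u (tractor x v y).
Proof.
move=> Ux; pose m := tvec y; pose s := tscale y; pose r := trho y.
pose M (a : 'rV[R]_n) : 'rV[R]_n := - christoffel g x a m - s *: sharpP g P x a + r *: a.
have D (a b : 'rV[R]_n) : 'D_b (fun x => tractor x a y) x = tpack (inner ('D_b g x) a m)
    (- 'D_b (fun y : 'rV[R]_n => christoffel g y a m) x
     - s *: 'D_b (fun y : 'rV[R]_n => sharpP g P y a) x)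
    (- inner ('D_b P x) a m).
  transitivity ('D_b (fun x : 'rV[R]_n => tpack (inner (g x) a (tvec y))
    (- christoffel g x a (tvec y) - tscale y *: sharpP g P x a + trho y *: a)
    (- inner (P x) a (tvec y))) x).
    apply: (derive_ext oU Ux) => z Uz.
    exact: tractorE.
  have c1 := is_derive_cst a x b; have c2 := is_derive_cst m x b.
  have d1 := is_derive_inner (smooth_mx_is_derive oU smooth_g b Ux) c1 c2.
  have d2 := is_derive_inner (smooth_mx_is_derive oU smooth_P b Ux) c1 c2.
  have d3 := christoffel_is_derive mg a m b Ux.
  have d4 : is_derive x b (fun y : 'rV[R]_n => sharpP g P y a) ('D_b (fun y : 'rV[R]_n => sharpP g P y a) x).
    by apply: derivableP; exact: (smooth_mx_derivable oU (smooth_sharpP a) Ux).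
  have [_ E] := is_derive_tpack d1
    (is_deriveD (is_deriveB (is_deriveN d3) (is_deriveZ s d4)) (is_derive_cst (r *: a) x b))
    (is_deriveN d2).
  apply: (etrans E) => {E}; congr tpack.
  - by rewrite inner0l inner0r !addr0.
  - by rewrite addr0.
  - by rewrite inner0l inner0r !addr0.
have sC a b : inner (g x) a b = inner (g x) b a := innerC a b (sym_g Ux).
have pC a b : inner (P x) a b = inner (P x) b a := innerC a b (sym_P Ux).
have gC a b := christoffel_sym mg a b Ux.
have cz := cotton_zero u v _ Ux.
have S (a b : 'rV[R]_n) : 'D_b (fun x => tractor x a y) x + tractor x a (tractor x b y) =
   tpack (inner ('D_b g x) a m + inner (g x) a (M b))
    (- 'D_b (fun y : 'rV[R]_n => christoffel g y a m) x
     - s *: 'D_b (fun y : 'rV[R]_n => sharpP g P y a) x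
     + (- christoffel g x a (M b) - inner (g x) b m *: sharpP g P x a - inner (P x) b m *: a))
    (- inner ('D_b P x) a m - inner (P x) a (M b)).
  rewrite D (tractorE b y Ux) tractorE// !tpackE -/m -/s -/r -/(M b).
  by rewrite -[X in X + _]scale1r tpack_comb !mul1r scale1r scaleNr.
apply: (etrans (S v u)); apply: (etrans _ (esym (S u v))) => {S D}; congr tpack.
- rewrite !(metric_compat mg _ _ _ Ux) /M !innerDr !innerNr !innerZr.
  rewrite (sC v (sharpP g P x u)) (sC u (sharpP g P x v)) !(inner_sharpP P _ _ (unit_g Ux)) (gC u v).
  by rewrite (pC u v) (sC u v); gen_inner; ring.
- apply: (inner_nondeg (unit_g Ux)) => z.
  have CG a b : christoffel g x a (M b) = - christoffel g x a (christoffel g x b m)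
     - s *: christoffel g x a (sharpP g P x b) + r *: christoffel g x a b.
    rewrite /M (christoffelDr mg _ _ _ Ux) (christoffelBr mg _ _ _ Ux).
    by rewrite -scaleN1r !(christoffelZr mg _ _ _ Ux) scaleN1r.
  have := RP u v m z Ux; rewrite (riemannE mg _ _ _ _ Ux).
  have := cz z; rewrite /cov_derive (gC v u).
  have := derive_sharpP u v z Ux; have := derive_sharpP v u z Ux.
  rewrite !nabla_cstE !CG (gC v u) /bullet.
  move: (christoffel g x u (christoffel g x v m)) (christoffel g x v (christoffel g x u m)) => a1 a2.
  move: (christoffel g x u (sharpP g P x v)) (christoffel g x v (sharpP g P x u)) => a3 a4.
  move: (christoffel g x u v) (christoffel g x u z) (christoffel g x v z) => a5 a6 a7.
  have := inner_sharpP P u z (unit_g Ux); have := inner_sharpP P v z (unit_g Ux).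
  move: (sharpP g P x u) (sharpP g P x v) => a8 a9.
  gen_derive.
  rewrite !(innerDl, innerNl, innerZl); move: (s) (r) => s' r'.
  gen_inner => -> -> -> -> e3 e4.
  (* The Codazzi equation is needed multiplied by s, a product that linear arithmetic does not form
     by itself. *)
  have e5 : s' * _ = s' * _ := congr1 ( *%R s') e3.
  lra.
- have := cz m; rewrite /cov_derive (gC v u) /M !innerDr !innerNr !innerZr.
  have -> : inner (P x) v (sharpP g P x u) = inner (P x) u (sharpP g P x v).
    by rewrite -!(inner_sharpP P _ _ (unit_g Ux)) sC.
  rewrite (pC u v).
  by gen_derive; gen_inner => ?; lra.
Qed.

End Tractor.

(** * From parallel sections to conformally flat metrics *)

Section TractorSolution.
Variables (R : realType) (n : nat) (U : set 'rV[R]_n) (g P : 'rV[R]_n -> 'M[R]_n).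
Hypothesis mg : metric_on U g.

Let oU := metric_open mg.
Let sym_g := metric_sym mg.
Let unit_g := metric_unit mg.
Hypothesis RP : forall x u v w z, U x ->
  riemann g x u v w z = bullet (inner (P x)) (inner (g x)) u v w z.
Variables (s r : 'rV[R]_n -> R) (m : 'rV[R]_n -> 'rV[R]_n).
Hypothesis s_gt0 : forall x, U x -> 0 < s x.
Hypothesis smooth_s : smooth_on U s.
Hypothesis smooth_m : smooth_on U m.
Hypothesis Ds : forall x (v : 'rV[R]_n), U x -> 'D_v s x = inner (g x) v (m x).
Hypothesis Dm : forall x (v : 'rV[R]_n), U x -> 'D_v m x =
  - christoffel g x v (m x) - s x *: sharpP g P x v + r x *: v.
Hypothesis null : forall x, U x -> inner (g x) (m x) (m x) = 2 * s x * r x.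

Let h x := (s x)^-1 * (s x)^-1.
Let T x := (- (s x)^-1) *: m x.

(** - m / s is half the gradient of ln s^-2. Inserting the equation for m, the terms in r cancel by
    the null condition and [conformal_schouten] becomes exactly [P], so the conformal change formula
    leaves no curvature. *)
Lemma tractor_conformal_flat x u v w : U x -> curvature (fun y => h y *: g y) x u v w = 0.
Proof.
have s_neq0 y : U y -> s y != 0 by move=> Uy; apply: lt0r_neq0; exact: s_gt0.
have sV : smooth_on U (fun y => (s y)^-1) by exact: smoothV.
have sh : smooth_on U h by exact: smoothM.
have h0 y : U y -> h y != 0 by move=> Uy; rewrite mulf_neq0// invr_eq0 s_neq0.
have sT : smooth_on U T by apply: (smooth_scalemx oU) => //; exact: smoothN.
have ds y (a : 'rV[R]_n) : U y -> is_derive y a (fun y => (s y)^-1)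
    (- (s y) ^- 2 * inner (g y) a (m y)).
  move=> Uy; have d1 : derivable s y a by exact: (smooth_derivable oU smooth_s Uy).
  split; first by apply: derivableV => //; exact: s_neq0.
  by rewrite deriveV ?s_neq0// Ds.
have gC y a b : U y -> inner (g y) a b = inner (g y) b a by move=> Uy; apply: innerC; exact: sym_g.
have hT y (a : 'rV[R]_n) : U y -> 'D_a h y = 2 * h y * inner (g y) (T y) a.
  move=> Uy; have [_ E] := is_deriveM (ds y a Uy) (ds y a Uy).
  apply: (etrans E); rewrite /h /T innerZl (gC y (m y) a Uy) -[_ *: _]/(_ * _).
  by gen_inner; field; exact: s_neq0.
move=> Ux.
have cf := conformal_riemann mg sh h0 sT hT.
have ug := metric_unit (conformal_metric mg sh h0).
apply: (inner_nondeg (ug x Ux)) => z; rewrite inner0l.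
apply: (etrans (cf x u v w z Ux)); rewrite RP//.
have PC a b : conformal_schouten g T x a b = inner (P x) a b.
  rewrite /conformal_schouten nabla_cstE.
  have dm : derivable m x a by exact: (smooth_mx_derivable oU smooth_m Ux).
  have E : 'D_a T x = (- (- s x ^- 2 * inner (g x) a (m x))) *: m x + (- (s x)^-1) *: 'D_a m x.
    by have [_] := is_derive_scalemx (is_deriveN (ds x a Ux)) (derivableP dm).
  rewrite E Dm// /T.
  rewrite (christoffelZr mg)//.
  rewrite !(innerDl, innerNl, innerZl, innerZr, innerDr, innerNr).
  rewrite (inner_sharpP P _ _ (unit_g Ux)) null// (gC x (m x) a Ux).
  by gen_inner; field; exact: s_neq0.
by rewrite /bullet !PC subrr mulr0.
Qed.

End TractorSolution.

Section LocalFlatness.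
Variables (R : realType) (n : nat) (U : set 'rV[R]_n) (g : 'rV[R]_n -> 'M[R]_n).
Hypothesis rg : riemannian_on U g.

Let mg := riemannian_metric rg.
Let oU := metric_open mg.
Let smooth_g := metric_smooth mg.
Let sym_g := metric_sym mg.
Let unit_g := metric_unit mg.

Lemma smooth_riemann u v w z : smooth_on U (fun x => riemann g x u v w z).
Proof.
apply: (smooth_inner oU) => //; last exact: smooth_cst.
exact: (smooth_curvature mg).
Qed.

Lemma smooth_mtrace (S : 'rV[R]_n -> 'rV[R]_n -> 'rV[R]_n -> R) :
  (forall i j, smooth_on U (fun x => S x 'e_i 'e_j)) ->
  smooth_on U (fun x => mtrace (g x) (S x)).
Proof.
move=> sS; apply: (smooth_sum oU) => i; apply: (smooth_sum oU) => j.
by apply: (smoothM oU) => //; apply: ((smooth_entry oU _).1); exact: smooth_invmx.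
Qed.

Lemma smooth_ricci u v : smooth_on U (fun x => ricci g x u v).
Proof. by apply: smooth_mtrace => i j; exact: smooth_riemann. Qed.

Lemma smooth_schouten u v : smooth_on U (fun x => schouten g x u v).
Proof.
apply: (smoothM oU); first exact: smooth_cst.
apply: (smoothB oU); first exact: smooth_ricci.
apply: (smoothM oU).
  apply: (smoothM oU); last exact: smooth_cst.
  by apply: smooth_mtrace => i j; exact: smooth_ricci.
by apply: (smooth_inner oU) => //; exact: smooth_cst.
Qed.

Let P x : 'M[R]_n := \matrix_(i, j) schouten g x 'e_i 'e_j.

Lemma schouten_matrix x : U x -> schouten g x = inner (P x).
Proof.
move=> Ux; have [E EGE] := riemannian_basis rg Ux.
exact: (bilinear_inner (schouten_bilinear rg Ux EGE)).
Qed.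

Lemma schouten_matrix_sym x : U x -> (P x)^T = P x.
Proof.
move=> Ux; have [E EGE] := riemannian_basis rg Ux.
apply/matrixP => i j; rewrite !mxE; exact: (schouten_sym rg Ux EGE).
Qed.

Lemma smooth_schouten_matrix : smooth_on U P.
Proof.
apply/(smooth_entry oU) => i j.
apply: (smooth_ext oU (f := fun x => schouten g x 'e_i 'e_j)); last exact: smooth_schouten.
by move=> x _; rewrite /P mxE.
Qed.

Hypothesis n_gt3 : (3 < n)%N.
Hypothesis weyl0 : forall x u v w z, U x -> weyl g x u v w z = 0.

Theorem weyl_flat_conformal x0 : U x0 -> exists e : R, exists h : 'rV[R]_n -> R,
  [/\ 0 < e, (forall x, `|x - x0| < e -> U x), smooth_on [set x | `|x - x0| < e] h,
   (forall x, `|x - x0| < e -> 0 < h x) &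
   forall x u v w, `|x - x0| < e -> curvature (fun y => h y *: g y) x u v w = 0].
Proof.
move=> Ux0.
have RP x u v w z : U x -> riemann g x u v w z = bullet (inner (P x)) (inner (g x)) u v w z.
  move=> Ux; have /eqP := weyl0 u v w z Ux.
  by rewrite /weyl subr_eq0 => /eqP ->; rewrite schouten_matrix.
have [d [d0 [dU [Y [sY Yx0 DY]]]]] := frobenius oU Ux0
  (tractor_linl P rg) (tractor_linr P rg)
  (smooth_tractor rg smooth_schouten_matrix)
  (tractor_flat rg smooth_schouten_matrix schouten_matrix_sym RP n_gt3)
   (tpack 1 0 0).
pose D := [set x | `|x - x0| < d].
have oD : open D by exact: open_normball.
have dY x (v : 'rV[R]_n) : D x -> is_derive x v Y (tractor U g P x v (Y x)).
  move=> Dx; rewrite -DY//; apply: derivableP; exact: (smooth_mx_derivable oD sY Dx).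
pose s x := tscale (Y x); pose m x := tvec (Y x); pose r x := trho (Y x).
have sE : s = fun x => Y x 0 (lshift _ 0) by apply/funext => x; rewrite /s /tscale mxE.
have rE : r = fun x => Y x 0 (rshift 1 (rshift n 0)).
  by apply/funext => x; rewrite /r /trho !mxE.
have mE i j x : m x i j = Y x i (rshift 1 (lshift 1 j)) by rewrite /m /tvec !mxE.
have ss : smooth_on D s by rewrite sE; exact: ((smooth_entry oD _).1 sY).
have sr : smooth_on D r by rewrite rE; exact: ((smooth_entry oD _).1 sY).
have sm : smooth_on D m.
  apply/(smooth_entry oD) => i j; apply: (smooth_ext oD (f := fun x => Y x i (rshift 1 (lshift 1 j)))).
    by move=> x _; rewrite mE.
  exact: ((smooth_entry oD _).1 sY).
have ds x (v : 'rV[R]_n) : D x -> is_derive x v s (inner (g x) v (m x)).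
  move=> Dx; have := dY x v Dx; rewrite (tractorE _ _ _ _ (dU x Dx)) => /is_derive_mxP/(_ 0 (lshift _ 0)).
  by rewrite -sE /tpack row_mxEl mxE eqxx mulr1n.
have dr x (v : 'rV[R]_n) : D x -> is_derive x v r (- inner (P x) v (m x)).
  move=> Dx; have := dY x v Dx; rewrite (tractorE _ _ _ _ (dU x Dx)) => /is_derive_mxP/(_ 0 (rshift 1 (rshift n 0))).
  by rewrite -rE /tpack !row_mxEr mxE eqxx mulr1n.
have dm x (v : 'rV[R]_n) : D x -> is_derive x v m
    (- christoffel g x v (m x) - s x *: sharpP g P x v + r x *: v).
  move=> Dx; apply/is_derive_mxP => i j.
  have := dY x v Dx; rewrite (tractorE _ _ _ _ (dU x Dx)) => /is_derive_mxP/(_ i (rshift 1 (lshift 1 j))).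
  rewrite /tpack row_mxEr row_mxEl ord1.
  by congr is_derive; apply/funext => y; rewrite mE.
(* The quadratic form preserved by the tractor connection: constant along the solution and zero at
   the initial value (1, 0, 0). *)
pose Q x := inner (g x) (m x) (m x) - 2 * (s x * r x).
have dQ x (v : 'rV[R]_n) : D x -> is_derive x v Q 0.
  move=> Dx; have Ux := dU x Dx.
  have d1 := is_derive_inner (smooth_mx_is_derive oU smooth_g v Ux) (dm x v Dx) (dm x v Dx).
  have d2 := is_deriveZ 2 (is_deriveM (ds x v Dx) (dr x v Dx)).
  apply: (is_derive_eq (is_deriveB d1 d2)).
  rewrite (metric_compat mg _ _ _ Ux).
  have sc (p q : R) : p *: q = p * q by [].
  have gC a b : inner (g x) a b = inner (g x) b a by apply: innerC; exact: sym_g.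
  rewrite !(innerDl, innerNl, innerZl, innerZr, innerDr, innerNr) !sc.
  rewrite (gC (m x) (sharpP _ _ _ _)) (inner_sharpP P _ _ (unit_g Ux)) (gC (m x) v).
  by gen_inner; ring.
have null x : D x -> inner (g x) (m x) (m x) = 2 * s x * r x.
  move=> Dx.
  have seg (t : R) : 0 <= t <= 1 -> D (x0 + t *: (x - x0)).
    move=> /andP[t0 t1]; rewrite /D/= addrC addKr normrZ ger0_norm//.
    by apply: le_lt_trans Dx; rewrite ler_piMl.
  have [t t01] : exists2 t : R, 0 <= t <= 1 & Q (x0 + (x - x0)) - Q x0 = 'D_(x - x0) Q (x0 + t *: (x - x0)).
    by apply: mvt_segment_line => t t01; have [] := dQ _ (x - x0) (seg t t01).
  have [_ ->] := dQ _ (x - x0) (seg t t01).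
  have -> : Q x0 = 0 by rewrite /Q /m /s /r Yx0 !tpackE inner0l mulr0 mulr0 subrr.
  by rewrite [x0 + _]addrC subrK subr0 /Q => /eqP; rewrite subr_eq0 => /eqP ->; rewrite mulrA.
have Dx0 : D x0 by rewrite /D/= subrr normr0.
have spos : \forall x \near x0, 0 < s x.
  have cs := smooth_continuous ss Dx0.
  have sx0 : s x0 = 1 by rewrite /s Yx0 tpackE.
  apply: (cs [set t | 0 < t]); apply: open_nbhs_nbhs; split; last by rewrite /= sx0.
  exact: open_gt.
have [e /= e0 He] : exists2 e : R, 0 < e & forall x, `|x - x0| < e -> D x /\ 0 < s x.
  have : nbhs x0 (D `&` [set x | 0 < s x]) by apply: filterI => //; exact: open_nbhs_nbhs.
  move=> /nbhs_ballP[e /= e0 He]; exists e => // x xe; apply: He.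
  by rewrite -ball_normE /ball_/= distrC.
pose V := [set x | `|x - x0| < e].
have oV : open V by exact: open_normball.
have VD : V `<=` D by move=> x /He[].
have subV (W : normedModType R) (f : 'rV[R]_n -> W) : smooth_on D f -> smooth_on V f.
  by move=> sf k; exact: (Ck_sub VD (sf k)).
have s0 x : V x -> 0 < s x by move=> /He[].
have s_neq0 x : V x -> s x != 0 by move=> /s0; exact: lt0r_neq0.
exists e; exists (fun x => (s x)^-1 * (s x)^-1); split => //.
- by move=> x /VD; exact: dU.
- by apply: (smoothM oV); apply: (smoothV oV) => //; exact: subV.
- by move=> x Vx; rewrite mulr_gt0// invr_gt0 s0.
- have UV x : V x -> U x by move=> /VD; exact: dU.
  move=> x u v w.
  apply: (@tractor_conformal_flat R n V g P (riemannian_on_sub oV UV rg) _ s r m) => //.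
  + by move=> y a b c z /UV; exact: RP.
  + exact: subV.
  + exact: subV.
  + by move=> y a /VD Dy; have [] := ds y a Dy.
  + by move=> y a /VD Dy; have [] := dm y a Dy.
  + by move=> y /VD; exact: null.
Qed.

End LocalFlatness.

(** * Warped products and changes of charts *)

Section ProductMetric.
Variables (R : realType) (m n : nat) (U1 : set 'rV[R]_m) (U2 : set 'rV[R]_n).
Variables (g1 : 'rV[R]_m -> 'M[R]_m) (g2 : 'rV[R]_n -> 'M[R]_n).
Hypothesis mg1 : metric_on U1 g1.
Hypothesis mg2 : metric_on U2 g2.

Let U : set 'rV[R]_(m + n) := [set x | U1 (lsubmx x) /\ U2 (rsubmx x)].

Definition product_metric (x : 'rV[R]_(m + n)) : 'M[R]_(m + n) :=
  block_mx (g1 (lsubmx x)) 0 0 (g2 (rsubmx x)).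

Lemma product_metric_on : metric_on U product_metric.
Proof.
have [oU1 sg1 sym1 u1] := mg1; have [oU2 sg2 sym2 u2] := mg2.
have oU : open U.
  by apply: openI; apply: open_comp => // x _;
    [exact: continuous_lsubmx|exact: continuous_rsubmx].
split=> // [|x [x1 x2]|x [x1 x2]].
- apply/(smooth_entry oU) => i j.
  have s1 a b : smooth_on U (fun x => g1 (lsubmx x) a b).
    move=> k; apply: (Ck_sub (U := [set x | U1 (lsubmx x)])); first by move=> x [].
    by apply: (@Ck_lsubmx _ _ _ k _ _ (fun y => g1 y a b)); apply: ((smooth_entry oU1 _).1 sg1).
  have s2 a b : smooth_on U (fun x => g2 (rsubmx x) a b).
    move=> k; apply: (Ck_sub (U := [set x | U2 (rsubmx x)])); first by move=> x [].
    by apply: (@Ck_rsubmx _ _ _ k _ _ (fun y => g2 y a b)); apply: ((smooth_entry oU2 _).1 sg2).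
  rewrite /product_metric.
  case: (split_ordP i) => {}i ->; case: (split_ordP j) => {}j ->.
  + by under eq_fun do rewrite block_mxEul; exact: s1.
  + by under eq_fun do rewrite block_mxEur mxE; exact: smooth_cst.
  + by under eq_fun do rewrite block_mxEdl mxE; exact: smooth_cst.
  + by under eq_fun do rewrite block_mxEdr; exact: s2.
- by rewrite /product_metric tr_block_mx !trmx0 sym1// sym2.
- by rewrite unitmxE det_ublock unitrM -!unitmxE u1// u2.
Qed.

Let mp := product_metric_on.

Lemma is_derive_lsubmx (W : normedModType R) (f : 'rV[R]_m -> W) (x v : 'rV[R]_(m + n)) :
  derivable f (lsubmx x) (lsubmx v) ->
  is_derive x v (fun y => f (lsubmx y)) ('D_(lsubmx v) f (lsubmx x)).
Proof.
move=> df; pose L : {linear 'rV[R]_(m + n) -> 'rV[R]_m} := lsubmx.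
split; first exact: (@derivable_lin _ _ _ _ L f).
exact: (@derive_lin _ _ _ _ L f).
Qed.

Lemma is_derive_rsubmx (W : normedModType R) (f : 'rV[R]_n -> W) (x v : 'rV[R]_(m + n)) :
  derivable f (rsubmx x) (rsubmx v) ->
  is_derive x v (fun y => f (rsubmx y)) ('D_(rsubmx v) f (rsubmx x)).
Proof.
move=> df; pose L : {linear 'rV[R]_(m + n) -> 'rV[R]_n} := rsubmx.
split; first exact: (@derivable_lin _ _ _ _ L f).
exact: (@derive_lin _ _ _ _ L f).
Qed.

Lemma product_derive_inner x (u v w : 'rV[R]_(m + n)) : U x ->
  'D_w (fun y => inner (product_metric y) u v) x =
  'D_(lsubmx w) (fun y => inner (g1 y) (lsubmx u) (lsubmx v)) (lsubmx x)
  + 'D_(rsubmx w) (fun y => inner (g2 y) (rsubmx u) (rsubmx v)) (rsubmx x).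
Proof.
move=> [x1 x2].
have d1 : derivable (fun y => inner (g1 y) (lsubmx u) (lsubmx v)) (lsubmx x) (lsubmx w).
  apply: (smooth_derivable (metric_open mg1) _ x1).
  by apply: (smooth_inner (metric_open mg1) (metric_smooth mg1)); exact: smooth_cst.
have d2 : derivable (fun y => inner (g2 y) (rsubmx u) (rsubmx v)) (rsubmx x) (rsubmx w).
  apply: (smooth_derivable (metric_open mg2) _ x2).
  by apply: (smooth_inner (metric_open mg2) (metric_smooth mg2)); exact: smooth_cst.
have [_ <-] := is_deriveD (is_derive_lsubmx d1) (is_derive_rsubmx d2).
by congr ('D_w _ x); apply/funext => y; rewrite /product_metric inner_block.
Qed.

Lemma product_christoffel x (u v : 'rV[R]_(m + n)) : U x ->
  christoffel product_metric x u v =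
  row_mx (christoffel g1 (lsubmx x) (lsubmx u) (lsubmx v))
         (christoffel g2 (rsubmx x) (rsubmx u) (rsubmx v)).
Proof.
move=> Ux; apply: (inner_nondeg (metric_unit mp Ux)) => w; have [x1 x2] := Ux.
rewrite (christoffelE mp)//.
rewrite {2}/product_metric inner_block row_mxKl row_mxKr.
rewrite (christoffelE mg1)// (christoffelE mg2)//.
rewrite /koszul !product_derive_inner//; gen_derive; ring.
Qed.

Lemma is_derive_row_mx (V : normedModType R) (f : V -> 'rV[R]_m) (h : V -> 'rV[R]_n)
    (df : 'rV[R]_m) (dh : 'rV[R]_n) (x v : V) :
  is_derive x v f df -> is_derive x v h dh ->
  is_derive x v (fun y => row_mx (f y) (h y)) (row_mx df dh).
Proof.
move=> /is_derive_mxP Hf /is_derive_mxP Hh; apply/is_derive_mxP => i j.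
case: (split_ordP j) => {}j ->.
  by rewrite row_mxEl; under eq_fun do rewrite row_mxEl; exact: Hf.
by rewrite row_mxEr; under eq_fun do rewrite row_mxEr; exact: Hh.
Qed.

Lemma product_nabla x (u v w : 'rV[R]_(m + n)) : U x ->
  nabla product_metric (cst v) (fun y => christoffel product_metric y u w) x =
  row_mx (nabla g1 (cst (lsubmx v)) (fun y => christoffel g1 y (lsubmx u) (lsubmx w)) (lsubmx x))
         (nabla g2 (cst (rsubmx v)) (fun y => christoffel g2 y (rsubmx u) (rsubmx w)) (rsubmx x)).
Proof.
move=> Ux; have [x1 x2] := Ux; rewrite !nabla_cstE.
have d1 : derivable (fun y => christoffel g1 y (lsubmx u) (lsubmx w)) (lsubmx x) (lsubmx v).
  exact: (christoffel_derivable mg1 x1).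
have d2 : derivable (fun y => christoffel g2 y (rsubmx u) (rsubmx w)) (rsubmx x) (rsubmx v).
  exact: (christoffel_derivable mg2 x2).
have [_ E] := is_derive_row_mx (is_derive_lsubmx d1) (is_derive_rsubmx d2).
have E' : 'D_v (fun y => christoffel product_metric y u w) x =
    'D_v (fun y => row_mx (christoffel g1 (lsubmx y) (lsubmx u) (lsubmx w))
       (christoffel g2 (rsubmx y) (rsubmx u) (rsubmx w))) x.
  apply: (derive_ext (metric_open mp) Ux) => y.
  exact: product_christoffel.
have G : christoffel product_metric x v (christoffel product_metric x u w) =
    row_mx (christoffel g1 (lsubmx x) (lsubmx v) (christoffel g1 (lsubmx x) (lsubmx u) (lsubmx w)))
      (christoffel g2 (rsubmx x) (rsubmx v) (christoffel g2 (rsubmx x) (rsubmx u) (rsubmx w))).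
  rewrite (product_christoffel u w Ux) (product_christoffel v _ Ux).
  by rewrite row_mxKl row_mxKr.
exact: (etrans (congr2 (fun a b => a + b) (etrans E' E) G) (add_row_mx _ _ _ _)).
Qed.

Lemma product_riemann x (u v w z : 'rV[R]_(m + n)) : U x ->
  riemann product_metric x u v w z =
  riemann g1 (lsubmx x) (lsubmx u) (lsubmx v) (lsubmx w) (lsubmx z)
  + riemann g2 (rsubmx x) (rsubmx u) (rsubmx v) (rsubmx w) (rsubmx z).
Proof.
move=> Ux; have [x1 x2] := Ux.
have Z (a1 b1 : 'rV[R]_m) (a2 b2 : 'rV[R]_n) :
    inner (product_metric x) (row_mx a1 a2) z - inner (product_metric x) (row_mx b1 b2) z =
    (inner (g1 (lsubmx x)) a1 (lsubmx z) - inner (g1 (lsubmx x)) b1 (lsubmx z))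
    + (inner (g2 (rsubmx x)) a2 (rsubmx z) - inner (g2 (rsubmx x)) b2 (rsubmx z)).
  by rewrite /product_metric !inner_block !row_mxKl !row_mxKr; gen_inner; ring.
apply: (etrans (riemannE mp u v w z Ux)).
apply: (etrans (congr2 (fun a b => inner (product_metric x) a z - inner (product_metric x) b z)
  (product_nabla u v w Ux) (product_nabla v u w Ux))).
apply: (etrans (Z _ _ _ _)).
rewrite (riemannE mg1 _ _ _ _ x1).
by rewrite (riemannE mg2 _ _ _ _ x2).
Qed.

End ProductMetric.

Section CoordinateChange.
Variables (R : realType) (n : nat) (U V : set 'rV[R]_n) (g k : 'rV[R]_n -> 'M[R]_n).
Hypothesis mg : metric_on U g.
Hypothesis mk : metric_on V k.
Variable t : 'rV[R]_n -> 'rV[R]_n.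
Hypothesis UV : forall x, U x -> V (t x).
Hypothesis smooth_t : smooth_on U t.
Hypothesis pullback : forall x (a b : 'I_n), U x ->
  g x a b = inner (k (t x)) ('D_('e_a) t x) ('D_('e_b) t x).

(** An opaque name for the differential of [t], which shields it from [gen_derive] while second
    derivatives are abstracted. *)
Variable J : 'rV[R]_n -> 'rV[R]_n -> 'rV[R]_n.
Hypothesis JE : forall x u, J x u = 'D_u t x.

Let oU := metric_open mg.
Let oV := metric_open mk.
Let unit_g := metric_unit mg.
Let smooth_k := metric_smooth mk.
Let unit_k := metric_unit mk.
Let sym_k := metric_sym mk.
Let Jm (x : 'rV[R]_n) : 'M[R]_n := \matrix_i J x 'e_i.

Lemma jacobian_mx x u : U x -> J x u = u *m Jm x.
Proof.
move=> Ux; rewrite mulmx_sum_row {1}(row_sum_delta u).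
have dt := smooth_mx_differentiable oU smooth_t Ux.
have J0 : J x 0 = 0 by rewrite JE derive0.
have JD (a b : 'rV[R]_n) : J x (a + b) = J x a + J x b by rewrite !JE; exact: derive_add.
have JZ c (a : 'rV[R]_n) : J x (c *: a) = c *: J x a by rewrite !JE; exact: derive_scale.
elim/big_ind2 : _ => [//|p p' q q' <- <-|i _]; first exact: JD.
by rewrite rowK JZ.
Qed.

Lemma pullback_inner x u v : U x -> inner (g x) u v = inner (k (t x)) (J x u) (J x v).
Proof.
move=> Ux; rewrite !jacobian_mx//.
have -> : g x = Jm x *m k (t x) *m (Jm x)^T.
  apply/matrixP => a b; rewrite pullback//.
  rewrite -!JE !jacobian_mx// /inner trmx_mul trmx_delta.
  by rewrite !mulmxA -colE -!mulmxA -rowE !mxE.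
by rewrite /inner trmx_mul !mulmxA.
Qed.

(** The Jacobian matrix is invertible because it is a left factor of the invertible matrix g = Jm k
    Jm^T. *)
Lemma jacobian_nondeg x (y z : 'rV[R]_n) : U x ->
  (forall w, inner (k (t x)) y (J x w) = inner (k (t x)) z (J x w)) -> y = z.
Proof.
move=> Ux yz; apply: (inner_nondeg (unit_k (UV Ux))) => w.
have uJ : Jm x \in unitmx.
  have : g x *m invmx (g x) = 1%:M by rewrite mulmxV ?unit_g.
  have -> : g x = Jm x *m (k (t x) *m (Jm x)^T).
    apply/matrixP => a b; rewrite pullback//.
    rewrite -!JE !jacobian_mx// /inner trmx_mul trmx_delta.
    by rewrite !mulmxA -colE -!mulmxA -rowE !mxE.
  by rewrite -mulmxA => /mulmx1_unit[].
by have := yz (w *m invmx (Jm x)); rewrite (jacobian_mx _ Ux) mulmxKV.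
Qed.

Lemma jacobian_inj x y z : U x -> J x y = J x z -> y = z.
Proof.
move=> Ux yz; apply: (inner_nondeg (unit_g Ux)) => w.
by rewrite (pullback_inner y w Ux) (pullback_inner z w Ux) yz.
Qed.

Lemma jacobian_is_derive x (u v : 'rV[R]_n) : U x ->
  is_derive x v (fun y : 'rV[R]_n => J y u) ('D_v ('D_u t) x).
Proof.
move=> Ux; have -> : (fun y : 'rV[R]_n => J y u) = 'D_u t by apply/funext => y; rewrite JE.
by apply: (smooth_mx_is_derive oU _ _ Ux); exact: smooth_mx_derive.
Qed.

Lemma compose_is_derive p q (f : 'rV[R]_n -> 'M[R]_(p, q)) x (v : 'rV[R]_n) :
  U x -> smooth_on V f -> is_derive x v (fun y : 'rV[R]_n => f (t y)) ('D_(J x v) f (t x)).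
Proof.
move=> Ux sf.
have dt := smooth_mx_differentiable oU smooth_t Ux.
have df := smooth_mx_differentiable oV sf (UV Ux).
split; last by rewrite JE; exact: derive_comp.
apply: diff_derivable; exact: (differentiable_comp dt df).
Qed.

Lemma pullback_koszul x (u v w : 'rV[R]_n) : U x -> koszul g x u v w =
  koszul k (t x) (J x u) (J x v) (J x w) + inner (k (t x)) ('D_u ('D_v t) x) (J x w).
Proof.
move=> Ux.
have D (a b c : 'rV[R]_n) : 'D_c (fun y : 'rV[R]_n => inner (g y) a b) x =
    inner ('D_(J x c) k (t x)) (J x a) (J x b)
    + inner (k (t x)) ('D_c ('D_a t) x) (J x b) + inner (k (t x)) (J x a) ('D_c ('D_b t) x).
  transitivity ('D_c (fun y : 'rV[R]_n => inner (k (t y)) (J y a) (J y b)) x).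
    apply: (derive_ext oU Ux) => y Uy.
    exact: pullback_inner.
  by have [_] := is_derive_inner (compose_is_derive c Ux smooth_k)
    (jacobian_is_derive a c Ux) (jacobian_is_derive b c Ux).
have K := koszulE mk (J x u) (J x v) (J x w) (UV Ux).
apply: (etrans _ (esym (congr1 (fun p => p + _) K))) => {K}.
apply: (etrans (congr1 (fun p => 2^-1 * p) (congr2 (fun p q => p - q)
  (congr2 (fun p q => p + q) (D v w u) (D u w v)) (D u v w)))) => {D}.
have kC a b : inner (k (t x)) a b = inner (k (t x)) b a.
  by apply: innerC; apply: sym_k; exact: UV.
have := kC (J x v) ('D_u ('D_w t) x).
have := mx_derive_comm oU u v smooth_t Ux.
have := mx_derive_comm oU u w smooth_t Ux.
have := mx_derive_comm oU v w smooth_t Ux.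
by gen_derive => -> -> ->; gen_inner => ->; field.
Qed.

(** The Hessian of [t] is the inhomogeneous term of the transformation law: the symbols are not
    tensorial. *)
Lemma pullback_christoffel x (u v : 'rV[R]_n) : U x -> J x (christoffel g x u v) =
  christoffel k (t x) (J x u) (J x v) + 'D_u ('D_v t) x.
Proof.
move=> Ux; apply: (jacobian_nondeg Ux) => w; rewrite -(pullback_inner _ w Ux).
rewrite innerDl (christoffelE mg _ _ _ Ux).
by rewrite (christoffelE mk _ _ _ (UV Ux)) (pullback_koszul u v w Ux).
Qed.

Lemma christoffel_along x (v : 'rV[R]_n) (X Y : 'rV[R]_n -> 'rV[R]_n) (dX dY : 'rV[R]_n) :
  U x -> is_derive x v X dX -> is_derive x v Y dY ->
  is_derive x v (fun y : 'rV[R]_n => christoffel k (t y) (X y) (Y y))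
  ('D_(J x v) (fun z : 'rV[R]_n => christoffel k z (X x) (Y x)) (t x)
  + christoffel k (t x) dX (Y x) + christoffel k (t x) (X x) dY).
Proof.
move=> Ux; apply: (christoffel_is_derive_along mk _ (UV Ux)).
  by apply: filterS (open_nbhs_nbhs (conj oU Ux)) => y; exact: UV.
by move=> a b; exact: (compose_is_derive v Ux (smooth_christoffel mk a b)).
Qed.

(** Everything after the first term is symmetric in [u] and [v], hence disappears from the
    curvature. *)
Lemma pullback_nabla x (u v w : 'rV[R]_n) : U x ->
  J x (nabla g (cst v) (fun y => christoffel g y u w) x) =
  nabla k (cst (J x v)) (fun z => christoffel k z (J x u) (J x w)) (t x)
  + christoffel k (t x) ('D_v ('D_u t) x) (J x w)
  + (christoffel k (t x) (J x u) ('D_v ('D_w t) x) + christoffel k (t x) (J x v) ('D_u ('D_w t) x))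
  + 'D_v ('D_u ('D_w t)) x.
Proof.
move=> Ux.
have JD a b : J x (a + b) = J x a + J x b by rewrite !(jacobian_mx _ Ux) mulmxDl.
have sJm : smooth_on U Jm.
  apply/(smooth_entry oU) => i j; apply: (smooth_ext oU (f := fun y => 'D_('e_i) t y 0 j)).
    by move=> y _; rewrite mxE JE.
  by apply: ((smooth_entry oU _).1); exact: smooth_mx_derive.
have dJm : is_derive x v Jm ('D_v Jm x) := smooth_mx_is_derive oU sJm v Ux.
have dJ (z : 'rV[R]_n) : 'D_v ('D_z t) x = z *m 'D_v Jm x.
  transitivity ('D_v (fun y : 'rV[R]_n => z *m Jm y) x).
    apply: (derive_ext oU Ux) => y Uy.
    by rewrite -JE jacobian_mx.
  have [_ E] := is_derive_mulmx (is_derive_cst z x v) dJm.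
  by apply: (etrans E); rewrite mul0mx add0r.
pose Z (y : 'rV[R]_n) := christoffel g y u w.
have dZ := christoffel_is_derive mg u w v Ux.
have E1 : J x ('D_v Z x) + 'D_v ('D_(Z x) t) x = 'D_v (fun y : 'rV[R]_n => J y (Z y)) x.
  rewrite jacobian_mx// dJ; have [_ E] := is_derive_mulmx dZ dJm.
  apply: (etrans (esym E)); apply: (derive_ext oU Ux) => y Uy; exact: esym (jacobian_mx _ Uy).
have E3 := christoffel_along Ux (jacobian_is_derive u v Ux) (jacobian_is_derive w v Ux).
have E2 : 'D_v (fun y : 'rV[R]_n => J y (Z y)) x =
    'D_(J x v) (fun z : 'rV[R]_n => christoffel k z (J x u) (J x w)) (t x)
    + christoffel k (t x) ('D_v ('D_u t) x) (J x w)
    + christoffel k (t x) (J x u) ('D_v ('D_w t) x) + 'D_v ('D_u ('D_w t)) x.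
  have d2 : derivable ('D_u ('D_w t)) x v.
    by apply: (smooth_mx_derivable oU _ Ux); do 2 apply: (smooth_mx_derive oU).
  have [_ E] := is_deriveD E3 (derivableP d2).
  apply: (etrans _ E); apply: (derive_ext oU Ux) => y Uy; exact: pullback_christoffel.
have E4 : J x (Z x) = christoffel k (t x) (J x u) (J x w) + 'D_u ('D_w t) x.
  exact: pullback_christoffel.
have E5 : J x (christoffel g x v (Z x)) = christoffel k (t x) (J x v) (J x (Z x)) + 'D_v ('D_(Z x) t) x.
  exact: pullback_christoffel.
have E6 := christoffelDr mk (J x v) (christoffel k (t x) (J x u) (J x w))
  ('D_u ('D_w t) x) (UV Ux).
rewrite nabla_cstE JD -/Z.
have {}E6 : christoffel k (t x) (J x v) (J x (Z x)) =
   christoffel k (t x) (J x v) (christoffel k (t x) (J x u) (J x w))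
   + christoffel k (t x) (J x v) ('D_u ('D_w t) x) := etrans (congr1 _ E4) E6.
have {}E1 := etrans E1 E2.
rewrite nabla_cstE -/(Z x).
move: E1 E5 E6 => {E2 E3 E4 dJ dZ}.
generalize (J x ('D_v Z x)) ('D_v ('D_(Z x) t) x) (J x (christoffel g x v (Z x))) => a b c.
generalize (christoffel k (t x) (J x v) (J x (Z x))) => d.
move=> E1 E5 E6; rewrite E5 E6 {E5 E6 c d}.
have -> : a = a + b - b by rewrite addrK.
rewrite E1 {E1}; gen_derive.
repeat match goal with |- context [christoffel ?a ?b ?c ?d] =>
  generalize (christoffel a b c d); intro end.
by apply/rowP => l; rewrite !mxE; ring.
Qed.

Lemma pullback_curvature x (u v w : 'rV[R]_n) : U x -> J x (curvature g x u v w) =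
  curvature k (t x) (J x u) (J x v) (J x w).
Proof.
move=> Ux.
have JB a b : J x (a - b) = J x a - J x b by rewrite !(jacobian_mx _ Ux) mulmxBl.
apply: (etrans (congr1 _ (curvatureE mg u v w Ux))).
apply: (etrans _ (esym (curvatureE mk (J x u) (J x v) (J x w) (UV Ux)))).
apply: (etrans (JB _ _)).
apply: (etrans (congr2 (fun a b => a - b) (pullback_nabla u v w Ux) (pullback_nabla v u w Ux))).
have c1 : 'D_v ('D_u t) x = 'D_u ('D_v t) x := mx_derive_comm oU v u smooth_t Ux.
have c2 : 'D_v ('D_u ('D_w t)) x = 'D_u ('D_v ('D_w t)) x :=
  mx_derive_comm oU v u (smooth_mx_derive oU w smooth_t) Ux.
move: c1 c2; gen_derive => -> ->.
repeat match goal with |- context [christoffel k (t x) ?c ?d] =>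
  generalize (christoffel k (t x) c d); intro end.
repeat match goal with |- context [nabla ?a ?b ?c ?d] => generalize (nabla a b c d); intro end.
by apply/rowP => l; rewrite !mxE; ring.
Qed.

Lemma pullback_flat x (u v w : 'rV[R]_n) : U x -> (forall a b c, curvature k (t x) a b c = 0) ->
  curvature g x u v w = 0.
Proof.
move=> Ux k0; apply: (jacobian_inj Ux); rewrite (pullback_curvature u v w Ux) k0.
by rewrite (jacobian_mx _ Ux) mul0mx.
Qed.

End CoordinateChange.

(** * The Osserman condition at one point, in an orthonormal basis *)

Section OssermanPoint.
Variables (R : realType) (n : nat) (G E : 'M[R]_n).
Hypothesis sG : G^T = G.
Hypothesis EGE : E *m G *m E^T = 1%:M.
Variable W : 'rV[R]_n -> 'rV[R]_n -> 'rV[R]_n -> 'rV[R]_n -> R.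
Hypothesis cW : curvature_like W.

Let Eu : E \in unitmx.
Proof. by have /mulmx1_unit[] : E *m (G *m E^T) = 1%:M by rewrite mulmxA. Qed.

Let Gu : G \in unitmx.
Proof.
have : E *m (G *m E^T) = 1%:M by rewrite mulmxA.
by move=> /mulmx1C; rewrite -mulmxA => /mulmx1_unit[].
Qed.

Lemma sharp_basis f : functional f -> sharp G f = \sum_i f (row i E) *: row i E.
Proof.
move=> lf; apply: (inner_nondeg Gu) => w; rewrite inner_sharp//.
rewrite (functional_sum _ _ _ ((inner_bilinear G).2 w)) -(basis_contract w sG EGE lf).
by apply: eq_bigr => i _; rewrite innerZl mulrC (innerC w _ sG).
Qed.

Definition jacobi_mx u : 'M[R]_n := \matrix_(a, b) W u (row a E) u (row b E).

Lemma jacobi_mx_sym u : (jacobi_mx u)^T = jacobi_mx u.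
Proof. by apply/matrixP => a b; rewrite !mxE (curv_pair cW). Qed.

(** In coordinates the Jacobi operator is only self-adjoint for [G]; conjugation by the orthonormal
    basis makes it a symmetric matrix, to which [trace_sq_eq] applies. *)
Lemma jacobi_mx_conj u :
  lin1_mx (fun v => sharp G (W u v u)) = invmx E *m jacobi_mx u *m E.
Proof.
apply/row_matrixP => k; rewrite rowE.
have -> : 'e_k *m lin1_mx (fun v => sharp G (W u v u)) = sharp G (W u 'e_k u).
  by apply/rowP => j; rewrite -rowE !mxE.
rewrite (sharp_basis (curv_lin cW u 'e_k u)) row_mul mulmx_sum_row.
apply: eq_bigr => b _; congr (_ *: _).
have lf : functional (fun v => W u v u (row b E)) := curv_lin2 cW u u (row b E).
have -> : 'e_k = \sum_a (row k (invmx E)) 0 a *: row a E.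
  by rewrite -mulmx_sum_row -row_mul mulVmx// rowE mulmx1.
rewrite (functional_sum _ _ _ lf) row_mul [RHS]mxE; apply: eq_bigr => a _.
by rewrite (functionalZ _ _ lf) !mxE.
Qed.

Lemma jacobi_mx_rank u a : \rank (eigenspace (lin1_mx (fun v => sharp G (W u v u))) a) =
  \rank (eigenspace (jacobi_mx u) a).
Proof.
rewrite /eigenspace !mxrank_ker jacobi_mx_conj; congr (_ - _)%N.
rewrite -[RHS](rank_conj (P := E) _ Eu) mulmxBr mulmxBl.
by rewrite -[invmx E *m a%:M *m E]mulmxA mul_scalar_mx -scalemxAr mulVmx// scalemx1.
Qed.

Lemma jacobi_mx_trace u : \tr (jacobi_mx u *m jacobi_mx u) =
  \sum_a \sum_b W u (row a E) u (row b E) ^+ 2.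
Proof.
apply: eq_bigr => a _; rewrite mxE; apply: eq_bigr => b _.
by rewrite !mxE (curv_pair cW u (row b E)) expr2.
Qed.

Lemma curvature_like_basis0 : (forall a b c d, W (row a E) (row b E) (row c E) (row d E) = 0) ->
  forall u v w z, W u v w z = 0.
Proof.
move=> W0 u v w z.
rewrite (basis_expand u sG EGE) (functional_sum _ _ _ (curv_lin1 cW v w z)) big1// => a _.
rewrite (functionalZ _ _ (curv_lin1 cW v w z)).
rewrite (basis_expand v sG EGE) (functional_sum _ _ _ (curv_lin2 cW (row a E) w z)).
rewrite big1 ?mulr0// => b _; rewrite (functionalZ _ _ (curv_lin2 cW _ w z)).
rewrite (basis_expand w sG EGE) (functional_sum _ _ _ (curv_lin3 cW (row a E) (row b E) z)).
rewrite big1 ?mulr0// => c _; rewrite (functionalZ _ _ (curv_lin3 cW _ _ z)).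
rewrite (basis_expand z sG EGE) (functional_sum _ _ _ (curv_lin cW (row a E) (row b E) (row c E))).
rewrite big1 ?mulr0// => d _; rewrite (functionalZ _ _ (curv_lin cW _ _ _)).
by rewrite W0 mulr0.
Qed.

Hypothesis osserman : forall u v, inner G u u = 1 -> inner G v v = 1 -> forall a,
  \rank (eigenspace (lin1_mx (fun y => sharp G (W u y u))) a) =
  \rank (eigenspace (lin1_mx (fun y => sharp G (W v y v))) a).

(** The left side is the trace of the squared Jacobi operator at the vector with coordinates [z]:
    constant on unit vectors because the spectra agree, and homogeneous of degree 4. *)
Lemma osserman_trace : exists K, forall z : 'I_n -> R,
  \sum_a \sum_b (\sum_c \sum_d z c * z d * W (row c E) (row a E) (row d E) (row b E)) ^+ 2
  = K * (\sum_c z c ^+ 2) ^+ 2.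
Proof.
pose vec (z : 'I_n -> R) : 'rV[R]_n := \sum_c z c *: row c E.
have WE z a b : \sum_c \sum_d z c * z d * W (row c E) (row a E) (row d E) (row b E) =
    W (vec z) (row a E) (vec z) (row b E).
  rewrite (functional_sum _ _ _ (curv_lin1 cW (row a E) (vec z) (row b E))).
  apply: eq_bigr => c _; rewrite (functionalZ _ _ (curv_lin1 cW _ (vec z) _)).
  rewrite (functional_sum _ _ _ (curv_lin3 cW (row c E) (row a E) (row b E))) mulr_sumr.
  by apply: eq_bigr => d _; rewrite (functionalZ _ _ (curv_lin3 cW _ _ _)) mulrA.
have normE z : inner G (vec z) (vec z) = \sum_c z c ^+ 2.
  rewrite (functional_sum _ _ _ ((inner_bilinear G).2 (vec z))); apply: eq_bigr => c _.
  rewrite innerZl (functional_sum _ _ _ ((inner_bilinear G).1 (row c E))) (bigD1 c)//=.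
  rewrite big1 => [|d dc].
    by rewrite innerZr (basis_orthonormal _ _ EGE) eqxx mulr1 addr0 expr2.
  by rewrite innerZr (basis_orthonormal _ _ EGE) eq_sym (negPf dc) mulr0.
pose N u := \sum_a \sum_b W u (row a E) u (row b E) ^+ 2.
have unitN u v : inner G u u = 1 -> inner G v v = 1 -> N u = N v.
  move=> u1 v1; rewrite /N -!jacobi_mx_trace; apply: trace_sq_eq; try exact: jacobi_mx_sym.
  move=> a; apply: (etrans (esym (jacobi_mx_rank u a))).
  exact: (etrans (osserman u1 v1 a) (jacobi_mx_rank v a)).
have scaleN k u : N (k *: u) = (k ^+ 2) ^+ 2 * N u.
  rewrite /N mulr_sumr; apply: eq_bigr => a _; rewrite mulr_sumr; apply: eq_bigr => b _.
  rewrite (functionalZ _ _ (curv_lin1 cW _ _ _)) (functionalZ _ _ (curv_lin3 cW _ _ _)).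
  by move: (W _ _ _ _) => t; ring.
have main K : (forall u, inner G u u = 1 -> N u = K) -> forall z : 'I_n -> R,
  \sum_a \sum_b (\sum_c \sum_d z c * z d * W (row c E) (row a E) (row d E) (row b E)) ^+ 2
  = K * (\sum_c z c ^+ 2) ^+ 2.
  move=> NK z.
  have pos v : 0 < inner G v v -> N v = K * inner G v v ^+ 2.
    move=> v0; have r0 : Num.sqrt (inner G v v) != 0 by rewrite gt_eqF// sqrtr_gt0.
    have rr : Num.sqrt (inner G v v) ^+ 2 = inner G v v by rewrite sqr_sqrtr// ltW.
    move: (Num.sqrt (inner G v v)) r0 rr => r r0 rr.
    have n1 : inner G (r^-1 *: v) (r^-1 *: v) = 1 by rewrite innerZl innerZr -rr; field.
    have -> : N v = N (r *: (r^-1 *: v)) by rewrite scalerA divff// scale1r.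
    by rewrite (scaleN r) (NK _ n1) rr mulrC.
  under eq_bigr do under eq_bigr do rewrite WE.
  rewrite -/(N (vec z)) -normE; have : 0 <= inner G (vec z) (vec z).
    by rewrite normE; apply: sumr_ge0 => c _; exact: sqr_ge0.
  rewrite le_eqVlt => /orP[/eqP z0|z0].
    have z00 c : z c = 0.
      have := normE z; rewrite -z0 => /esym/eqP; rewrite psumr_eq0 => [|d _]; last exact: sqr_ge0.
      by move=> /allP/(_ c (mem_index_enum c)) /=; rewrite sqrf_eq0 => /eqP.
    have -> : vec z = 0 *: vec z.
      by rewrite scale0r /vec big1// => c _; rewrite z00 scale0r.
    by rewrite scaleN innerZl; ring.
  exact: pos.
(* Unit vectors are missing only in dimension 0, where K = 0 is as good as any value. *)
case: (pselect (exists u, inner G u u = 1)) => [[u u1]|nou].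
  by exists (N u); apply: main => v v1; exact: unitN.
by exists 0; apply: main => v v1; case: nou; exists v.
Qed.

End OssermanPoint.

Section ConformalChange.
Variables (R : realType) (n : nat) (U : set 'rV[R]_n) (g : 'rV[R]_n -> 'M[R]_n).
Variable h : 'rV[R]_n -> R.
Hypothesis mg : metric_on U g.

Let oU := metric_open mg.
Let sym_g := metric_sym mg.
Let unit_g := metric_unit mg.
Hypothesis smooth_h : smooth_on U h.
Hypothesis h_neq0 : forall x, U x -> h x != 0.

Lemma conformal_change x : U x -> exists P,
  [/\ bilinear_form P, (forall a b, P a b = P b a) &
   forall u v w z, riemann (fun y => h y *: g y) x u v w z =
     h x * (riemann g x u v w z - bullet P (inner (g x)) u v w z)].
Proof.
(* Half the gradient of ln h, the field that the conformal change formula is stated for. *)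
move=> Ux; pose T (y : 'rV[R]_n) := sharp (g y) (fun u => 'D_u h y / (2 * h y)).
have hT y (u : 'rV[R]_n) : U y -> 'D_u h y = 2 * h y * inner (g y) (T y) u.
  move=> Uy; rewrite inner_sharp ?unit_g//; last first.
    move=> a v w; rewrite (derive_linear a v w (smooth_differentiable oU smooth_h Uy)).
    have sc (p q : R) : p *: q = p * q by [].
    by rewrite !sc mulrDl mulrA.
  by gen_derive; field; exact: h_neq0.
have sT : smooth_on U T.
  apply: (smooth_mulmx oU); last exact: (smooth_invmx oU unit_g (metric_smooth mg)).
  apply/(smooth_entry oU) => i j.
  apply: (smooth_ext oU (f := fun y => 'D_('e_j) h y * (2 * h y)^-1)).
    by move=> y _; rewrite mxE.
  apply: (smoothM oU); first exact: smooth_derive.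
  apply: (smoothV oU); first by move=> y Uy; rewrite mulf_neq0// ?h_neq0// pnatr_eq0.
  by apply: (smoothM oU) => //; exact: smooth_cst.
have sP := conformal_hessian_sym mg smooth_h h_neq0 sT hT.
have PC a b : conformal_schouten g T x a b = conformal_schouten g T x b a.
  rewrite /conformal_schouten; move: (sP x a b Ux) (innerC a b (sym_g Ux)).
  generalize (nabla g (cst a) T x) (nabla g (cst b) T x) => na nb.
  by gen_inner => -> ->; ring.
exists (conformal_schouten g T x); split => //; last first.
  by move=> u v w z; exact: (conformal_riemann mg smooth_h h_neq0 sT hT).
have lin a : functional (conformal_schouten g T x a).
  move=> c v w; rewrite /conformal_schouten; generalize (nabla g (cst a) T x) => na.
  by rewrite !innerDr !innerZr; gen_inner; ring.
split=> [|b c v w]; first exact: lin.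
by rewrite (PC _ b) (PC v b) (PC w b); exact: lin.
Qed.

End ConformalChange.

Lemma curvature_like0 (R : realType) n (A : 'rV[R]_n -> 'rV[R]_n -> 'rV[R]_n -> 'rV[R]_n -> R) u v w z :
  curvature_like A -> [|| u == 0, v == 0, w == 0 | z == 0] -> A u v w z = 0.
Proof.
move=> cA /or4P[] /eqP ->.
- exact: functional0 (curv_lin1 cA v w z).
- exact: functional0 (curv_lin2 cA u w z).
- exact: functional0 (curv_lin3 cA u v z).
- exact: functional0 (curv_lin cA u v w).
Qed.

Section WarpedMetric.
Variables (R : realType) (m n : nat) (U1 : set 'rV[R]_m) (U2 : set 'rV[R]_n).
Variables (gB : 'rV[R]_m -> 'M[R]_m) (gF : 'rV[R]_n -> 'M[R]_n) (f : 'rV[R]_m -> R).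
Hypothesis rB : riemannian_on U1 gB.
Hypothesis rF : riemannian_on U2 gF.
Hypothesis smooth_f : smooth_on U1 f.
Hypothesis f_gt0 : forall x, 0 < f x.
Hypothesis m_gt0 : (0 < m)%N.
Hypothesis n_gt0 : (0 < n)%N.
Hypothesis dim_gt3 : (3 < m + n)%N.

Let U : set 'rV[R]_(m + n) := [set x | U1 (lsubmx x) /\ U2 (rsubmx x)].

Definition warped_metric (x : 'rV[R]_(m + n)) : 'M[R]_(m + n) :=
  block_mx (gB (lsubmx x)) 0 0 (f (lsubmx x) ^+ 2 *: gF (rsubmx x)).

Let g1 x := (f x ^+ 2)^-1 *: gB x.
Let h (x : 'rV[R]_(m + n)) := f (lsubmx x) ^+ 2.

Lemma warped_metric_conformal : warped_metric = fun x => h x *: product_metric g1 gF x.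
Proof.
apply/funext => x; rewrite /warped_metric /product_metric /h /g1.
by rewrite scale_block_mx !scaler0 scalerA divff ?scale1r// expf_neq0// gt_eqF.
Qed.

Let r1 : riemannian_on U1 g1.
Proof.
have f2 x : 0 < f x ^+ 2 by rewrite exprn_gt0// f_gt0.
split=> [|x u Ux u0]; last by rewrite innerZg mulr_gt0 ?invr_gt0// (riemannian_pos rB).
apply: (conformal_metric rB) => [|x _]; last by rewrite invr_eq0 gt_eqF.
have oU1 := metric_open rB.
by apply: (smoothV oU1) => [x _|]; [rewrite gt_eqF|exact: smoothX].
Qed.

Let h_smooth : smooth_on U h.
Proof.
move=> k; apply: (Ck_sub (U := [set x | U1 (lsubmx x)])); first by move=> x [].
apply: (@Ck_lsubmx _ _ _ k _ _ (fun y => f y ^+ 2)); exact: (smoothX (metric_open rB) 2 smooth_f).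
Qed.

Lemma warped_riemannian_on : riemannian_on U warped_metric.
Proof.
have h0 x : 0 < h x by rewrite exprn_gt0// f_gt0.
split.
  rewrite warped_metric_conformal; apply: (conformal_metric (product_metric_on r1 rF) h_smooth).
  by move=> x _; rewrite gt_eqF.
move=> x u [x1 x2] u0; rewrite warped_metric_conformal innerZg /product_metric inner_block.
rewrite mulr_gt0//.
have ge0 p (G : 'M[R]_p) (v : 'rV[R]_p) : (v != 0 -> 0 < inner G v v) -> 0 <= inner G v v.
  by have [->|v0 H] := eqVneq v 0; [rewrite inner0l|exact: ltW (H isT)].
have B0 := ge0 _ _ _ (@riemannian_pos _ _ _ _ r1 _ (lsubmx u) x1).
have F0 := ge0 _ _ _ (@riemannian_pos _ _ _ _ rF _ (rsubmx u) x2).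
have [l0|l0] := eqVneq (lsubmx u) 0; last by apply: ltr_wpDr => //; exact: (riemannian_pos r1).
apply: ltr_wpDl => //; apply: (riemannian_pos rF x2).
by apply: contraNneq u0 => r0; rewrite -(hsubmxK u) l0 r0 row_mx0.
Qed.

Lemma warped_osserman_weyl0 x : U x ->
  (forall u v, inner (warped_metric x) u u = 1 -> inner (warped_metric x) v v = 1 -> forall a,
   \rank (eigenspace (lin1_mx (conformal_jacobi warped_metric x u)) a) =
   \rank (eigenspace (lin1_mx (conformal_jacobi warped_metric x v)) a)) ->
  forall u v w z, weyl warped_metric x u v w z = 0.
Proof.
move=> Ux oss; have [x1 x2] := Ux.
have rW := warped_riemannian_on.
have h0 y : U y -> h y != 0 by move=> _; rewrite expf_neq0// gt_eqF// f_gt0.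
have [P [bP sP RP]] := conformal_change (product_metric_on r1 rF) h_smooth h0 Ux.
have [E1 EGE1] := riemannian_basis rB x1.
have [E2 EGE2] := riemannian_basis rF x2.
have t0 : f (lsubmx x) != 0 by rewrite gt_eqF// f_gt0.
(* Orthonormal bases of the two factors, the second rescaled by 1/f to be orthonormal for f^2
   g_F. *)
pose E : 'M[R]_(m + n) := block_mx E1 0 0 ((f (lsubmx x))^-1 *: E2).
have EGE : E *m warped_metric x *m E^T = 1%:M.
  rewrite /E /warped_metric tr_block_mx !trmx0 !mulmx_block.
  rewrite !(mulmx0, mul0mx, addr0, add0r) EGE1 [(_ *: E2)^T]linearZ/=.
  rewrite -!scalemxAl -!scalemxAr -!scalemxAl EGE2.
  rewrite !scalerA expr2 -?mulrA mulKf// mulVf// scale1r.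
  by rewrite -scalar_mx_block.
have sG := metric_sym rW Ux.
have n2 : (2 < m + n)%N by apply: ltnW.
have cW := weyl_curvature_like rW Ux EGE.
apply: (curvature_like_basis0 sG EGE cW).
have [K HK] := osserman_trace sG EGE cW oss.
pose L (i : 'I_(m + n)) := (i < m)%N.
have lE i : ~~ L i -> lsubmx (row i E) = 0.
  case: (split_ordP i) => j -> Lj; first by case/negP: Lj; exact: (ltn_ord j).
  by apply/rowP => k; rewrite [LHS]mxE [LHS]mxE /E block_mxEdl !mxE.
have rE i : L i -> rsubmx (row i E) = 0.
  case: (split_ordP i) => j -> Lj; last by move: Lj; rewrite /L ltnNge leq_addr.
  by apply/rowP => k; rewrite [LHS]mxE [LHS]mxE /E block_mxEur !mxE.
have c1 := riemann_curvature_like r1 x1.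
have c2 := riemann_curvature_like rF x2.
(* With k the product metric, R_g = h (R_k - P . k) and h k = g, so that W = h R_k - (P + C) . g
   with C the Schouten tensor: this gives [A] and [S]. *)
pose A a b c d := h x * riemann (product_metric g1 gF) x (row a E) (row b E) (row c E) (row d E).
pose S a b := P (row a E) (row b E) + schouten warped_metric x (row a E) (row b E).
apply: (@weyl_split_zero _ _ L _ A S) => //.
- by move=> a b c d; exact: (curv12 cW).
- by move=> a b c d; exact: (curv34 cW).
- by move=> a b c d; exact: (curv_pair cW).
- move=> b d; rewrite -[RHS](weyl_trace rW Ux EGE n2 (row b E) (row d E)).
  by apply: eq_bigr => a _; rewrite (curv12 cW) (curv34 cW) opprK.
- move=> a b c d; rewrite -!(basis_orthonormal _ _ EGE) /A /S /weyl.
  have := RP (row a E) (row b E) (row c E) (row d E); rewrite -warped_metric_conformal => ->.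
  rewrite /bullet warped_metric_conformal !innerZg.
  move: (schouten _ x) (riemann _ x _ _ _ _) => s r.
  by gen_inner; move: (h x) => k; ring.
- by move=> a b; rewrite /S sP (schouten_sym rW Ux EGE).
(* The product curvature is the sum of those of the factors; when the indices lie on both sides,
   each summand receives a zero vector. *)
- move=> a b c d mix; rewrite /A (product_riemann r1 rF _ _ _ _ Ux).
  rewrite (curvature_like0 c1) ?(curvature_like0 c2) ?addr0 ?mulr0//.
    have zE i : L i ==> (rsubmx (row i E) == 0) by apply/implyP => /rE ->.
    move: mix (zE a) (zE b) (zE c) (zE d).
    case: (L a); case: (L b); case: (L c); case: (L d) => //=;
      move: (rsubmx _ == 0) (rsubmx _ == 0) (rsubmx _ == 0) (rsubmx _ == 0);
      by do 4!case.
  have zE i : ~~ L i ==> (lsubmx (row i E) == 0) by apply/implyP => /lE ->.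
  move: mix (zE a) (zE b) (zE c) (zE d).
  case: (L a); case: (L b); case: (L c); case: (L d) => //=;
    move: (lsubmx _ == 0) (lsubmx _ == 0) (lsubmx _ == 0) (lsubmx _ == 0);
    by do 4!case.
- by rewrite card_ord.
- by exists (lshift n (Ordinal m_gt0)); exists (rshift m (Ordinal n_gt0)); rewrite /L/= m_gt0 addn0 ltnn.
- by move=> a b c d; exact: (curv_bianchi cW).
Qed.

End WarpedMetric.

(** * From charts to the manifold *)

Section Manifold.
Variables (R : realType) (n : nat) (M : riemannian_data R n).
Hypothesis hM : is_riemannian M.

Lemma chart_riemannian_on (i : chart_index M) :
  riemannian_on (chart_img (chart_at i)) (metric i).
Proof.
apply: posdef_riemannian_on; first exact: chart_img_open (riem_chart hM i).
- exact: riem_smooth.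
- exact: riem_sym.
- by move=> x u; exact: riem_pos.
Qed.

(** The factor is constructed in one chart [i0] around [p], but flatness is required in every chart
    meeting [U]: there h g is the pullback of the flat metric by [transition i i0]. *)
Lemma weyl0_conformally_flat : (3 < n)%N ->
  (forall (i : chart_index M) x, chart_img (chart_at i) x ->
    forall u v w z, weyl (metric i) x u v w z = 0) -> locally_conformally_flat M.
Proof.
move=> n3 W0 p; have [i0 p0] := riem_cover hM p.
have c0 := riem_chart hM i0.
have [e [h [e0 eU sh h0 flat]]] := weyl_flat_conformal (chart_riemannian_on i0) n3
  (fun x u v w z xi => W0 i0 x xi u v w z) (to_chart_img c0 p0).
pose V := [set x | `|x - to_chart (chart_at i0) p| < e].
have oV : open V by exact: open_normball.
pose U := chart_dom (chart_at i0) `&` to_chart (chart_at i0) @^-1` V.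
have oU : open U.
  rewrite openE => q [qd qV]; apply: filterI.
    by apply: open_nbhs_nbhs; split => //; exact: chart_dom_open c0.
  by apply: (to_chart_continuous c0 qd); exact: open_nbhs_nbhs.
pose O (i : chart_index M) := chart_img_of U i.
have oO i : open (O i) by apply: open_chart_img_of => //; exact: riem_chart hM i.
have Odom i : O i `<=` chart_img_of (chart_dom (chart_at i0)) i by move=> x [xi [xd _]].
have OV i x : O i x -> V (transition i i0 x) by move=> [_ [_ xV]].
have st i : smooth_on (O i) (transition i i0).
  by move=> k; apply: (Ck_sub (@Odom i)); exact: (riem_transition hM).
have shi i : smooth_on (O i) (fun x => h (transition i i0 x)).
  exact: (smooth_comp (oO i) oV (@OV i) (st i) sh).
exists U; exists (fun q => h (to_chart (chart_at i0) q)); split => //.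
- by split => //; rewrite /V/= subrr normr0.
- by move=> q [_ qV]; exact: h0.
- move=> i x Ox u v w.
  have hn0 y : V y -> h y != 0 by move=> Vy; rewrite gt_eqF// h0.
  have mi := riemannian_on_sub (oO i) (@subIsetl _ _ _) (chart_riemannian_on i).
  have m0 := riemannian_on_sub oV eU (chart_riemannian_on i0).
  apply: (@pullback_flat _ _ (O i) V _ (fun y => h y *: metric i0 y)
    (conformal_metric mi (shi i) (fun y Oy => hn0 _ (OV i y Oy))) (conformal_metric m0 sh hn0)
    (transition i i0) (@OV i) (st i) _ (fun x u => 'D_u (transition i i0) x)) => //.
  + move=> y a b Oy; rewrite innerZg mxE; congr (_ * _).
    exact: (riem_compat hM (@Odom i y Oy)).
  + by move=> a b c; apply: flat; exact: OV Ox.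
Qed.

(** Flatness of h g leaves R = P . g, and such a P can only be the Schouten tensor. *)
Lemma conformally_flat_weyl0 : (2 < n)%N -> locally_conformally_flat M ->
  forall (i : chart_index M) x, chart_img (chart_at i) x ->
    forall u v w z, weyl (metric i) x u v w z = 0.
Proof.
move=> n2 lcf i x xi.
have ci := riem_chart hM i.
have [U [h [oU Ux sh h0 flat]]] := lcf (from_chart (chart_at i) x).
pose O := chart_img_of U i.
have oO : open O by exact: open_chart_img_of.
have Ox : O x by split.
have Oimg : O `<=` chart_img (chart_at i) by move=> y [].
pose hi y := h (from_chart (chart_at i) y).
have hi0 y : O y -> hi y != 0 by move=> [_ Uy]; rewrite gt_eqF// h0.
have rO := riemannian_on_sub oO Oimg (chart_riemannian_on i).
have [P [bP sP RP]] := conformal_change rO (sh i) hi0 Ox.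
apply: (weyl_eq0_of_bullet rO n2 Ox bP sP) => u v w z.
have := RP u v w z; rewrite /riemann flat// inner0l => /esym/eqP.
by rewrite mulf_eq0 (negPf (hi0 x Ox)) subr_eq0 => /eqP.
Qed.

Lemma weyl0_conformally_osserman :
  (forall (i : chart_index M) x, chart_img (chart_at i) x ->
    forall u v w z, weyl (metric i) x u v w z = 0) -> conformally_osserman M.
Proof.
move=> W0 p i pi g x u v _ _ a.
have xi : chart_img (chart_at i) x := to_chart_img (riem_chart hM i) pi.
suff E w : conformal_jacobi g x w = fun _ => 0 by rewrite !E.
apply/funext => y; rewrite /conformal_jacobi /sharp.
rewrite (_ : \row_k _ = 0) ?mul0mx//.
by apply/rowP => k; rewrite !mxE W0.
Qed.

End Manifold.

Theorem theorem1p1 (R : realType) (m n : nat)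
    (B : riemannian_data R m) (F : riemannian_data R n) (f : B -> R)
    (hB : is_riemannian B) (hF : is_riemannian F)
    (hm : (0 < m)%N) (hn : (0 < n)%N) (hmn : (4 <= m + n)%N)
    (f_smooth : smooth_fun setT f) (f_gt0 : forall p : B, 0 < f p) :
  conformally_osserman (warped_product B F f) <->
  locally_conformally_flat (warped_product B F f).
Proof.
have hM := warped_product_riemannian hB hF f_smooth f_gt0.
split=> [oss|lcf].
  apply: (weyl0_conformally_flat hM hmn) => -[i j] x [x1 x2].
  have cB := riem_chart hB i; have cF := riem_chart hF j.
  have sf : smooth_on (chart_img (chart_at i)) (fun y => f (from_chart (chart_at i) y)).
    by move=> k; apply: (Ck_sub _ (f_smooth i k)) => y yi; split.
  apply: (@warped_osserman_weyl0 R m n _ _ (metric i) (metric j)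
    (fun y => f (from_chart (chart_at i) y)) (chart_riemannian_on hB i)
    (chart_riemannian_on hF j) sf _ hm hn hmn x) => //.
  have := oss (from_chart (chart_at i) (lsubmx x), from_chart (chart_at j) (rsubmx x)) (i, j).
  rewrite /= (from_chartK cB x1) (from_chartK cF x2) hsubmxK; apply.
  by split; [exact: (from_chart_dom cB)|exact: (from_chart_dom cF)].
apply: (weyl0_conformally_osserman hM); apply: (conformally_flat_weyl0 hM _ lcf).
exact: ltnW.
Qed.
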